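(* Let $N\cong\mathbb{Z}^d$ be a lattice with $d\ge 3$, and let $P\subseteq N_{\mathbb{R}}$ be a simplicial reflexive polytope of dimension $d$ with exactly $3d-1$ vertices. If $d$ is even, then $P$ splits into one copy of $\tilde V_2$, or of $E_1$, or of $E_2$, together with $(d-2)/2$ copies of $V_2$. If $d$ is odd, then $P$ splits into one copy of $Q_3$, or of $Q_3'$, together with $(d-3)/2$ copies of $V_2$.
   Context: Let $N\cong\mathbb{Z}^d$ be a lattice, $N_{\mathbb{R}}=N\otimes_{\mathbb{Z}}\mathbb{R}$, $M=\mathrm{Hom}_{\mathbb{Z}}(N,\mathbb{Z})$, $M_{\mathbb{R}}=M\otimes_{\mathbb{Z}}\mathbb{R}$, with pairing $\langle\cdot,\cdot\rangle$. A lattice polytope $P\subseteq N_{\mathbb{R}}$ is the convex hull of finitely many points of $N$. A $d$-dimensional lattice polytope $P$ with the origin in its interior is reflexive if its dual $P^*=\{x\in M_{\mathbb{R}} : \langle x,y\rangle\le 1\ \forall y\in P\}$ is a lattice polytope (with respect to $M$). $P$ is simplicial if every facet is a simplex. Two lattice polytopes are isomorphic (unimodularly equivalent) if a lattice isomorphism maps the vertex set of one onto that of the other. Splitting: $P\subseteq N_{\mathbb{R}}$ splits into $P_1,\dots,P_k$ if there is a direct sum decomposition $N=N_1\oplus\cdots\oplus N_k$ of lattices such that each $P_i\subseteq (N_i)_{\mathbb{R}}$ is a lattice polytope with respect to $N_i$ and $P$ is the convex hull of $P_1\cup\cdots\cup P_k$. (Then each $P_i$ is reflexive with respect to $N_i$.)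 A ''copy'' of a polytope $Q$ means a lattice polytope isomorphic to $Q$; if $k=1$, splitting into one copy of $Q$ means being isomorphic to $Q$. The following polytopes are given with respect to $\mathbb{Z}^2$, respectively $\mathbb{Z}^3$, up to isomorphism: $V_2=\mathrm{conv}\{\pm(1,0),\pm(0,1),\pm(1,-1)\}$ (the reflexive hexagon); $\tilde V_2=\mathrm{conv}\{\pm(1,0),\pm(0,1),(1,-1)\}$; $E_1=\mathrm{conv}\{(1,0),(1,1),(0,1),(-1,-1),(-1,-2)\}$; $E_2=\mathrm{conv}\{(1,0),(0,1),(-1,1),(-1,-1),(1,-1)\}$ (the last three are the reflexive polygons with exactly five vertices); $Q_3=\mathrm{conv}\big((V_2\times\{0\})\cup\{(0,0,1),(0,0,-1)\}\big)$; $Q_3'=\mathrm{conv}\big((V_2\times\{0\})\cup\{(0,0,1),(1,0,-1)\}\big)$ (a bipyramid over the hexagon whose two apexes add up to a vertex of the hexagon). *)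

(* Defs.v *)
From mathcomp Require Import all_boot all_order all_algebra.
From mathcomp Require Import all_classical all_reals topology normedtype.

Set Implicit Arguments.
Unset Strict Implicit.
Unset Printing Implicit Defensive.

Import Order.TTheory GRing.Theory Num.Theory.
Import numFieldNormedType.Exports.
Local Open Scope classical_set_scope.
Local Open Scope ring_scope.

Definition conv (R : realType) (V : lmodType R) (A : set V) : set V :=
  [set x | exists n (a : 'I_n -> V) (t : 'I_n -> R),
     [/\ forall i, A (a i), forall i, 0 <= t i,
         \sum_(i < n) t i = 1 & x = \sum_(i < n) t i *: a i]].

Definition affinely_free (R : realType) (V : vectType R) (s : seq V) : bool :=
  if s is x :: s' then free [seq y - x | y <- s'] else true.

Definition has_dim (R : realType) (V : vectType R) (A : set V) (n : nat) : Prop :=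
  (exists s : seq V, [/\ [set` s] `<=` A, affinely_free s & size s = n.+1]) /\
  (forall s : seq V, [set` s] `<=` A -> affinely_free s -> (size s <= n.+1)%N).

(* The linear forms 'Hom(V, R^o) are the dual vector space of V.  Every such u
   is allowed, so P itself (u = 0, c = 0) and set0 (u = 0, c = 1) are faces. *)
Definition face (R : realType) (V : vectType R) (P F : set V) : Prop :=
  exists (u : 'Hom(V, R^o)) (c : R),
    (forall y, P y -> u y <= c) /\ F = [set y | P y /\ u y = c].

Definition facet (R : realType) (V : vectType R) (P F : set V) : Prop :=
  face P F /\ exists n, has_dim P n.+1 /\ has_dim F n.

Definition vertices (R : realType) (V : vectType R) (P : set V) : set V :=
  [set v | face P [set v]].

Definition simplex (R : realType) (V : vectType R) (F : set V) : Prop :=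
  exists s : seq V, affinely_free s /\ F = conv [set` s].

Definition simplicial (R : realType) (V : vectType R) (P : set V) : Prop :=
  forall F, facet P F -> simplex F.

(* A lattice is given inside a real vector space V, as the integral span of
   R-linearly independent vectors; the real span of these is the vector space
   L (x) R.  In particular, L has full rank in V, i.e. V = L (x) R, exactly
   when its rank r is the dimension of V. *)
Definition is_lattice (R : realType) (V : vectType R) (r : nat) (L : set V) :
    Prop :=
  exists b : r.-tuple V, free b /\
    L = [set x | exists z : 'I_r -> int, x = \sum_(i < r) b`_i *~ z i].

(* The dual lattice Hom(N, Z), as a subset of the dual space, for N of full
   rank. *)
Definition dual_lattice (R : realType) (V : vectType R) (N : set V) :
    set 'Hom(V, R^o) :=
  [set u | forall y, N y -> (u y : R) \is a Num.int].

Definition lattice_polytope (R : realType) (V : lmodType R) (L P : set V) :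
    Prop :=
  exists s : seq V, [set` s] `<=` L /\ P = conv [set` s].

Definition dual_polytope (R : realType) (V : vectType R) (P : set V) :
    set 'Hom(V, R^o) :=
  [set u | forall y, P y -> u y <= 1].

Definition reflexive_polytope (R : realType) (d : nat) (N P : set 'rV[R]_d) : Prop :=
  [/\ has_dim P d, lattice_polytope N P, interior P 0 &
      lattice_polytope (dual_lattice N) (dual_polytope P)].

(* L and L' may live in spaces of different dimensions; f only matters on L. *)
Definition isomorphic (R : realType) (V W : vectType R)
    (L P : set V) (L' P' : set W) : Prop :=
  exists f : V -> W,
    [/\ forall x y, L x -> L y -> f (x + y) = f x + f y,
        set_bij L L' f & f @` vertices P = vertices P'].

Definition lattice_direct_sum (R : realType) (V : vectType R) (N : set V)
    (k : nat) (Ns : 'I_k -> set V) : Prop :=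
  [/\ forall i, exists r, is_lattice r (Ns i),
      N = [set \sum_(i < k) x i | x in [set x | forall i, Ns i (x i)]] &
      forall x y : 'I_k -> V, (forall i, Ns i (x i)) -> (forall i, Ns i (y i)) ->
        \sum_(i < k) x i = \sum_(i < k) y i -> forall i, x i = y i].

Definition splits (R : realType) (V : vectType R) (N P : set V)
    (k : nat) (Ns Ps : 'I_k -> set V) : Prop :=
  [/\ lattice_direct_sum N Ns,
      forall i, lattice_polytope (Ns i) (Ps i) &
      P = conv (\bigcup_i Ps i)].

Definition Zlattice (R : realType) (n : nat) : set 'rV[R]_n :=
  [set x | forall j, x 0 j \is a Num.int].
Arguments Zlattice : clear implicits.

(* P splits into one copy of Q together with m copies of Q'. *)
Definition splits_into (R : realType) (V : vectType R) (N P : set V)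
    (n : nat) (Q : set 'rV[R]_n) (m : nat) (n' : nat) (Q' : set 'rV[R]_n') :
    Prop :=
  exists Ns Ps : 'I_m.+1 -> set V,
    [/\ splits N P Ns Ps,
        isomorphic (Ns ord0) (Ps ord0) (Zlattice R n) Q &
        forall i, i != ord0 -> isomorphic (Ns i) (Ps i) (Zlattice R n') Q'].

Definition pt2 (R : realType) (a b : int) : 'rV[R]_2 :=
  \row_(j < 2) ([:: a; b]`_j)%:~R.

Definition pt3 (R : realType) (a b c : int) : 'rV[R]_3 :=
  \row_(j < 3) ([:: a; b; c]`_j)%:~R.

Definition V2 (R : realType) : set 'rV[R]_2 :=
  conv [set` [:: pt2 R 1 0; pt2 R (-1) 0; pt2 R 0 1; pt2 R 0 (-1);
                 pt2 R 1 (-1); pt2 R (-1) 1]].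
Arguments V2 : clear implicits.

Definition V2t (R : realType) : set 'rV[R]_2 :=
  conv [set` [:: pt2 R 1 0; pt2 R (-1) 0; pt2 R 0 1; pt2 R 0 (-1);
                 pt2 R 1 (-1)]].
Arguments V2t : clear implicits.

Definition E1 (R : realType) : set 'rV[R]_2 :=
  conv [set` [:: pt2 R 1 0; pt2 R 1 1; pt2 R 0 1; pt2 R (-1) (-1);
                 pt2 R (-1) (-2)]].
Arguments E1 : clear implicits.

Definition E2 (R : realType) : set 'rV[R]_2 :=
  conv [set` [:: pt2 R 1 0; pt2 R 0 1; pt2 R (-1) 1; pt2 R (-1) (-1);
                 pt2 R 1 (-1)]].
Arguments E2 : clear implicits.

(* 'rV_3 is 'rV_(2 + 1), and row_mx v 0 is the point (v, 0). *)
Definition V2x0 (R : realType) : set 'rV[R]_3 :=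
  [set row_mx v (0 : 'rV[R]_1) | v in V2 R].
Arguments V2x0 : clear implicits.

Definition Q3 (R : realType) : set 'rV[R]_3 :=
  conv (V2x0 R `|` [set` [:: pt3 R 0 0 1; pt3 R 0 0 (-1)]]).
Arguments Q3 : clear implicits.

Definition Q3' (R : realType) : set 'rV[R]_3 :=
  conv (V2x0 R `|` [set` [:: pt3 R 0 0 1; pt3 R 1 0 (-1)]]).
Arguments Q3' : clear implicits.

(* Main.v *)
(** Every facet of [P] has a basis of vertices e_1, ..., e_d and an integral form
    u equal to 1 on it, so the vertices lie on the levels u = 1, 0, -1, ...  A
    vertex on level 0 with a negative i-th coordinate is the new vertex of the
    facet adjacent along e_i; hence at most d vertices lie on level 0.  For a
    facet whose cone contains the sum nu of all vertices, the levels sum up to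
    u(nu) >= 0, and 3d - 1 vertices leave three possibilities: u(nu) = 1 with
    d, d, d - 1 vertices on the levels 1, 0, -1; nu = 0 with d, d, d - 2, 1
    vertices on the levels 1, 0, -1, -2; nu = 0 with d, d - 1, d vertices on the
    levels 1, 0, -1.

    Passing to adjacent facets whose cone still contains nu, the vertices on
    level 0 turn out to be differences e_(phi i) - e_i and those on level -1 the
    -e_i, where phi is an involution outside a block of two or three indices.
    Each pair {i, phi i} spans a hexagon, and the block carries the rest: if nu
    is a vertex, it is [V2t] or [Q3'], and if nu is the midpoint of two vertices
    it is [E1]; if nu = 0 and some vertex has level -2, it is [E2]; otherwise all
    facets have levels >= -1 only, so P = -P, and the block is [Q3].

    Facets and adjacent facets are produced by the pivot steps of the simplex
    algorithm; a facet with y in its cone is one that maximises u(y). *)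

From HB Require Import structures.
Require Import Defs.
From mathcomp Require Import all_boot all_order all_algebra finmap.
From mathcomp Require Import all_classical all_reals topology normedtype.
From mathcomp Require Import ring lra zify.

Set Implicit Arguments.
Unset Strict Implicit.
Unset Printing Implicit Defensive.

Import Order.TTheory GRing.Theory Num.Theory.
Import numFieldNormedType.Exports.
Local Open Scope ring_scope.

(** * Coordinates in a basis and the exchange of one basis vector *)

Section Coordinates.
Variables (R : fieldType) (d : nat).
Implicit Types (B : 'M[R]_d) (v w : 'rV[R]_d) (i j : 'I_d).

(** The obstacle is that the vertices of a facet need not span the lattice. The positive integers
    [kap B i] measure the defect: the forms of two adjacent facets are integral on the lattice and
    differ by [kap B i] times the i-th coordinate. If all of them are 1, the rows are a lattice
    basis. An adjacent facet with d vertices on level 0 forces [kap B i = 1], so the proof stays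
    among such facets as long as it can; in the case of E1 two of the numbers are 2.

    Level -1 is read off from level 0: a vertex with i-th coordinate -1 moves to level 0 of the
    facet adjacent along i, where it is a difference of two rows. As [phi] depends on the facet, it
    is compared on adjacent facets. What remains open is settled by counting: the coordinates of all
    vertices add up to those of [nu], and terms of known sign have to cancel.

    These arguments involve only a finite list V and a choice [nb] of neighbours; the geometry of P
    enters afterwards and provides both. *)

Definition crd B v i : R := (v *m invmx B) 0 i.
Definition lev B v : R := \sum_i crd B v i.
Definition repl B i w : 'M[R]_d := \matrix_j (if j == i then w else row j B).

Lemma crdD B v w i : crd B (v + w) i = crd B v i + crd B w i.
Proof. by rewrite /crd mulmxDl mxE. Qed.
Lemma crdN B v i : crd B (- v) i = - crd B v i.
Proof. by rewrite /crd mulNmx mxE. Qed.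
Lemma crdB B v w i : crd B (v - w) i = crd B v i - crd B w i.
Proof. by rewrite crdD crdN. Qed.
Lemma crdZ B a v i : crd B (a *: v) i = a * crd B v i.
Proof. by rewrite /crd -scalemxAl mxE. Qed.
Lemma crd0 B i : crd B 0 i = 0.
Proof. by rewrite /crd mul0mx mxE. Qed.
Lemma crd_sum B I (r : seq I) (Q : pred I) (F : I -> 'rV[R]_d) i :
  crd B (\sum_(k <- r | Q k) F k) i = \sum_(k <- r | Q k) crd B (F k) i.
Proof.
by apply: (big_morph (fun v => crd B v i)) => [v w|]; rewrite ?crdD ?crd0.
Qed.

Lemma levD B v w : lev B (v + w) = lev B v + lev B w.
Proof. by rewrite -big_split /=; apply: eq_bigr => i _; rewrite crdD. Qed.
Lemma levN B v : lev B (- v) = - lev B v.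
Proof. by rewrite /lev -sumrN; apply: eq_bigr => i _; rewrite crdN. Qed.
Lemma levB B v w : lev B (v - w) = lev B v - lev B w.
Proof. by rewrite levD levN. Qed.
Lemma levZ B a v : lev B (a *: v) = a * lev B v.
Proof. by rewrite /lev mulr_sumr; apply: eq_bigr => i _; rewrite crdZ. Qed.
Lemma lev0 B : lev B 0 = 0.
Proof. by rewrite /lev big1 // => i _; rewrite crd0. Qed.
Lemma lev_sum B I (r : seq I) (Q : pred I) (F : I -> 'rV[R]_d) :
  lev B (\sum_(k <- r | Q k) F k) = \sum_(k <- r | Q k) lev B (F k).
Proof. by apply: (big_morph (lev B)) => [v w|]; rewrite ?levD ?lev0. Qed.

Lemma crd_row B i j : B \in unitmx -> crd B (row i B) j = (i == j)%:R.
Proof. by move=> Bu; rewrite /crd -row_mul mulmxV // !mxE. Qed.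

Lemma lev_row B i : B \in unitmx -> lev B (row i B) = 1.
Proof.
move=> Bu; rewrite /lev (bigD1 i) //= crd_row // eqxx big1 ?addr0 // => j.
by rewrite crd_row // eq_sym => /negbTE->.
Qed.

Lemma crdE B v : B \in unitmx -> v = \sum_i crd B v i *: row i B.
Proof.
move=> Bu; rewrite -[LHS]mulmx1 -(mulVmx Bu) mulmxA.
by rewrite mulmx_sum_row.
Qed.

Lemma crdP B v w : B \in unitmx -> (forall i, crd B v i = crd B w i) -> v = w.
Proof.
by move=> Bu e; rewrite (crdE v Bu) (crdE w Bu); apply: eq_bigr => i _; rewrite e.
Qed.

Lemma row_repl B i w j : row j (repl B i w) = if j == i then w else row j B.
Proof. by apply/rowP => k; rewrite !mxE; case: ifP => //; rewrite !mxE. Qed.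

Lemma row_inj B i j : B \in unitmx -> row i B = row j B -> i = j.
Proof.
move=> Bu e; have := crd_row i i Bu; rewrite e crd_row // eqxx => /eqP.
by case: (altP (j =P i)) => // _; rewrite eq_sym oner_eq0.
Qed.

Section Replacement.
Variables (B : 'M[R]_d) (i : 'I_d) (w : 'rV[R]_d).
Hypotheses (Bu : B \in unitmx) (wi : crd B w i != 0).

(** The inverse of [repl B i w], taken from the pivot formulas: [row i B] is eliminated by means of
    the expansion of [w]. *)
Let Psi : 'M[R]_d := \matrix_(k, j)
  (if j == i then invmx B k i / crd B w i
   else invmx B k j - crd B w j / crd B w i * invmx B k i).

Let crdPsi v j : (v *m Psi) 0 j = if j == i then crd B v i / crd B w i
  else crd B v j - crd B w j / crd B w i * crd B v i.
Proof.
rewrite mxE; case: ifP => ji.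
  rewrite [crd B v i]mxE mulr_suml; apply: eq_bigr => k _.
  by rewrite mxE ji mulrA.
rewrite [crd B v i]mxE [crd B v j]mxE mulr_sumr -sumrB; apply: eq_bigr => k _.
rewrite mxE ji; ring.
Qed.

Let replK : repl B i w *m Psi = 1%:M.
Proof.
apply/matrixP => k j.
transitivity ((row k (repl B i w) *m Psi) 0 j); first by rewrite -row_mul [RHS]mxE.
rewrite crdPsi row_repl mxE; case: (altP (k =P i)) => [->|ki].
  rewrite (eq_sym i); case: ifP => ji; first by rewrite divff.
  by rewrite divfK // subrr.
rewrite !crd_row // (negbTE ki) mulr0 subr0 mul0r; case: ifP => // /eqP ->.
by rewrite (negbTE ki).
Qed.

Lemma repl_unit : repl B i w \in unitmx.
Proof. by case: (mulmx1_unit replK). Qed.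

Lemma crd_repl v j : crd (repl B i w) v j =
  if j == i then crd B v i / crd B w i
  else crd B v j - crd B w j / crd B w i * crd B v i.
Proof.
rewrite -crdPsi /crd; congr (_ _ _).
have -> : invmx (repl B i w) = Psi.
  by rewrite -[LHS]mulmx1 -replK mulmxA mulVmx ?mul1mx // repl_unit.
by [].
Qed.

(** Both forms are 1 on the rows other than [row i B], so they differ by a multiple of the i-th
    coordinate; the value 1 at [w] determines the multiple. *)
Lemma lev_repl v :
  lev (repl B i w) v = lev B v + (1 - lev B w) / crd B w i * crd B v i.
Proof.
rewrite {1}/lev (bigD1 i) //= crd_repl eqxx.
under eq_bigr => j ji do rewrite crd_repl (negbTE ji).
have sumN1 x : \sum_(j | j != i) crd B x j = lev B x - crd B x i.
  by apply/esym/eqP; rewrite subr_eq addrC; apply/eqP/bigD1.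
by rewrite sumrB /= -!mulr_suml !sumN1; field.
Qed.

End Replacement.
End Coordinates.

(** * Pairing of indices by a fixed-point-free involution *)

Section InvolutionPairs.
Variables (d : nat) (T : seq 'I_d) (f : 'I_d -> 'I_d).
Hypothesis T_uniq : uniq T.
Hypothesis fP : forall i, i \notin T -> [/\ f i \notin T, f i != i & f (f i) = i].

Lemma involution_pairs : exists m (rep : 'I_m -> 'I_d),
  [/\ d = (size T + 2 * m)%N, forall k, rep k \notin T,
    forall i, i \notin T -> exists k, i \in [:: rep k; f (rep k)] &
    forall i k k', i \in [:: rep k; f (rep k)] -> i \in [:: rep k'; f (rep k')] ->
      k = k'].
Proof.
(* Each pair is represented by its smaller index. *)
pose A := [set i | (i \notin T) && (i < f i)%N].
have AP i : i \in A -> i \notin T /\ (i < f i)%N by rewrite inE => /andP [].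
exists #|A|, (fun k => enum_val k); split.
- have finj : {in A &, injective f}.
    move=> i j /AP [iT _] /AP [jT _] e; have [_ _ <-] := fP iT.
    by have [_ _ <-] := fP jT; rewrite e.
  have e : ~: [set i in T] = A :|: f @: A.
    apply/setP => i; rewrite !inE; have [iT|iT] /= := boolP (i \in T).
      apply/esym/negbTE/imsetP => -[j /AP [jT _] e].
      by have [fjT _ _] := fP jT; rewrite -e iT in fjT.
    have [fiT fi ffi] := fP iT; apply/esym.
    move: fi; rewrite neq_ltn => /orP [fi|-> //].
    by apply/orP; right; apply/imsetP; exists (f i); rewrite // inE fiT ffi.
  have dis : A :&: f @: A = finset.set0.
    apply/setP => i; rewrite !inE; apply/negbTE/negP.
    move=> /andP [/andP [iT ii] /imsetP [j /AP [jT jj] e']].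
    have [_ _ ffj] := fP jT; move: ii; rewrite e' ffj ltnNge.
    by rewrite (ltnW jj).
  have := cardsC [set i in T]; rewrite card_ord e cardsU dis cards0 subn0.
  rewrite (card_in_imset finj) cardsE (card_uniqP T_uniq).
  by move=> e2; rewrite -[LHS]e2 mul2n addnn.
- by move=> k; have [] := AP _ (enum_valP k).
- move=> i iT; have [fiT fi ffi] := fP iT.
  move: fi; rewrite neq_ltn => /orP [fi|fi].
    have fA : f i \in A by rewrite inE fiT ffi.
    exists (enum_rank_in fA (f i)).
    by rewrite enum_rankK_in // ffi !inE eqxx orbT.
  have iA : i \in A by rewrite inE iT.
  by exists (enum_rank_in iA i); rewrite enum_rankK_in // inE eqxx.
move=> i k k'; have [kT kk] := AP _ (enum_valP k); have [_ _ fk] := fP kT.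
have [k'T kk'] := AP _ (enum_valP k'); have [_ _ fk'] := fP k'T.
rewrite !inE => h h'; apply: enum_val_inj.
case/orP: h h' => /eqP -> /orP [] /eqP // e.
- by move: kk; rewrite e fk' ltnNge (ltnW kk').
- by move: kk'; rewrite -e fk ltnNge (ltnW kk).
- by rewrite -fk e fk'.
Qed.

End InvolutionPairs.

(** * Integrality *)

Section IntegralReals.
Variable R : archiRealFieldType.
Implicit Types x y : R.

Lemma int_lt1 x : x \is a Num.int -> x < 1 -> x <= 0.
Proof.
by move=> /intrP [m ->]; rewrite -[1]/(1%:~R) -[0]/(0%:~R) ltr_int ler_int; lia.
Qed.

Lemma int_gt0 x : x \is a Num.int -> 0 < x -> 1 <= x.
Proof.
by move=> /intrP [m ->]; rewrite -[1]/(1%:~R) -[0]/(0%:~R) ltr_int ler_int; lia.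
Qed.

Lemma int_gtN1 x : x \is a Num.int -> -1 < x -> 0 <= x.
Proof.
move=> xi xN; have : 1 <= x + 1 by apply: int_gt0; [rewrite rpredD ?rpred1|lra].
by lra.
Qed.

Lemma int_lt0 x : x \is a Num.int -> x < 0 -> x <= -1.
Proof.
move=> xi x0; have : 1 <= - x by apply: int_gt0; [rewrite rpredN|lra].
by lra.
Qed.

(** Used to recognise a vector with such coordinates as a single row of a frame. *)
Lemma sum1_int (I : finType) (f : I -> R) :
  (forall i, f i \is a Num.int) -> (forall i, 0 <= f i) -> \sum_i f i = 1 ->
  exists j, forall i, f i = (i == j)%:R.
Proof.
move=> fi f0 s1.
have [j fj] : exists j, 0 < f j.
  apply/existsP; apply: contraT; rewrite negb_exists => /forallP h.
  suff: \sum_i f i = 0 by rewrite s1 => /eqP; rewrite oner_eq0.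
  by apply: big1 => i _; apply/eqP; rewrite eq_le f0 leNgt h.
have fj1 := int_gt0 (fi j) fj.
move: s1; rewrite (bigD1 j) //= => s1.
have r0 : 0 <= \sum_(i | i != j) f i by apply: sumr_ge0.
have r00 : \sum_(i | i != j) f i = 0 by lra.
exists j => i; case: (altP (i =P j)) => [->|ij]; first by rewrite /=; lra.
by move/psumr_eq0P: r00 => ->.
Qed.

End IntegralReals.

Lemma cardsC_pair n (p q : 'I_n) : p != q -> #|~: [set p; q]|.+1 = (n - 1)%N.
Proof.
move=> pq; rewrite cardsCs finset.setCK cards2 card_ord pq.
by move: pq (ltn_ord p) (ltn_ord q); rewrite -val_eqE /=; lia.
Qed.

(* [lra] fails on hypotheses that are equalities of vectors or of indices. *)
Ltac rlra :=
  repeat match goal with H : @eq ?T _ _ |- _ =>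
    let T' := eval hnf in T in
    lazymatch T' with matrix _ _ _ => clear H | ordinal _ => clear H end
  end; lra.

(** * Facets, neighbouring facets and levels *)

Section FacetFrames.
Variables (R : archiRealFieldType) (d : nat).
Variables (N : 'rV[R]_d -> Prop) (V : seq 'rV[R]_d).
Implicit Types (B : 'M[R]_d) (v w x : 'rV[R]_d) (i j : 'I_d).

(* The rows of [B] are the vertices of a facet, and [lev B] is the linear form
   equal to 1 on it. *)
Record frame B : Prop := Frame {
  frame_unit : B \in unitmx;
  frame_row : forall i, row i B \in V;
  frame_int : forall x, N x -> lev B x \is a Num.int;
  frame_le1 : forall v, v \in V -> lev B v <= 1;
  frame_top : forall v, v \in V -> lev B v = 1 -> exists i, v = row i B }.

Variable nb : 'M[R]_d -> 'I_d -> 'rV[R]_d.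
Definition adj B i := repl B i (nb B i).
(** The drop in level of the removed row. By [lev_adj] it is also the factor of the i-th coordinate
    in the difference of the two forms, so it clears the denominators of that coordinate on the
    lattice. *)
Definition kap B i := 1 - lev (adj B i) (row i B).

Hypotheses (VN : forall v, v \in V -> N v) (V_uniq : uniq V) (V0 : 0 \notin V).
Hypothesis V_size : size V = (3 * d - 1)%N.
Hypothesis nbV : forall B i, frame B -> nb B i \in V.
Hypothesis nb_lt0 : forall B i, frame B -> crd B (nb B i) i < 0.
Hypothesis adj_frame : forall B i, frame B -> frame (adj B i).

Lemma frame_intV B v : frame B -> v \in V -> lev B v \is a Num.int.
Proof. by move=> fB vV; apply: (frame_int fB); apply: VN. Qed.

Lemma crd_adj B i v j : frame B -> crd (adj B i) v j =
  if j == i then crd B v i / crd B (nb B i) i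
  else crd B v j - crd B (nb B i) j / crd B (nb B i) i * crd B v i.
Proof.
by move=> fB; rewrite crd_repl ?(frame_unit fB) // lt_eqF // nb_lt0.
Qed.

Section OneFrame.
Variables (B : 'M[R]_d) (fB : frame B).
Let Bu := frame_unit fB.

Lemma row_uniq : uniq [seq row i B | i <- enum 'I_d].
Proof. by rewrite map_inj_uniq ?enum_uniq // => i j; apply: row_inj. Qed.

Lemma kapE i : kap B i = - (1 - lev B (nb B i)) / crd B (nb B i) i.
Proof.
rewrite /kap lev_repl ?lt_eqF ?nb_lt0 // lev_row // crd_row // eqxx /=; ring.
Qed.

Lemma lev_adj i v : lev (adj B i) v = lev B v - kap B i * crd B v i.
Proof. rewrite kapE lev_repl ?lt_eqF ?nb_lt0 //; ring. Qed.

Lemma kap_nb i : kap B i * crd B (nb B i) i = lev B (nb B i) - 1.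
Proof. by rewrite kapE divfK ?lt_eqF ?nb_lt0 //; ring. Qed.

Lemma kap_int i : kap B i \is a Num.int.
Proof.
by rewrite rpredB ?rpred1 // (frame_intV (adj_frame i fB)) // frame_row.
Qed.

Lemma nb_top i v : v \in V -> crd B v i < 0 -> lev (adj B i) v = 1 -> v = nb B i.
Proof.
move=> vV vi l1; have [j vE] := frame_top (adj_frame i fB) vV l1.
move: vi; rewrite vE row_repl; case: ifP => // ji.
by rewrite crd_row // ji ltxx.
Qed.

(** The removed row does not lie on the adjacent facet, so its integral level there is at most 0. *)
Lemma kap_ge1 i : 1 <= kap B i.
Proof.
apply: int_gt0 (kap_int i) _.
have := frame_le1 (adj_frame i fB) (frame_row fB i).
rewrite le_eqVlt => /orP [/eqP l1|]; last by rewrite subr_gt0.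
have [j] := frame_top (adj_frame i fB) (frame_row fB i) l1.
rewrite row_repl; case: ifP => [_ e|ji /(row_inj Bu) e].
  by have := nb_lt0 i fB; rewrite -e crd_row // eqxx ltr10.
by rewrite e eqxx in ji.
Qed.

Lemma kap_crd_int i x : N x -> kap B i * crd B x i \is a Num.int.
Proof.
move=> Nx; have -> : kap B i * crd B x i = lev B x - lev (adj B i) x.
  by rewrite lev_adj; ring.
by rewrite rpredB // ?(frame_int fB) // (frame_int (adj_frame i fB)).
Qed.

(** By [nb_top] the new vertex is the only one on the adjacent facet with a negative i-th
    coordinate; any other such vertex has an integral level below 1 there. *)
Lemma crd_ge_or_nb i v : v \in V -> v != nb B i ->
  crd B v i < 0 -> lev B v - kap B i * crd B v i <= 0.
Proof.
move=> vV vnb vi; have fA := adj_frame i fB; rewrite -lev_adj.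
apply: int_lt1; first exact: frame_intV.
rewrite lt_neqAle (frame_le1 fA vV) andbT; apply: contra vnb => /eqP l1.
by apply/eqP/nb_top.
Qed.

(** The level on the adjacent facet is [- kap B i * crd B v i], which is positive, against the bound
    of [crd_ge_or_nb] for all other vertices. *)
Lemma lev0_nb i v : v \in V -> lev B v = 0 -> crd B v i < 0 -> v = nb B i.
Proof.
move=> vV l0 vi; apply/eqP; apply: contraT => vnb.
have := crd_ge_or_nb vV vnb vi; rewrite l0; have := kap_ge1 i; nra.
Qed.

Lemma lev0_kap i v : v \in V -> lev B v = 0 -> crd B v i < 0 ->
  kap B i * crd B v i = -1.
Proof.
by move=> vV l0 vi; have := kap_nb i; rewrite -(lev0_nb vV l0 vi) l0 => ->; ring.
Qed.

Lemma lev0_ge i v : v \in V -> lev B v = 0 -> -1 <= crd B v i.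
Proof.
move=> vV l0; have [v0|vi] := leP 0 (crd B v i); first by lra.
by have := lev0_kap vV l0 vi; have := kap_ge1 i; nra.
Qed.

Lemma crd_ge0_lev0 v : (forall i, 0 <= crd B v i) -> lev B v = 0 -> v = 0.
Proof.
move=> v0 /psumr_eq0P vE; apply: (crdP Bu) => i; rewrite crd0.
by apply: vE.
Qed.

Lemma lev0_lt0 v : v \in V -> lev B v = 0 -> exists i, crd B v i < 0.
Proof.
move=> vV l0; apply/existsP; apply: contraT; rewrite negb_exists => /forallP h.
move: V0; rewrite -(crd_ge0_lev0 (v := v)) ?vV // => i.
by rewrite leNgt h.
Qed.

Definition L0 := [seq v <- V | lev B v == 0].
Definition Lneg := [seq v <- V | lev B v < 0].

Lemma mem_L0 v : (v \in L0) = (v \in V) && (lev B v == 0).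
Proof. by rewrite mem_filter andbC. Qed.
Lemma mem_Lneg v : (v \in Lneg) = (v \in V) && (lev B v < 0).
Proof. by rewrite mem_filter andbC. Qed.

Lemma V_perm : perm_eq V ([seq row i B | i <- enum 'I_d] ++ L0 ++ Lneg).
Proof.
apply: uniq_perm => //.
  rewrite !cat_uniq row_uniq !filter_uniq // !andbT /=; apply/andP; split.
    apply/hasPn => v; rewrite mem_cat mem_L0 mem_Lneg => h.
    apply/mapP => -[i _ e]; move: h.
    by rewrite e lev_row // oner_eq0 ltr10 !andbF.
  apply/hasPn => v; rewrite /= mem_Lneg mem_L0 => /andP [_ h].
  by rewrite lt_eqF ?andbF.
move=> v; rewrite !mem_cat mem_L0 mem_Lneg.
apply/idP/idP => [vV|/orP [/mapP [i _ ->]|/orP [] /andP [] //]]; last first.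
  exact: frame_row.
rewrite vV /=; case: (ltgtP (lev B v) 0) => [_|l1|_]; rewrite ?orbT // ?orbF.
have [|i ->] := frame_top fB vV; last by apply: map_f; rewrite mem_enum.
by apply/eqP; rewrite eq_le (frame_le1 fB vV) /= int_gt0 // frame_intV.
Qed.

Lemma V_sum (M : nmodType) (f : 'rV[R]_d -> M) : \sum_(v <- V) f v =
  \sum_i f (row i B) + \sum_(v <- L0) f v + \sum_(v <- Lneg) f v.
Proof. by rewrite (perm_big _ V_perm) !big_cat /= big_map big_enum addrA. Qed.

Lemma V_size_lev : (size L0 + size Lneg = 2 * d - 1)%N.
Proof.
have : size V = (d + (size L0 + size Lneg))%N.
  by rewrite (perm_size V_perm) !size_cat size_map size_enum_ord.
by rewrite V_size; lia.
Qed.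

Lemma L0_sub : {subset L0 <= [seq nb B i | i <- enum 'I_d]}.
Proof.
move=> v; rewrite mem_L0 => /andP [vV /eqP l0].
have [i vi] := lev0_lt0 vV l0.
by rewrite (lev0_nb vV l0 vi); apply: map_f; rewrite mem_enum.
Qed.

Lemma L0_size : (size L0 <= d)%N.
Proof.
have := uniq_leq_size (filter_uniq _ V_uniq) L0_sub.
by rewrite size_map size_enum_ord.
Qed.

Definition full := size L0 == d.

Section Full.
Hypothesis fullB : full.

Let nbs := [seq nb B i | i <- enum 'I_d].

Let full_size : size nbs = size L0.
Proof. by rewrite size_map size_enum_ord (eqP fullB). Qed.

Let L0_uniq : uniq L0. Proof. exact: filter_uniq. Qed.

(** The d distinct elements of [L0] are found among the d neighbours, so no neighbour is repeated or
    left over. *)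
Let L0_eq : L0 =i nbs.
Proof. by apply: (uniq_min_size L0_uniq L0_sub _).2; rewrite full_size. Qed.

Lemma nb_inj : injective (nb B).
Proof.
move=> i j e; have := leq_size_uniq L0_uniq L0_sub; rewrite full_size.
move=> /(_ (leqnn _)) /injectiveP; exact.
Qed.

Lemma full_sum (M : nmodType) (f : 'rV[R]_d -> M) :
  \sum_(v <- L0) f v = \sum_i f (nb B i).
Proof.
have nbs_uniq : uniq nbs by rewrite (leq_size_uniq L0_uniq L0_sub) // full_size.
by rewrite (perm_big nbs) ?uniq_perm // big_map big_enum.
Qed.

Lemma full_lev i : lev B (nb B i) = 0.
Proof.
have : nb B i \in L0 by rewrite L0_eq; apply: map_f; rewrite mem_enum.
by rewrite mem_L0 => /andP [_ /eqP].
Qed.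

Lemma fullP v : v \in V -> lev B v = 0 -> exists i, v = nb B i.
Proof.
move=> vV l0; have : v \in L0 by rewrite mem_L0 vV l0 /=.
by rewrite L0_eq => /mapP [i _ ->]; exists i.
Qed.

(** A second negative coordinate would make [nb B i] the neighbour along j as well, against
    injectivity. *)
Lemma full_ge0 i j : i != j -> 0 <= crd B (nb B i) j.
Proof.
move=> ij; rewrite leNgt; apply: contra ij => /(lev0_nb (nbV i fB) (full_lev i)).
by move/nb_inj => ->.
Qed.

Lemma full_kap i : kap B i * crd B (nb B i) i = -1.
Proof. by rewrite kap_nb full_lev sub0r. Qed.

Lemma full_Lneg_size : size Lneg = (d - 1)%N.
Proof. by have := V_size_lev; rewrite (eqP fullB); lia. Qed.

End Full.
End OneFrame.

(** The neighbour y has a positive i-th coordinate with respect to B, so level 0 gives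
    [lev B y = kap B i * crd B y i > 0]. Hence y is a row of B with positive i-th coordinate, that
    is, the removed row. *)
Lemma kap_nb_adj B i : frame B -> lev (adj B i) (nb (adj B i) i) = 0 ->
  kap B i = 1.
Proof.
move=> fB; have fA := adj_frame i fB; have k1 := kap_ge1 fB i.
set y := nb (adj B i) i; have yV : y \in V by exact: nbV.
rewrite lev_adj // => ly; have := nb_lt0 i fA.
rewrite -/y crd_adj // eqxx nmulr_llt0 ?invr_lt0 ?nb_lt0 // => yi.
have l1 : lev B y = 1.
  apply/eqP; rewrite eq_le (frame_le1 fB yV) /=.
  by apply: int_gt0; [apply: frame_intV|nra].
have [j yE] := frame_top fB yV l1; move: yi ly.
rewrite yE lev_row ?crd_row ?(frame_unit fB) //.
by case: (j == i) => /=; lra.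
Qed.

Lemma kap_full_adj B i : frame B -> full (adj B i) -> kap B i = 1.
Proof.
by move=> fB fuA; apply: kap_nb_adj => //; apply: full_lev => //; apply: adj_frame.
Qed.

(** * The vertex sum and the distribution of the levels *)

Definition nu := \sum_(v <- V) v.

Lemma crd_nu B i : crd B nu i = \sum_(v <- V) crd B v i.
Proof. exact: crd_sum. Qed.

Lemma frame_nu_cases B : (0 < d)%N -> frame B -> (forall i, 0 <= crd B nu i) ->
  (full B /\ lev B nu = 1 /\ forall v, v \in V -> -1 <= lev B v) \/
  nu = 0 /\ (
  (full B /\ exists z, [/\ z \in V, lev B z = -2 &
       forall v, v \in V -> v != z -> -1 <= lev B v]) \/
  (size (L0 B) = (d - 1)%N /\ forall v, v \in V -> -1 <= lev B v)).
Proof.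
move=> d0 fB nu0.
have levnu : 0 <= lev B nu by apply: sumr_ge0.
have e : lev B nu = d%:R + \sum_(v <- Lneg B) lev B v.
  rewrite lev_sum (V_sum fB) [X in _ + X + _]big_seq [X in _ + X + _]big1.
    rewrite addr0 (eq_bigr (fun _ => 1)) => [|i _]; last first.
      by rewrite lev_row ?(frame_unit fB).
    by rewrite sumr_const card_ord.
  by move=> v; rewrite mem_L0 => /andP [_ /eqP].
have neg v : v \in Lneg B -> lev B v <= -1.
  by rewrite mem_Lneg => /andP [vV]; apply: int_lt0; apply: frame_intV.
have nneg v : v \in V -> v \notin Lneg B -> -1 <= lev B v.
  by rewrite mem_Lneg => -> /=; rewrite -leNgt => h; lra.
have sz := V_size_lev fB; have s0 := L0_size fB.
(* [h] is the depth below level -1. Its sum over [Lneg] is [d - size (Lneg B) - lev B nu], which is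
   [1 - lev B nu] if d vertices have level 0 and at most 0 otherwise; it is never negative. *)
pose h v : R := - 1 - lev B v.
have h0 v : v \in Lneg B -> 0 <= h v by move/neg; rewrite /h; lra.
have hs : \sum_(v <- Lneg B) h v = d%:R - (size (Lneg B))%:R - lev B nu.
  rewrite e /h sumrB big_const_seq count_predT iter_addr_0.
  by rewrite -mulr_natr; ring.
have hs0 : 0 <= \sum_(v <- Lneg B) h v.
  by rewrite big_seq; apply: sumr_ge0 => v /h0.
have hz : \sum_(v <- Lneg B) h v = 0 -> forall v, v \in V -> -1 <= lev B v.
  rewrite big_seq => /eqP; rewrite psumr_eq0; last by move=> v; apply: h0.
  move=> /allP hall v vV; have [vL|] := boolP (v \in Lneg B); last exact: nneg.
  by have := hall _ vL; rewrite vL /h /= subr_eq0 => /eqP <-.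
have lev_nu0 : lev B nu = 0 -> nu = 0 by exact: crd_ge0_lev0.
have nu_int : lev B nu \is a Num.int.
  by rewrite lev_sum big_seq rpred_sum // => v vV; apply: frame_intV.
have [f|nf] := boolP (full B).
  have szn := full_Lneg_size fB f; rewrite szn natrB // in hs.
  have [lnu|lnu] := ltP (lev B nu) 1; last first.
    left; split=> //; have hs00 : \sum_(v <- Lneg B) h v = 0 by lra.
    by split; [lra|apply: hz].
  right; have lnu0 : lev B nu = 0 by have := int_lt1 nu_int lnu; lra.
  split; first exact: lev_nu0.
  left; split=> //.
  have [z zL hz0] : exists2 z, z \in Lneg B & 0 < h z.
    apply/hasP; apply: contraT => /hasPn hn.
    suff : \sum_(v <- Lneg B) h v = 0 by lra.
    rewrite big_seq big1 // => v vL; apply/eqP; rewrite eq_le h0 //.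
    by rewrite leNgt hn.
  have Lu : uniq (Lneg B) by apply: filter_uniq.
  have hz1 : 1 <= h z.
    apply: int_gt0 hz0; move: zL; rewrite mem_Lneg => /andP [zV _].
    by rewrite rpredB ?rpredN ?rpred1 // frame_intV.
  move: hs; rewrite (big_rem z) //= => hs.
  have r0 : 0 <= \sum_(v <- rem z (Lneg B)) h v.
    by rewrite big_seq; apply: sumr_ge0 => v /mem_rem/h0.
  have hz2 : h z = 1 by lra.
  have r00 : \sum_(v <- rem z (Lneg B)) h v = 0 by lra.
  exists z; split; first by move: zL; rewrite mem_Lneg => /andP [].
    by move: hz2; rewrite /h => hz2; lra.
  move=> v vV vz; have [vL|] := boolP (v \in Lneg B); last exact: nneg.
  have vr : v \in rem z (Lneg B) by rewrite mem_rem_uniq // inE vz.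
  have : h v <= \sum_(u <- rem z (Lneg B)) h u.
    rewrite (big_rem v) //= lerDl big_seq; apply: sumr_ge0 => u /mem_rem/mem_rem.
    exact: h0.
  by rewrite r00 /h => ?; lra.
have szL : (size (L0 B) < d)%N by rewrite ltn_neqAle nf L0_size.
have szn : (d <= size (Lneg B))%N by lia.
have szn' : d%:R <= (size (Lneg B))%:R :> R by rewrite ler_nat.
right; split; first by apply: lev_nu0; lra.
right; split; last by apply: hz; lra.
have : (size (Lneg B))%:R <= d%:R :> R by lra.
by rewrite ler_nat; lia.
Qed.

(** * Facets whose vertices form a lattice basis *)

Lemma row_adj B i j : row j (adj B i) = if j == i then nb B i else row j B.
Proof. exact: row_repl. Qed.

(* A frame is good when its rows form a lattice basis and the [d] vertices at
   level 0 are differences of rows. *)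
Definition good B := full B /\ forall i, kap B i = 1.

(** The default [i] is a dummy value: where [nb_phi] applies, an index with the required property
    exists. *)
Definition phi B i : 'I_d := odflt i [pick j | nb B i == row j B - row i B].

Lemma nb_phi B i : frame B -> lev B (nb B i) = 0 -> crd B (nb B i) i = -1 ->
    (forall k, k != i -> 0 <= crd B (nb B i) k) ->
    (forall k, crd B (nb B i) k \is a Num.int) ->
  nb B i = row (phi B i) B - row i B.
Proof.
move=> fB li ci c0 cint; have Bu := frame_unit fB.
(* Adding [row i B] cancels the only negative coordinate and raises the level to 1, so [sum1_int]
   yields a single row. *)
pose f k := crd B (nb B i) k + (k == i)%:R.
have [|||j fj] := @sum1_int R _ f.
- by move=> k; rewrite rpredD ?rpred_nat.
- move=> k; rewrite /f; have [->|ki] := eqVneq k i; first by rewrite ci addNr.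
  by rewrite addr0 c0.
- rewrite big_split /= -/(lev B _) li add0r.
  by rewrite (bigD1 i) //= eqxx big1 ?addr0 // => k /negbTE ->.
have E : nb B i = row j B - row i B.
  apply: (crdP Bu) => k; rewrite crdB !crd_row //.
  by have := fj k; rewrite /f !(eq_sym k) => <-; rewrite addrK.
by rewrite /phi; case: pickP => [k /eqP //|/(_ j)]; rewrite E eqxx.
Qed.

Section Good.
Variables (B : 'M[R]_d) (fB : frame B) (gB : good B).
Let Bu := frame_unit fB.

Lemma good_crd_int x i : N x -> crd B x i \is a Num.int.
Proof. by move=> Nx; have := kap_crd_int fB i Nx; rewrite gB.2 mul1r. Qed.

Lemma good_nb i : nb B i = row (phi B i) B - row i B.
Proof.
apply: nb_phi => //; first exact: (full_lev fB gB.1).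
- by rewrite -(full_kap fB gB.1 i) gB.2 mul1r.
- by move=> k ki; apply: full_ge0 => //; rewrite ?gB.1 // eq_sym.
- by move=> k; apply/good_crd_int/VN/nbV.
Qed.

Lemma phi_neq i : phi B i != i.
Proof.
apply/eqP => e; have := nb_lt0 i fB.
by rewrite good_nb e subrr crd0 ltxx.
Qed.

Lemma good_crd_nb i j : crd B (nb B i) j = (phi B i == j)%:R - (i == j)%:R.
Proof. by rewrite good_nb crdB !crd_row. Qed.

Lemma good_crd_adj i v j : crd (adj B i) v j =
  if j == i then - crd B v i else crd B v j + (phi B i == j)%:R * crd B v i.
Proof.
rewrite crd_adj // !good_crd_nb eqxx (negbTE (phi_neq i)) sub0r.
case: ifP => ji; first by rewrite invrN1 mulrN1.
by rewrite (eq_sym i) ji subr0 invrN1; ring.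
Qed.

Lemma good_lev_adj i v : lev (adj B i) v = lev B v - crd B v i.
Proof. by rewrite lev_adj // gB.2 mul1r. Qed.

Lemma good_lev0 v : v \in V -> lev B v = 0 ->
  exists i, v = row (phi B i) B - row i B.
Proof.
by move=> vV /(fullP fB gB.1 vV) [i ->]; exists i; rewrite -good_nb.
Qed.

Lemma good_crd_nu i : crd B nu i =
  \sum_l (phi B l == i)%:R + \sum_(v <- Lneg B) crd B v i.
Proof.
rewrite crd_nu (V_sum fB) (full_sum fB gB.1); congr (_ + _).
rewrite -big_split /=; apply: eq_bigr => l _.
by rewrite crd_row // good_crd_nb addrC subrK.
Qed.

End Good.

(** The vertex has level 0 on the adjacent facet, hence is a difference of two rows there. Its i-th
    coordinate has become 1, so the positive one is the new row
    [nb B i = row (phi B i) B - row i B]. *)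
Lemma good_step B i v : frame B -> good B -> good (adj B i) ->
  v \in V -> lev B v = -1 -> crd B v i = -1 ->
  exists2 j, j != i & v = row (phi B i) B - row i B - row j B.
Proof.
move=> fB gB gA vV lv vi; have fA := adj_frame i fB; have Au := frame_unit fA.
have lAv : lev (adj B i) v = 0 by rewrite good_lev_adj // lv vi subrr.
have [a vE] := good_lev0 fA gA vV lAv.
have := good_crd_adj fB gB i v i; rewrite eqxx vi opprK {1}vE crdB !crd_row //.
case: (altP (phi (adj B i) a =P i)) => [e|_] /eqP; last first.
  by case: (a == i); rewrite /= ?subr0 -subr_eq0 ?sub0r; lra.
case: (altP (a =P i)) => [_|ai _]; first by rewrite subrr eq_sym oner_eq0.
by exists a; rewrite // vE e !row_adj eqxx (negbTE ai) good_nb.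
Qed.

Lemma sum_eq1 (T : eqType) (s : seq T) (a : T) : uniq s ->
  \sum_(v <- s) (v == a)%:R = (a \in s)%:R :> R.
Proof.
move=> us; rewrite -count_uniq_mem // -sum1_count natr_sum.
by rewrite [RHS]big_mkcond /=; apply: eq_bigr => v _; case: (v == a).
Qed.

(** * Facets whose cone contains a nonzero vertex sum *)

Section NonzeroSum.
Hypotheses (d_gt0 : (0 < d)%N) (nu_neq0 : nu != 0).

Definition special B := forall i, 0 <= crd B nu i.

Section Special.
Variables (B : 'M[R]_d) (fB : frame B) (sB : special B).
Let Bu := frame_unit fB.

Lemma special_full : full B.
Proof.
by case: (frame_nu_cases d_gt0 fB sB) => [[]|[/eqP]] //; rewrite (negbTE nu_neq0).
Qed.

Lemma special_lev_nu : lev B nu = 1.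
Proof.
by case: (frame_nu_cases d_gt0 fB sB) => [[_ []]|[/eqP]] //; rewrite (negbTE nu_neq0).
Qed.

Lemma special_lev_ge v : v \in V -> -1 <= lev B v.
Proof.
case: (frame_nu_cases d_gt0 fB sB) => [[_ [_]]|[/eqP]]; first exact.
by rewrite (negbTE nu_neq0).
Qed.

Lemma special_Lneg v : v \in Lneg B -> lev B v = -1.
Proof.
rewrite mem_Lneg => /andP [vV v0]; apply/eqP; rewrite eq_le special_lev_ge //.
by rewrite int_lt0 // frame_intV.
Qed.

(** A row with coefficient 0 in [nu] can be exchanged without changing the coefficients; such pivots
    keep [nu] in the cone. *)
Lemma special_crd_adj i j : crd B nu i = 0 -> crd (adj B i) nu j = crd B nu j.
Proof.
by move=> nui; rewrite crd_adj // nui mul0r mulr0 subr0; case: eqP => // ->.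
Qed.

Lemma special_adj i : crd B nu i = 0 -> special (adj B i).
Proof. by move=> nui j; rewrite special_crd_adj. Qed.

End Special.

Lemma special_kap B i : frame B -> special B -> crd B nu i = 0 -> kap B i = 1.
Proof.
move=> fB sB nui; apply: kap_full_adj => //.
by apply: special_full (special_adj _ _ _) => //; apply: adj_frame.
Qed.

Lemma special_crd_le B i v : frame B -> special B -> crd B nu i = 0 ->
  v \in V -> crd B v i <= lev B v + 1.
Proof.
move=> fB sB nui vV.
have := special_lev_ge (adj_frame i fB) (special_adj fB sB nui) vV.
by rewrite lev_adj // (special_kap fB sB nui); lra.
Qed.

(** The level on the adjacent facet is at least -1, which gives [crd B v i <= 0]; for a negative
    coordinate it is at most 0, which gives [-1 <= crd B v i]. *)
Lemma special_Lneg_crd B i v : frame B -> special B -> crd B nu i = 0 ->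
  v \in Lneg B -> crd B v i = 0 \/ crd B v i = -1.
Proof.
move=> fB sB nui vL; have lv := special_Lneg fB sB vL.
move: (vL); rewrite mem_Lneg => /andP [vV _].
have k1 := special_kap fB sB nui.
have vi_int : crd B v i \is a Num.int.
  by have := kap_crd_int fB i (VN vV); rewrite k1 mul1r.
have le := special_crd_le fB sB nui vV.
have [v0|vi] := leP 0 (crd B v i); first by left; lra.
right; have vnb : v != nb B i.
  apply/eqP => e; move: lv; rewrite e (full_lev fB (special_full fB sB)).
  by move/eqP; rewrite eq_sym oppr_eq0 oner_eq0.
have := crd_ge_or_nb fB vV vnb vi; rewrite k1 lv mul1r.
by have := int_lt0 vi_int vi; lra.
Qed.

(** * The vertex sum is a vertex *)

Section VertexSum.
Variable p : 'I_d.

Definition vertex_sum B := frame B /\ nu = row p B.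

Lemma vertex_sum_crd B i : vertex_sum B -> crd B nu i = (p == i)%:R.
Proof. by move=> [fB ->]; rewrite crd_row // (frame_unit fB). Qed.

Lemma vertex_sum_special B : vertex_sum B -> special B.
Proof. by move=> vB i; rewrite vertex_sum_crd. Qed.

Lemma vertex_sum_crd0 B i : vertex_sum B -> i != p -> crd B nu i = 0.
Proof. by move=> vB ip; rewrite vertex_sum_crd // eq_sym (negbTE ip). Qed.

Lemma vertex_sum_good B : vertex_sum B -> good B.
Proof.
move=> vB; have fB := vB.1; have sB := vertex_sum_special vB.
have fuB := special_full fB sB.
have k1 i : i != p -> kap B i = 1.
  by move=> ip; apply: special_kap; rewrite ?vertex_sum_crd0.
split=> // i; have [->|] := eqVneq i p; last exact: k1.
(* The index p needs another argument, as [nu] has a nonzero coefficient there: [nb B p] has level 0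
   and a positive integral coordinate at some j, hence a p-th coordinate of at most -1, and
   [kap B p] times it is -1. *)
have kp := full_kap fB fuB p; have wp := nb_lt0 p fB.
have := full_lev fB fuB p; rewrite /lev (bigD1 p) //= => s0.
have [j jp cj] : exists2 j, j != p & 0 < crd B (nb B p) j.
  apply/exists_inP; apply: contraT; rewrite negb_exists => /forallP h.
  suff : \sum_(i < d | i != p) crd B (nb B p) i <= 0 by lra.
  by apply: sumr_le0 => k kp'; have := h k; rewrite kp' /= -leNgt.
have cj1 : 1 <= crd B (nb B p) j.
  apply: int_gt0 cj; have := kap_crd_int fB j (VN (nbV p fB)).
  by rewrite k1 // mul1r.
have : 0 <= \sum_(k < d | (k != p) && (k != j)) crd B (nb B p) k.
  by apply: sumr_ge0 => k /andP [kp' _]; apply: full_ge0; rewrite // eq_sym.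
move: s0; rewrite (bigD1 j) //= => s0 r0.
have := kap_ge1 fB p; nra.
Qed.

Lemma vertex_sum_adj B i : vertex_sum B -> i != p -> vertex_sum (adj B i).
Proof.
move=> [fB e] ip; split; first exact: adj_frame.
by rewrite row_adj eq_sym (negbTE ip).
Qed.

Lemma vertex_sum_Lneg B v : vertex_sum B -> v \in Lneg B ->
  exists i, v = - row i B.
Proof.
move=> vB; have fB := vB.1; have sB := vertex_sum_special vB.
have gB := vertex_sum_good vB; have Bu := frame_unit fB.
have coords x i : x \in Lneg B -> i != p -> crd B x i = 0 \/ crd B x i = -1.
  by move=> xL ip; apply: special_Lneg_crd; rewrite ?vertex_sum_crd0.
have step x i : x \in Lneg B -> i != p -> crd B x i = -1 ->
    exists2 j, j != i & x = row (phi B i) B - row i B - row j B.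
  move=> xL ip; apply: good_step => //.
  - exact/vertex_sum_good/vertex_sum_adj.
  - by move: xL; rewrite mem_Lneg => /andP [].
  - exact: special_Lneg.
(* A coordinate -1 at some i other than p is treated by [good_step]. Unless [j = phi B i], the
   coordinate at [phi B i] is 1, which is possible only at p; then j has coordinate -1, and
   [good_step] applies to j too. If there is no such i, the vertex is [- row p B]. *)
have shape x : x \in Lneg B -> (exists i, x = - row i B) \/
    exists i j, [/\ i != j, phi B i = p, phi B j = p &
                 x = row p B - row i B - row j B].
  move=> xL; have lx := special_Lneg fB sB xL.
  have [/existsP [i /andP [ip xi]]|] := boolP [exists i, (i != p) && (crd B x i != 0)].
    have {}xi : crd B x i = -1 by case: (coords x i xL ip) => // e; rewrite e eqxx in xi.
    have [j ji xE] := step x i xL ip xi.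
    have [e|jphi] := eqVneq j (phi B i).
      by left; exists i; rewrite xE e addrAC subrr sub0r.
    have cx k : crd B x k = (phi B i == k)%:R - (i == k)%:R - (j == k)%:R.
      by rewrite xE !crdB !crd_row.
    have ep : phi B i = p.
      apply/eqP; apply: contraT => np; have := coords x _ xL np.
      rewrite cx eqxx (negbTE jphi) (eq_sym i) (negbTE (phi_neq fB gB i)) /=.
      by case=> ?; lra.
    have jp : j != p by rewrite -ep.
    have xj : crd B x j = -1.
      rewrite cx eqxx ep (eq_sym p) (negbTE jp) (eq_sym i) (negbTE ji) /=; ring.
    have [k kj xE'] := step x j xL jp xj.
    right; exists i, j; split=> //; [by rewrite eq_sym| |by rewrite xE ep].
    have := cx p; rewrite ep eqxx (negbTE ip) (negbTE jp).
    rewrite xE' !crdB !crd_row // (negbTE jp).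
    by case: eqP => // _; case: (k == p) => /= e; exfalso; lra.
  rewrite negb_exists => /forallP h; left; exists p.
  have x0 i : i != p -> crd B x i = 0.
    by move=> ip; have := h i; rewrite ip /= negbK => /eqP.
  apply: (crdP Bu) => i; rewrite crdN crd_row //.
  have [<-|pi] := eqVneq p i; last by rewrite x0 1?eq_sym // oppr0.
  by rewrite -lx /lev (bigD1 p) //= big1 ?addr0 // => k; apply: x0.
(* The second shape is refuted by the p-th coordinates, whose sum is 1: it entails two preimages of
   p under [phi] and a vertex with coordinate 1, while only [- row p B] can contribute -1. *)
move=> vL; case: (shape v vL) => // -[i [j [ij phii phij vE]]]; exfalso.
have := good_crd_nu fB gB p; rewrite vertex_sum_crd // eqxx.
have : 2 <= \sum_l (phi B l == p)%:R :> R.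
  rewrite (bigD1 i) //= (bigD1 j) 1?eq_sym //= phii phij eqxx /=.
  have : 0 <= \sum_(l < d | (l != i) && (l != j)) (phi B l == p)%:R :> R.
    by apply: sumr_ge0.
  by move: (\sum_(l < d | _) _) => S; lra.
have ip : i != p by rewrite -phii eq_sym phi_neq.
have jp : j != p by rewrite -phij eq_sym phi_neq.
pose g x : R := crd B x p + (x == - row p B)%:R.
have g0 x : x \in Lneg B -> 0 <= g x.
  rewrite /g => /shape [[k ->]|[k [l [_ phik phil ->]]]].
    rewrite crdN crd_row // eqr_opp; have [->|] := eqVneq k p.
      by rewrite eqxx addNr.
    by rewrite oppr0 add0r.
  have kp : k != p by rewrite -phik eq_sym phi_neq.
  have lp : l != p by rewrite -phil eq_sym phi_neq.
  by rewrite !crdB !crd_row // eqxx (negbTE kp) (negbTE lp) !subr0 addr_ge0.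
have : 1 <= \sum_(x <- Lneg B) g x.
  rewrite (big_rem v) //=; have : 1 <= g v.
    rewrite /g {1}vE !crdB !crd_row // eqxx (negbTE ip) (negbTE jp) !subr0.
    by rewrite lerDl.
  have : 0 <= \sum_(x <- rem v (Lneg B)) g x.
    by rewrite big_seq; apply: sumr_ge0 => x /mem_rem/g0.
  by move: (g v) (\sum_(_ <- _) _) => a b; lra.
rewrite /g big_split /= sum_eq1 ?filter_uniq //.
move: (\sum_(_ <- _) _) (\sum_l _) => a b.
by case: (_ \in _) => /=; lra.
Qed.

End VertexSum.
End NonzeroSum.

(** * Lattice bases and the vertex lists of splittings *)

Section Splitting.
Hypotheses (N0 : N 0) (ND : forall x y, N x -> N y -> N (x + y)).
Hypothesis NN : forall x, N x -> N (- x).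

Lemma NZ (a : R) x : a \is a Num.int -> N x -> N (a *: x).
Proof.
move=> /intrP [m ->] Nx; rewrite scaler_int.
have Nn n : N (x *+ n) by elim: n => [|n IHn]; rewrite ?mulr0n // mulrS; apply: ND.
by case: m => n; [exact: Nn|rewrite NegzE mulrNz; apply: NN; apply: Nn].
Qed.

Definition lattice_basis B :=
  B \in unitmx /\ forall x, N x <-> forall i, crd B x i \is a Num.int.

Lemma lattice_basis_int B : B \in unitmx -> (forall i, N (row i B)) ->
  (forall x i, N x -> crd B x i \is a Num.int) -> lattice_basis B.
Proof.
move=> Bu Br Bi; split=> // x; split=> [Nx i|xi]; first exact: Bi.
rewrite (crdE x Bu); elim/big_ind: _ => // i _; exact: NZ.
Qed.

Lemma lattice_basis_repl B i w : lattice_basis B -> N w ->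
  crd B w i \in [:: 1; -1] -> lattice_basis (repl B i w).
Proof.
move=> [Bu Bi] Nw w1.
have wi0 : crd B w i != 0.
  by move: w1; rewrite !inE => /orP [] /eqP ->; rewrite ?oppr_eq0 oner_eq0.
apply: lattice_basis_int; first exact: repl_unit.
  move=> j; rewrite row_repl; case: ifP => // _; apply/Bi => k.
  by rewrite crd_row // rpred_nat.
have wv : (crd B w i)^-1 \is a Num.int.
  by move: w1; rewrite !inE => /orP [] /eqP ->; rewrite ?invrN1 ?invr1 ?rpredN rpred1.
have wj : forall j, crd B w j \is a Num.int by apply/Bi.
move=> x j /Bi xi; rewrite crd_repl //.
by case: ifP => _; do ?apply: rpredB; do ?apply: rpredM.
Qed.

(* [V] consists of the vertices [Q] of a block spanned by the rows indexed by
   [l] and of a hexagon for every pair [{i, f i}] of the other indices. *)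
Definition hexagons_over B (l : seq 'I_d) (Q : seq 'rV[R]_d) :=
  [/\ lattice_basis B, uniq l & exists f : 'I_d -> 'I_d,
    (forall i, i \notin l -> [/\ f i \notin l, f i != i & f (f i) = i]) /\
    forall v, v \in V <-> v \in Q \/ exists2 i, i \notin l &
      v \in [:: row i B; - row i B; row (f i) B - row i B]].

Lemma hexagons_overI B l Q f : lattice_basis B -> uniq l ->
    (forall i, i \notin l -> [/\ f i \notin l, f i != i & f (f i) = i]) ->
    {subset Q <= V} ->
    (forall i, i \notin l ->
       {subset [:: row i B; - row i B; row (f i) B - row i B] <= V}) ->
    (forall v, v \in V -> v \in Q \/ exists2 i, i \notin l &
       v \in [:: row i B; - row i B; row (f i) B - row i B]) ->
  hexagons_over B l Q.
Proof.
move=> LB ul fP QV hV Vh; split=> //; exists f; split=> // v; split; first exact: Vh.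
by move=> [/QV|[i il]] //; apply: hV.
Qed.

(** The vertex lists of the model polytopes, with arbitrary vectors in place of the unit vectors. *)
Definition V2t_of (T : zmodType) (a b : T) := [:: a; - a; b; - b; a - b].
Definition V2_of (T : zmodType) (a b : T) := V2t_of a b ++ [:: b - a].
Definition E1_of (T : zmodType) (a b : T) :=
  [:: a; a + b; b; - a - b; - a - b *+ 2].
Definition E2_of (T : zmodType) (a b : T) := [:: a; b; b - a; - a - b; a - b].
Definition Q3_of (T : zmodType) (a b c : T) := V2_of a b ++ [:: c; - c].
Definition Q3'_of (T : zmodType) (a b c : T) := V2_of a b ++ [:: c; a - c].

Lemma good_lattice_basis B : frame B -> good B -> lattice_basis B.
Proof.
move=> fB gB; apply: lattice_basis_int; first exact: frame_unit.
  by move=> i; apply/VN/frame_row.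
by move=> x i Nx; apply: good_crd_int.
Qed.

Lemma good_V B v : frame B -> good B -> v \in V ->
  [\/ exists i, v = row i B, exists i, v = row (phi B i) B - row i B |
      v \in Lneg B].
Proof.
move=> fB gB vV; case: (ltgtP (lev B v) 0) => l0.
- by apply: Or33; rewrite mem_Lneg vV.
- apply: Or31; apply: (frame_top fB vV); apply/eqP.
  by rewrite eq_le (frame_le1 fB vV) int_gt0 // frame_intV.
- by apply: Or32; apply: good_lev0.
Qed.

Lemma good_phiV B i : frame B -> good B -> row (phi B i) B - row i B \in V.
Proof. by move=> fB gB; rewrite -good_nb // nbV. Qed.

Lemma negrow_Lneg B i : frame B -> (- row i B \in Lneg B) = (- row i B \in V).
Proof.
by move=> fB; rewrite mem_Lneg levN lev_row ?frame_unit // ltrN10 andbT.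
Qed.

(** [Lneg B] has d - 1 elements, as many as there are candidates: [w] and d - 2 negated rows. So all
    candidates occur. *)
Lemma Lneg_rows_all B p q w : frame B -> full B -> p != q ->
    (forall v, v \in Lneg B ->
       v = w \/ exists2 i, i \notin [:: p; q] & v = - row i B) ->
  forall i, i \notin [:: p; q] -> - row i B \in V.
Proof.
move=> fB fuB pq h i il.
pose W := w :: [seq - row j B | j <- enum 'I_d & j \notin [:: p; q]].
have sub : {subset Lneg B <= W}.
  move=> v /h [->|[j jl ->]]; first by rewrite inE eqxx.
  rewrite inE; apply/orP; right; apply/mapP; exists j => //.
  by rewrite mem_filter jl mem_enum.
have szW : (size W <= size (Lneg B))%N.
  rewrite full_Lneg_size //= size_map.
  have -> : size [seq j <- enum 'I_d | j \notin [:: p; q]] = #|~: [set p; q]|.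
    rewrite enumT cardE /enum_mem; congr size.
    by apply: eq_filter => j; rewrite !inE.
  by rewrite cardsC_pair.
have : - row i B \in Lneg B.
  rewrite (uniq_min_size (filter_uniq _ V_uniq) sub szW).2 inE; apply/orP; right.
  by apply/mapP; exists i => //; rewrite mem_filter il mem_enum.
by rewrite negrow_Lneg.
Qed.

(** * Splitting when the vertex sum is a vertex *)

Section VertexSumSplit.
Hypotheses (d_gt0 : (0 < d)%N) (nu_neq0 : nu != 0).
Variables (p : 'I_d) (B : 'M[R]_d) (vB : vertex_sum p B).

Let fB : frame B := vB.1.
Let gB : good B := vertex_sum_good d_gt0 nu_neq0 vB.
Let Bu := frame_unit fB.

(** The i-th coordinates of all vertices add up to 0. Levels 1 and 0 together contribute the number
    of preimages of i, the negative levels -1 if [- row i B] is a vertex. *)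
Let phi_im i : i != p ->
  \sum_l (phi B l == i)%:R = (- row i B \in V)%:R :> R.
Proof.
move=> ip; have := good_crd_nu fB gB i; rewrite (vertex_sum_crd0 vB ip).
suff -> : \sum_(v <- Lneg B) crd B v i = - (- row i B \in V)%:R.
  by move/eqP; rewrite eq_sym subr_eq0 => /eqP.
rewrite -(negrow_Lneg i fB) -sum_eq1 ?filter_uniq // -sumrN.
rewrite big_seq [RHS]big_seq; apply: eq_bigr => v vL.
have [j ->] := vertex_sum_Lneg d_gt0 nu_neq0 vB vL.
rewrite crdN crd_row // eqr_opp; congr (- (nat_of_bool _)%:R); apply/eqP/eqP => [->//|].
by move/(row_inj Bu).
Qed.

Let phi_imP i : i != p -> reflect (exists l, phi B l = i) (- row i B \in V).
Proof.
move=> ip; have := phi_im ip; case: (_ \in V) => s; constructor.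
  have [/existsP [l /eqP]|] := boolP [exists l, phi B l == i]; first by exists l.
  rewrite negb_exists => /forallP h; move: s; rewrite big1 => [|l _].
    by move/eqP; rewrite eq_sym oner_eq0.
  by rewrite (negbTE (h l)).
move=> [l e]; move: s; rewrite (bigD1 l) //= e eqxx /=.
have : 0 <= \sum_(i0 < d | i0 != l) (phi B i0 == i)%:R :> R by apply: sumr_ge0.
by move: (\sum_(_ < _ | _) _) => S; lra.
Qed.

(** [nb B l = row i B - row l B] has level -1 on the facet adjacent along i, so it is a negated row
    of that facet. Its i-th coordinate 1 leaves only [- nb B i = row i B - row (phi B i) B]. *)
Let phi_back i l : i != p -> phi B l = i -> phi B i = l.
Proof.
move=> ip e; have vA := vertex_sum_adj vB ip; have fA := vA.1.
have wV : row i B - row l B \in Lneg (adj B i).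
  rewrite mem_Lneg -{1}e good_phiV //= good_lev_adj // levB !lev_row //.
  by rewrite crdB !crd_row // eqxx -e (eq_sym l) (negbTE (phi_neq fB gB l)) /=; lra.
have [b] := vertex_sum_Lneg d_gt0 nu_neq0 vA wV.
rewrite row_adj; case: ifP => [_|bi].
  rewrite good_nb // opprB => /addrI/oppr_inj/(row_inj Bu) //.
move/(congr1 (fun v => crd B v i)); rewrite crdN crdB !crd_row // bi eqxx.
rewrite -e (eq_sym l) (negbTE (phi_neq fB gB l)) subr0 oppr0 => /eqP.
by rewrite oner_eq0.
Qed.

(** All d - 1 vertices of negative level are among the d negated rows. *)
Let negrow_missing : exists i0, forall i, (- row i B \in V) = (i != i0).
Proof.
pose A := [set i | - row i B \in V].
have pA : perm_eq (Lneg B) [seq - row i B | i <- enum A].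
  apply: uniq_perm; first exact: filter_uniq.
    by rewrite map_inj_uniq ?enum_uniq // => i j /oppr_inj/(row_inj Bu).
  move=> v; apply/idP/mapP => [vL|[i]].
    have [i e] := vertex_sum_Lneg d_gt0 nu_neq0 vB vL.
    by exists i; rewrite // mem_enum inE -negrow_Lneg // -e.
  by rewrite mem_enum inE -negrow_Lneg // => h ->.
have : #|~: A| = 1%N.
  rewrite cardsCs finset.setCK card_ord.
  have <- : size (Lneg B) = #|A| by rewrite (perm_size pA) size_map -cardE.
  by rewrite (full_Lneg_size fB gB.1); lia.
move/eqP/cards1P => [i0 e]; exists i0 => i.
by have := finset.in_setC i A; rewrite e !inE => ->; rewrite negbK.
Qed.

Let V_shape v : v \in V -> exists i,
  [\/ v = row i B, v = row (phi B i) B - row i B | v = - row i B].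
Proof.
move=> vV; case: (good_V fB gB vV) => [[i ->]|[i ->]|vL].
- by exists i; apply: Or31.
- by exists i; apply: Or32.
- by have [i ->] := vertex_sum_Lneg d_gt0 nu_neq0 vB vL; exists i; apply: Or33.
Qed.

Lemma vertex_sum_split :
  (exists C a b, hexagons_over C [:: a; b] (V2t_of (row a C) (row b C))) \/
  (exists C a b c,
     hexagons_over C [:: a; b; c] (Q3'_of (row a C) (row b C) (row c C))).
Proof.
have [i0 negP] := negrow_missing.
have phi_ex i : i != p -> i != i0 -> exists l, phi B l = i.
  by move=> ip ii0; apply/phi_imP; rewrite ?negP.
have LB := good_lattice_basis fB gB.
pose q := phi B p; have qp : q != p by apply: phi_neq.
have phiq : phi B q = p by apply: phi_back.
have [i0p|i0p] := eqVneq i0 p.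
  (* Among the negatives of the vertices in the block of p and q only [- row p B] is missing,
     whereas for [V2t_of a b] it is [b - a]. This dictates [a - b = row p B], as for
     [a = row p B - row q B] and [b = - row q B]. *)
  left; pose B1 := repl B p (row p B - row q B).
  have LB1 : lattice_basis B1.
    apply: lattice_basis_repl => //.
      by apply: ND; [|apply: NN]; apply: VN; apply: frame_row.
    by rewrite crdB !crd_row // eqxx (negbTE qp) subr0 inE eqxx.
  pose C := repl B1 q (- row q B); have LC : lattice_basis C.
    apply: lattice_basis_repl => //; first by apply: NN; apply: VN; apply: frame_row.
    rewrite crd_repl // ?crdN ?crdB !crd_row // ?(eq_sym p q) ?eqxx ?(negbTE qp) /=.
      by rewrite subr0 oppr0 mulr0 subr0 !inE eqxx orbT.
    by rewrite subr0 oner_eq0.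
  have rp : row p C = row p B - row q B.
    by rewrite !row_repl (eq_sym p) (negbTE qp) eqxx.
  have rq : row q C = - row q B by rewrite row_repl eqxx.
  have ri i : i \notin [:: p; q] -> row i C = row i B.
    by rewrite !inE !row_repl => /norP [/negbTE -> /negbTE ->].
  have phi_lq l : phi B l = p -> l = q.
    move=> e; have lp : l != p by rewrite -e eq_sym phi_neq.
    have [|m em] := phi_ex l lp; first by rewrite i0p.
    by have := phi_back lp em; rewrite e => mp; rewrite -em -mp.
  have phiN i : i \notin [:: p; q] -> phi B i \notin [:: p; q].
    rewrite !inE => /norP [ip iq]; apply/norP; split.
      by apply: contra iq => /eqP/phi_lq ->.
    apply: contra ip => /eqP e.
    by have := phi_back qp e; rewrite phiq => ->.
  exists C, p, q; apply: (@hexagons_overI _ _ _ (phi B)) => //.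
  - by rewrite /= inE eq_sym qp.
  - move=> i il; split; [exact: phiN|exact: phi_neq|].
    have := phiN i il; rewrite !inE => /norP [pip _].
    exact: phi_back.
  - rewrite rp rq; apply/allP; rewrite /= !opprK opprB subrK.
    by rewrite !frame_row // -{1}phiq !good_phiV // negP i0p qp.
  - move=> i il; rewrite !ri ?phiN //; apply/allP.
    rewrite /= frame_row // good_phiV // negP i0p !andbT /=.
    by apply: contra il => /eqP ->; rewrite inE eqxx.
  - move=> v vV; have [i vE] := V_shape vV.
    have [il|] := boolP (i \in [:: p; q]); last first.
      move=> il; right; exists i; rewrite // !ri ?phiN //.
      by case: vE => ->; rewrite !inE eqxx ?orbT.
    left; rewrite rp rq /V2t_of !opprK opprB subrK.
    move: il vE vV; rewrite inE => /orP []; rewrite ?inE => /eqP -> [] -> vV;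
      rewrite ?phiq ?eqxx ?orbT //.
    by rewrite negP i0p eqxx in vV.
(* Otherwise [phi_back] would make [i0] a value of [phi], and [- row i0 B] a vertex. So [row i0 B]
   and [row p B - row i0 B] are the two apexes over the hexagon of p and q, with sum [row p B]. *)
right; have phii0 : phi B i0 = p.
  apply/eqP; apply: contraT => np.
  have /(introT (phi_imP i0p)) : exists l, phi B l = i0.
    by exists (phi B i0); apply: phi_back.
  by rewrite negP eqxx.
have qi0 : q != i0 by rewrite -negP; apply/(phi_imP qp); exists p.
have phi_lq l : phi B l = p -> l = q \/ l = i0.
  move=> e; have [->|li0] := eqVneq l i0; first by right.
  left; have lp : l != p by rewrite -e eq_sym phi_neq.
  have [m em] := phi_ex l lp li0.
  by have := phi_back lp em; rewrite e => mp; rewrite -em -mp.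
have phiN i : i \notin [:: p; q; i0] -> phi B i \notin [:: p; q; i0].
  rewrite !inE => /norP [ip] /norP [iq ii0]; apply/norP; split.
    apply/eqP => /phi_lq [] /eqP; first by rewrite (negbTE iq).
    by rewrite (negbTE ii0).
  apply/norP; split; last first.
    apply/eqP => e; have : - row i0 B \in V by apply/(phi_imP i0p); exists i.
    by rewrite negP eqxx.
  apply: contra ip => /eqP e.
  by have := phi_back qp e; rewrite phiq => ->.
exists B, p, q, i0; apply: (@hexagons_overI _ _ _ (phi B)) => //.
- by rewrite /= !inE negb_or eq_sym qp eq_sym i0p qi0.
- move=> i il; split; [exact: phiN|exact: phi_neq|].
  have := phiN i il; rewrite !inE => /norP [pip _].
  exact: phi_back.
- apply/allP; rewrite /= !frame_row // !negP qi0 eq_sym i0p /=.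
  have := good_phiV p fB gB; have := good_phiV q fB gB.
  by have := good_phiV i0 fB gB; rewrite phiq phii0 -/q => -> -> ->.
- move=> i il; apply/allP.
  rewrite /= frame_row // good_phiV // negP !andbT /=.
  by apply: contra il => /eqP ->; rewrite !inE eqxx !orbT.
- move=> v vV; have [i vE] := V_shape vV.
  have [il|] := boolP (i \in [:: p; q; i0]); last first.
    by move=> il; right; exists i; rewrite //; case: vE => ->; rewrite !inE eqxx ?orbT.
  left; move: il vE vV; rewrite !inE => /or3P [] /eqP -> [] -> vV;
    rewrite ?phiq ?phii0 ?eqxx ?orbT //.
  by rewrite negP eqxx in vV.
Qed.

End VertexSumSplit.

(** * The vertex sum is the midpoint of two vertices *)

Section HalfSum.
Hypotheses (d_gt0 : (0 < d)%N) (nu_neq0 : nu != 0).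

(** The coordinates in the support of [nu], added up over all vertices, give 1. The rows contribute
    the size of the support, which is at least 2 as all coefficients are below 1; the neighbours
    contribute nothing negative, and within [Lneg] only [- nu] does, namely -1. So the size is 2,
    [- nu] occurs and the neighbours contribute 0. *)
Lemma half_sum_support B : frame B -> special B -> (forall i, crd B nu i < 1) ->
  exists p q, [/\ p != q, crd B nu p = 2^-1, crd B nu q = 2^-1,
    (forall i, i \notin [:: p; q] -> crd B nu i = 0) &
    [/\ kap B p = 2, kap B q = 2, - nu \in V &
     forall l i, (l \in [:: p; q]) != (i \in [:: p; q]) -> crd B (nb B l) i = 0]].
Proof.
move=> fB sB nu1; have Bu := frame_unit fB.
have fuB := special_full d_gt0 nu_neq0 fB sB.
pose s i := crd B nu i != 0; pose sg v := \sum_(i | s i) crd B v i.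
have kN i : ~~ s i -> kap B i = 1.
  by rewrite negbK => /eqP; apply: special_kap.
have kS i : s i -> 1 <= kap B i * crd B nu i /\ 2 <= kap B i.
  move=> si; have ni : 0 < crd B nu i by rewrite lt_neqAle eq_sym sB andbT.
  have k1 := kap_ge1 fB i; have h1 : 1 <= kap B i * crd B nu i.
    apply: int_gt0; last by nra.
    rewrite crd_nu mulr_sumr big_seq rpred_sum // => v vV.
    by apply: kap_crd_int => //; apply: VN.
  split=> //; have : 1 <= kap B i - 1; last by lra.
  apply: int_gt0; first by rewrite rpredB ?rpred1 // kap_int.
  by have := nu1 i; nra.
have levS v : lev B v = sg v + \sum_(i | ~~ s i) crd B v i by rewrite /lev (bigID s).
have nuS : sg nu = 1.
  rewrite -(special_lev_nu d_gt0 nu_neq0 fB sB) levS [X in _ + X]big1 ?addr0 //.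
  by move=> i; rewrite negbK => /eqP.
(* Coordinates off the support are integral. The only negative coordinate of [nb B l] is at least
   -1/2, because [kap B l] is at least 2, so the others add up to at most 1/2. *)
have nbS l j : s l -> ~~ s j -> crd B (nb B l) j = 0.
  move=> sl sj; have jl : j != l by apply: contraNneq sj => ->.
  have c0 : 0 <= crd B (nb B l) j by apply: full_ge0; rewrite // eq_sym.
  apply/eqP; rewrite eq_le c0 andbT; apply: int_lt1.
    by have := kap_crd_int fB j (VN (nbV l fB)); rewrite kN // mul1r.
  have := full_lev fB fuB l; rewrite /lev (bigD1 l) //= (bigD1 j) //=.
  have := full_kap fB fuB l; have [_ k2] := kS l sl.
  have : 0 <= \sum_(i | (i != l) && (i != j)) crd B (nb B l) i.
    by apply: sumr_ge0 => i /andP [il _]; apply: full_ge0; rewrite // eq_sym.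
  have := nb_lt0 l fB; nra.
have sg_nb l : s l -> sg (nb B l) = 0.
  move=> sl; have := full_lev fB fuB l; rewrite levS [X in _ + X]big1 ?addr0 //.
  by move=> i; apply: nbS.
have sg_nb_ge0 l : 0 <= sg (nb B l).
  have [/sg_nb -> //|sl] := boolP (s l).
  by apply: sumr_ge0 => i si; apply: full_ge0 => //; apply: contraNneq sl => ->.
have sgV (f : 'rV[R]_d -> R) (F : seq 'rV[R]_d) :
    \sum_(i | s i) \sum_(v <- F) crd B v i = \sum_(v <- F) sg v.
  by rewrite exchange_big.
have cardS : \sum_(i | s i) 1 = #|s|%:R :> R by exact: sumr_const.
have count : 1 = #|s|%:R + \sum_l sg (nb B l) + \sum_(v <- Lneg B) sg v.
  rewrite -{1}nuS {1}/sg; under eq_bigr => i _ do rewrite crd_nu.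
  rewrite exchange_big /= (V_sum fB) (full_sum fB fuB); congr (_ + _ + _).
  rewrite exchange_big /= -cardS; apply: eq_bigr => i si.
  rewrite (bigD1 i) //= big1 ?addr0 ?crd_row ?eqxx // => k ki.
  by rewrite crd_row // (negbTE ki).
have neg v i : v \in Lneg B -> ~~ s i -> crd B v i = 0 \/ crd B v i = -1.
  by move=> vL; rewrite negbK => /eqP ?; apply: special_Lneg_crd.
(* A coordinate -1 off the support would already account for the level -1. So v lives on the
   support, where [-1 <= kap B i * crd B v i] and [1 <= kap B i * crd B nu i] bound it from below by
   [- nu]; both have level -1, so they agree. *)
have neg_sg v : v \in Lneg B -> sg v < 0 ->
    v = - nu /\ forall i, s i -> kap B i * crd B nu i = 1.
  move=> vL sv; have lv := special_Lneg d_gt0 nu_neq0 fB sB vL.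
  have v0 i : ~~ s i -> crd B v i = 0.
    move=> si; case: (neg v i vL si) => // vi.
    have : \sum_(j | ~~ s j && (j != i)) crd B v j <= 0.
      by apply: sumr_le0 => j /andP [sj _]; case: (neg v j vL sj) => ->; lra.
    by move: lv; rewrite levS [X in _ + X](bigD1 i) //= vi => ? ?; exfalso; lra.
  have svN : sg v = -1 by rewrite -lv levS [X in _ + X]big1 ?addr0.
  have kv i : -1 <= kap B i * crd B v i.
    have [c0|ci] := leP 0 (crd B v i); first by have := kap_ge1 fB i; nra.
    have vV : v \in V by move: vL; rewrite mem_Lneg => /andP [].
    have := crd_ge_or_nb fB vV _ ci; rewrite lv => h.
    have : -1 - kap B i * crd B v i <= 0; last by lra.
    by apply: h; apply/eqP => e; move: lv; rewrite e (full_lev fB fuB) => ?; lra.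
  have cs i : s i -> 0 <= crd B v i + crd B nu i.
    by move=> si; have := kv i; have [? ?] := kS i si; nra.
  have /psumr_eq0P z : \sum_(i | s i) (crd B v i + crd B nu i) = 0.
    by rewrite big_split /= -/(sg v) -/(sg nu) svN nuS addNr.
  have vE i : s i -> crd B v i = - crd B nu i.
    by move=> si; apply/eqP; rewrite -addr_eq0 z.
  split.
    apply: (crdP Bu) => i; rewrite crdN; have [/vE //|si] := boolP (s i).
    by rewrite v0 //; move: si; rewrite negbK => /eqP ->; rewrite oppr0.
  move=> i si; have := kv i; rewrite vE // mulrN => ?.
  by have [? _] := kS i si; lra.
have s_ne : exists i, s i.
  apply/existsP; apply: contraT; rewrite negb_exists => /forallP h.
  by move: nuS; rewrite /sg big_pred0 => [|i]; [lra|exact/negbTE].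
have card_gt1 : (1 < #|s|)%N.
  rewrite -(ltr_nat R) -subr_gt0.
  have -> : #|s|%:R - 1 = \sum_(i | s i) (1 - crd B nu i).
    by rewrite sumrB -/(sg nu) nuS cardS.
  have [i si] := s_ne; rewrite (bigD1 i) //=; apply: ltr_pwDl.
    by rewrite subr_gt0.
  by apply: sumr_ge0 => k _; rewrite subr_ge0 ltW.
have cardR : 2 <= #|s|%:R :> R by rewrite ler_nat.
have nbsum0 : 0 <= \sum_l sg (nb B l) by apply: sumr_ge0.
have [x xL sx] : exists2 x, x \in Lneg B & sg x < 0.
  apply/hasP; apply: contraT => /hasPn h.
  have : 0 <= \sum_(v <- Lneg B) sg v; last by lra.
  by rewrite big_seq; apply: sumr_ge0 => v /h; rewrite leNgt.
have [xE kn] := neg_sg x xL sx.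
pose g v : R := sg v + (v == - nu)%:R.
have gsum : 0 <= \sum_(v <- Lneg B) g v.
  rewrite big_seq; apply: sumr_ge0 => v vL; rewrite /g.
  have [sv|sv] := leP 0 (sg v); first by rewrite addr_ge0.
  have [-> _] := neg_sg v vL sv; rewrite eqxx.
  have -> : sg (- nu) = - sg nu.
    by rewrite /sg -[RHS]sumrN; apply: eq_bigr => i _; rewrite crdN.
  by rewrite nuS addNr.
have nuL : - nu \in Lneg B by rewrite -xE.
move: gsum; rewrite big_split /= sum_eq1 ?filter_uniq // nuL /= => gsum.
have card2 : #|s| = 2.
  apply/eqP; rewrite eqn_leq card_gt1 andbT -(ler_nat R).
  by lra.
have nbsum00 : \sum_l sg (nb B l) = 0 by move: count; rewrite card2; lra.
have /cards2P [p [q [pq sE]]] : #|[set i | s i]| == 2%N by rewrite cardsE card2.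
have sP i : s i = (i \in [:: p; q]).
  by have := finset.in_set s i; rewrite sE !inE => <-.
have nupq : crd B nu p + crd B nu q = 1.
  rewrite -nuS /sg (bigD1 p) /= ?sP ?inE ?eqxx // (bigD1 q) /=; last first.
    by rewrite sP !inE eqxx orbT eq_sym.
  rewrite big1 ?addr0 // => i; rewrite sP !inE => /andP [/andP [h ip] iq].
  by move: h; rewrite (negbTE ip) (negbTE iq).
have sp : s p by rewrite sP inE eqxx.
have sq : s q by rewrite sP !inE eqxx orbT.
have [_ kp] := kS p sp; have [_ kq] := kS q sq.
have kp1 := kn p sp; have kq1 := kn q sq.
(* Each coefficient is the inverse of its [kap], hence at most 1/2, and the two add up to 1. *)
have nup : crd B nu p = 2^-1 by nra.
have nuq : crd B nu q = 2^-1 by lra.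
exists p, q; split=> //.
  by move=> i; rewrite -sP negbK => /eqP.
split.
- by move: kp1; rewrite nup; lra.
- by move: kq1; rewrite nuq; lra.
- by move: nuL; rewrite mem_Lneg => /andP [].
move=> l i; rewrite -!sP; have [sl|sl] := boolP (s l); have [si|si] // := boolP (s i).
  by move=> _; apply: nbS.
move=> _; have /psumr_eq0P z := nbsum00.
have /psumr_eq0P z' : sg (nb B l) = 0 by apply: z.
apply: z' => // k sk; apply: full_ge0 => //.
by apply: contraNneq sl => ->.
Qed.

End HalfSum.

Section HalfSumSplit.
Hypotheses (d_gt0 : (0 < d)%N) (nu_neq0 : nu != 0).
Variables (p q : 'I_d).

Definition half_sum B := [/\ frame B, p != q, crd B nu p = 2^-1,
  crd B nu q = 2^-1 & forall i, i \notin [:: p; q] -> crd B nu i = 0].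

Section OneHalfSum.
Variables (B : 'M[R]_d) (hB : half_sum B).

Let fB : frame B. Proof. by case: hB. Qed.
Let Bu := frame_unit fB.

Lemma half_sum_special : special B.
Proof.
case: hB => _ _ np nq n0 i; have [|/n0 ->//] := boolP (i \in [:: p; q]).
by rewrite !inE => /orP [] /eqP ->; rewrite ?np ?nq; lra.
Qed.

Let sB := half_sum_special.
Let fuB : full B := special_full d_gt0 nu_neq0 fB sB.

Lemma half_sum_facts : [/\ kap B p = 2, kap B q = 2, - nu \in V &
     forall l i, (l \in [:: p; q]) != (i \in [:: p; q]) -> crd B (nb B l) i = 0].
Proof.
case: hB => _ pq np nq n0.
have [i|p' [q' [pq' np' nq' n0' [kp kq nuV h]]]] :=
    half_sum_support d_gt0 nu_neq0 fB sB.
  have [|/n0 ->//] := boolP (i \in [:: p; q]).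
  by rewrite !inE => /orP [] /eqP ->; rewrite ?np ?nq; lra.
have e i : (i \in [:: p'; q']) = (i \in [:: p; q]).
  apply/idP/idP; apply: contraLR => il; rewrite !inE; apply/norP.
    have ni := n0 i il.
    by split; apply/eqP => ii; move: ni; rewrite ii ?np' ?nq' => ?; lra.
  have ni := n0' i il.
  by split; apply/eqP => ii; move: ni; rewrite ii ?np ?nq => ?; lra.
have kpq i : i \in [:: p; q] -> kap B i = 2.
  by rewrite -e !inE => /orP [] /eqP ->.
split; rewrite ?kpq ?inE ?eqxx ?orbT // => l i; rewrite -!e; exact: h.
Qed.

Lemma half_sum_kap i : i \notin [:: p; q] -> kap B i = 1.
Proof. by case: hB => _ _ _ _ n0 /n0 ni; apply: special_kap. Qed.

Lemma half_sum_crd_nb i : i \notin [:: p; q] -> crd B (nb B i) i = -1.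
Proof. by move=> il; have := full_kap fB fuB i; rewrite half_sum_kap // mul1r. Qed.

Lemma half_sum_adj i : i \notin [:: p; q] -> half_sum (adj B i).
Proof.
case: hB => _ pq np nq n0 il; have ni := n0 i il.
have cE j : crd (adj B i) nu j = crd B nu j by apply: special_crd_adj.
by split; rewrite ?cE //; [apply: adj_frame|move=> j /n0; rewrite cE].
Qed.

(** [kap B a = 2] makes the a-th coordinate -1/2; the support and level 0 determine the others. *)
Lemma half_sum_nb_pair a b : [:: a; b] \in [:: [:: p; q]; [:: q; p]] ->
  nb B a = 2^-1 *: (row b B - row a B).
Proof.
move=> ab; have [kp kq _ h] := half_sum_facts; have [_ pq _ _ _] := hB.
have abE i : (i \in [:: a; b]) = (i \in [:: p; q]).
  by move: ab; rewrite !inE !eqseq_cons !andbT => /orP [] /andP [/eqP -> /eqP ->] //; rewrite orbC.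
have ba : b != a.
  move: ab; rewrite !inE !eqseq_cons !andbT => /orP [] /andP [/eqP -> /eqP ->] //.
  by rewrite eq_sym.
have ka : kap B a = 2.
  by move: ab; rewrite !inE !eqseq_cons !andbT => /orP [] /andP [/eqP -> _].
have ca : crd B (nb B a) a = - 2^-1.
  by have := full_kap fB fuB a; rewrite ka => ?; lra.
have c0 i : i \notin [:: a; b] -> crd B (nb B a) i = 0.
  by move=> il; apply: h; rewrite -!abE (negbTE il) inE eqxx.
have cb : crd B (nb B a) b = 2^-1.
  have := full_lev fB fuB a; rewrite /lev (bigD1 a) //= (bigD1 b) //= big1.
    by rewrite ca; lra.
  by move=> i /andP [ia ib]; apply: c0; rewrite !inE negb_or ia.
apply: (crdP Bu) => i; rewrite crdZ crdB !crd_row //.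
have [<-|ai] := eqVneq a i; first by rewrite (negbTE ba) ca /=; lra.
have [<-|bi] := eqVneq b i; first by rewrite cb /=; lra.
rewrite c0 ?subrr ?mulr0 // !inE negb_or.
by rewrite eq_sym ai eq_sym bi.
Qed.

Lemma half_sum_nb i : i \notin [:: p; q] ->
  nb B i = row (phi B i) B - row i B /\ phi B i \notin [:: p; q].
Proof.
move=> il; have [_ _ _ h] := half_sum_facts.
have h0 j : j \in [:: p; q] -> crd B (nb B i) j = 0.
  by move=> jl; apply: h; rewrite (negbTE il) jl.
have ci := half_sum_crd_nb il.
have ej : nb B i = row (phi B i) B - row i B.
  apply: nb_phi => //; first exact: full_lev.
    by move=> k ki; apply: full_ge0 => //; rewrite eq_sym.
  move=> k; have [/h0 ->|kl] := boolP (k \in [:: p; q]); first exact: rpred0.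
  by have := kap_crd_int fB k (VN (nbV i fB)); rewrite half_sum_kap // mul1r.
split=> //; apply: contraL (isT) => pl.
have := h0 _ pl; rewrite ej crdB !crd_row // eqxx.
have -> : (i == phi B i) = false by apply: contraNF il => /eqP ->.
by move=> /eqP; rewrite subr0 oner_eq0.
Qed.

Lemma half_sum_phi_neq i : i \notin [:: p; q] -> phi B i != i.
Proof.
move=> il; apply/eqP => e; have [] := half_sum_nb il.
by rewrite e subrr => n0 _; have := nb_lt0 i fB; rewrite n0 crd0 ltxx.
Qed.

End OneHalfSum.

Lemma half_sum_Lneg B v : half_sum B -> v \in Lneg B ->
  v = - nu \/ exists2 i, i \notin [:: p; q] & v = - row i B.
Proof.
move=> hB vL; have fB : frame B by case: hB.
have Bu := frame_unit fB; have sB := half_sum_special hB.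
have [_ pq np nq n0] := hB.
have fuB := special_full d_gt0 nu_neq0 fB sB.
have vV : v \in V by move: vL; rewrite mem_Lneg => /andP [].
have lv := special_Lneg d_gt0 nu_neq0 fB sB vL.
have neg i : i \notin [:: p; q] -> crd B v i = 0 \/ crd B v i = -1.
  by move=> /n0 ?; apply: special_Lneg_crd.
have [/existsP [i /andP [il vi0]]|] :=
    boolP [exists i, (i \notin [:: p; q]) && (crd B v i != 0)].
  right; have vi : crd B v i = -1 by case: (neg i il) => // e; rewrite e eqxx in vi0.
  have hA := half_sum_adj hB il; have fA : frame (adj B i) by case: hA.
  have sA := half_sum_special hA; have fuA := special_full d_gt0 nu_neq0 fA sA.
  have lA : lev (adj B i) v = 0 by rewrite lev_adj // (half_sum_kap hB) // lv vi; lra.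
  have [l vE] := fullP fA fuA vV lA.
  have cA : crd (adj B i) v i = 1.
    by rewrite crd_adj // eqxx (half_sum_crd_nb hB) // vi divff // oppr_eq0 oner_eq0.
  have ll : l \notin [:: p; q].
    apply/negP => ll; have [_ _ _ h] := half_sum_facts hA.
    move: cA; rewrite vE h; first by move/eqP; rewrite eq_sym oner_eq0.
    by rewrite ll (negbTE il).
  have [nl pl] := half_sum_nb hA ll.
  have [nbi phil] := half_sum_nb hB il.
  move: cA; rewrite {1}vE nl crdB !crd_row ?(frame_unit fA) //.
  have [e|_] := eqVneq (phi (adj B i) l) i; last first.
    by case: (l == i) => /= ?; exfalso; lra.
  have [_|li _] := eqVneq l i; first by rewrite subrr => /eqP; rewrite eq_sym oner_eq0.
  have {}vE : v = row (phi B i) B - row i B - row l B.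
    by rewrite vE nl e !row_adj eqxx (negbTE li) nbi.
  exists i => //; have [pe|pl'] := eqVneq (phi B i) l.
    by rewrite vE pe addrAC subrr sub0r.
  exfalso; case: (neg _ phil); rewrite vE !crdB !crd_row // eqxx.
    rewrite (eq_sym i) (negbTE (half_sum_phi_neq hB il)) (eq_sym l) (negbTE pl') /=.
    by move=> ?; lra.
  rewrite (eq_sym i) (negbTE (half_sum_phi_neq hB il)) (eq_sym l) (negbTE pl') /=.
  by move=> ?; lra.
rewrite negb_exists => /forallP h; left.
have v0 i : i \notin [:: p; q] -> crd B v i = 0.
  by move=> il; have := h i; rewrite il negbK => /eqP.
have lvpq : crd B v p + crd B v q = -1.
  rewrite -lv /lev (bigD1 p) //= (bigD1 q) 1?eq_sym //= big1 ?addr0 //.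
  by move=> i /andP [ip iq]; apply: v0; rewrite !inE negb_or ip.
have [kp kq _ _] := half_sum_facts hB.
(* Both coordinates in the pair turn out to be at least -1/2, and they add up to -1. *)
have ge i : kap B i = 2 -> - 2^-1 <= crd B v i.
  move=> k2; have [c0|ci] := leP 0 (crd B v i); first by lra.
  have := crd_ge_or_nb fB vV _ ci; rewrite lv k2 => h'.
  have : -1 - 2 * crd B v i <= 0; last by lra.
  by apply: h'; apply/eqP => e; move: lv; rewrite e (full_lev fB fuB) => ?; lra.
have gep := ge p kp; have geq := ge q kq.
apply: (crdP Bu) => i; rewrite crdN; have [il|il] := boolP (i \in [:: p; q]).
  by move: il; rewrite !inE => /orP [] /eqP ->; rewrite ?np ?nq; lra.
by rewrite v0 // n0 // oppr0.
Qed.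

Lemma half_sum_negrow B i : half_sum B -> i \notin [:: p; q] -> - row i B \in V.
Proof.
move=> hB; have [fB pq _ _ _] := hB.
apply: (Lneg_rows_all (w := - nu)) => //.
  exact: (special_full d_gt0 nu_neq0 fB (half_sum_special hB)).
by move=> v; apply: half_sum_Lneg.
Qed.

(** As for a vertex sum that is a vertex, [nb B l] drops to level -1 of the facet adjacent along i;
    the additional candidate [- nu] is excluded by its p-th coordinate. *)
Lemma half_sum_phi_back B i l : half_sum B ->
  i \notin [:: p; q] -> l \notin [:: p; q] -> phi B l = i -> phi B i = l.
Proof.
move=> hB il ll e; have fB : frame B by case: hB.
have Bu := frame_unit fB.
have hA := half_sum_adj hB il; have fA : frame (adj B i) by case: hA.
have [nl _] := half_sum_nb hB ll; have [ni _] := half_sum_nb hB il.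
have li := half_sum_phi_neq hB ll; rewrite e in li nl.
have wV : row i B - row l B \in Lneg (adj B i).
  rewrite mem_Lneg -nl nbV //= nl lev_adj // (half_sum_kap hB) // levB !lev_row //.
  by rewrite crdB !crd_row // eqxx (eq_sym l) (negbTE li) /=; lra.
have [_ _ np _ _] := hB.
have [|[b bl]] := half_sum_Lneg hA wV.
  move/(congr1 (fun v => crd B v p)); rewrite crdN np crdB !crd_row //.
  have -> : (i == p) = false by apply: contraNF il => /eqP ->; rewrite inE eqxx.
  have -> : (l == p) = false by apply: contraNF ll => /eqP ->; rewrite inE eqxx.
  by rewrite subrr => /eqP; rewrite eq_sym oppr_eq0 invr_eq0 pnatr_eq0.
rewrite row_adj; case: ifP => [_|bi].
  by rewrite ni opprB => /addrI/oppr_inj/(row_inj Bu).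
move/(congr1 (fun v => crd B v i)); rewrite crdN crdB !crd_row // bi eqxx.
by rewrite (eq_sym l) (negbTE li) subr0 oppr0 => /eqP; rewrite oner_eq0.
Qed.

(** The i-th coordinates add up to 0, to which [row i B], [nb B i] and [- row i B] contribute 1 - 1
    - 1. Only another neighbour can make up for this. *)
Lemma half_sum_phi_im B i : half_sum B -> i \notin [:: p; q] ->
  exists2 l, l \notin [:: p; q] & phi B l = i.
Proof.
move=> hB il; have fB : frame B by case: hB.
have Bu := frame_unit fB; have sB := half_sum_special hB.
have fuB := special_full d_gt0 nu_neq0 fB sB.
have [_ _ _ _ n0] := hB; have ni := n0 i il.
have [l li cl] : exists2 l, l != i & 0 < crd B (nb B l) i.
  apply/exists_inP; apply: contraT; rewrite negb_exists => /forallP h.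
  have nb0 : \sum_(l < d | l != i) crd B (nb B l) i <= 0.
    by apply: sumr_le0 => l li; have := h l; rewrite li /= -leNgt.
  have neg v : v \in Lneg B -> crd B v i <= 0.
    by move=> vL; case: (special_Lneg_crd d_gt0 nu_neq0 fB sB ni vL) => ->; lra.
  have := ni; rewrite crd_nu (V_sum fB) (full_sum fB fuB).
  rewrite (bigD1 i) //= crd_row // eqxx big1; last first.
    by move=> l li; rewrite crd_row // (negbTE li).
  rewrite (bigD1 i) //= (half_sum_crd_nb hB) //.
  have wL : - row i B \in Lneg B by rewrite negrow_Lneg // half_sum_negrow.
  rewrite (big_rem _ wL) /= crdN crd_row // eqxx /=.
  have : \sum_(v <- rem (- row i B) (Lneg B)) crd B v i <= 0.
    by rewrite big_seq; apply: sumr_le0 => v /mem_rem/neg.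
  by move=> ? ?; exfalso; lra.
have ll : l \notin [:: p; q].
  apply/negP => ll; have [_ _ _ h] := half_sum_facts hB.
  by move: cl; rewrite h ?ltxx // ll (negbTE il).
exists l => //; have [nl _] := half_sum_nb hB ll.
apply/eqP; move: cl; rewrite nl crdB !crd_row //.
by case: (phi B l == i); rewrite // (negbTE li) subrr ltxx.
Qed.

Lemma half_sum_split B : half_sum B ->
  exists C, hexagons_over C [:: p; q] (E1_of (row p C) (row q C)).
Proof.
move=> hB; have fB : frame B by case: hB.
have Bu := frame_unit fB; have sB := half_sum_special hB.
have fuB := special_full d_gt0 nu_neq0 fB sB.
have [_ pq np nq n0] := hB; have [kp kq nuV _] := half_sum_facts hB.
have wq : crd B (- nu) q != 0 by rewrite crdN nq oppr_eq0 invr_eq0 pnatr_eq0.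
have nuE : nu = 2^-1 *: (row p B + row q B).
  apply: (crdP Bu) => i; rewrite crdZ crdD !crd_row //.
  have [<-|pi] := eqVneq p i; first by rewrite np eq_sym (negbTE pq) /=; lra.
  have [<-|qi] := eqVneq q i; first by rewrite nq /=; lra.
  by rewrite n0 ?addr0 ?mulr0 // !inE negb_or eq_sym pi eq_sym qi.
(* The rows of B generate a sublattice of index 2. The vertex [- nu], half of [- row p B - row q B],
   completes it to the lattice and becomes the vector b of [E1_of]. *)
pose C := repl B q (- nu).
have rp : row p C = row p B by rewrite row_repl (negbTE pq).
have rq : row q C = - nu by rewrite row_repl eqxx.
have ri i : i \notin [:: p; q] -> row i C = row i B.
  by rewrite !inE row_repl => /norP [_ /negbTE ->].
have LC : lattice_basis C.
  apply: lattice_basis_int; first exact: repl_unit.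
    by move=> i; rewrite row_repl; case: ifP => _; apply: VN; rewrite ?frame_row.
  move=> x i Nx; rewrite crd_repl //.
  have int j : j \notin [:: p; q] -> crd B x j \is a Num.int.
    by move=> jl; have := kap_crd_int fB j Nx; rewrite (half_sum_kap hB) // mul1r.
  have intq : 2 * crd B x q \is a Num.int by rewrite -kq kap_crd_int.
  case: ifP => [_|/negbT iq].
    rewrite crdN nq; have -> : crd B x q / - 2^-1 = - (2 * crd B x q) by field.
    by rewrite rpredN.
  rewrite !crdN nq; have [ip|ip] := eqVneq i p.
    rewrite ip np.
    (* The new p-th coordinate is a difference of two coordinates that need not be integral; the
       integral level relates them. *)
    have -> : crd B x p - - 2^-1 / - 2^-1 * crd B x q =
        lev B x - \sum_(j | (j != p) && (j != q)) crd B x j - 2 * crd B x q.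
      rewrite /lev (bigD1 p) //= (bigD1 q) 1?eq_sym //=.
      move: (\sum_(j | _) _) => S; by field.
    rewrite !rpredB ?(frame_int fB) // rpred_sum // => j /andP [jp jq].
    by apply: int; rewrite !inE negb_or jp.
  have il : i \notin [:: p; q] by rewrite !inE negb_or ip.
  by rewrite n0 // oppr0 mul0r mul0r subr0 int.
have phiN i : i \notin [:: p; q] -> phi B i \notin [:: p; q].
  by move=> il; case: (half_sum_nb hB il).
have nbp : nb B p = - row p B - - nu.
  rewrite (half_sum_nb_pair hB (b := q)) ?inE ?eqxx // nuE opprK.
  by apply: (crdP Bu) => i; rewrite !(crdB, crdD, crdN, crdZ); field.
have nbq : nb B q = row p B + - nu.
  rewrite (half_sum_nb_pair hB (b := p)) ?inE ?eqxx ?orbT // nuE.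
  by apply: (crdP Bu) => i; rewrite !(crdB, crdD, crdN, crdZ); field.
have rqE : row q B = - row p B - - nu *+ 2.
  rewrite nuE -scaler_nat; apply: (crdP Bu) => i.
  by rewrite !(crdB, crdD, crdN, crdZ); field.
exists C; apply: (@hexagons_overI _ _ _ (phi B)) => //.
- by rewrite /= inE pq.
- move=> i il; split; [exact: phiN|by have := half_sum_phi_neq hB il|].
  have [l ll e] := half_sum_phi_im hB il.
  by rewrite (half_sum_phi_back hB il ll e).
- rewrite rp rq; apply/allP; rewrite /= -rqE -nbp -nbq.
  by rewrite !frame_row // !nbV // nuV.
- move=> i il; rewrite !ri ?phiN //; apply/allP.
  have [ni _] := half_sum_nb hB il.
  by rewrite /= -ni frame_row // nbV // half_sum_negrow.
move=> v vV; have [vL|] := boolP (v \in Lneg B).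
  have [->|[i il ->]] := half_sum_Lneg hB vL.
    by left; rewrite rq !inE eqxx !orbT.
  by right; exists i; rewrite // ri // !inE eqxx orbT.
rewrite mem_Lneg vV -leNgt le_eqVlt => /orP [/eqP l0|l0].
  have [i ->] := fullP fB fuB vV (esym l0).
  have [il|il] := boolP (i \in [:: p; q]); last first.
    right; exists i => //; have [-> _] := half_sum_nb hB il.
    by rewrite !ri ?phiN // !inE eqxx !orbT.
  left; rewrite rp rq; move: il; rewrite !inE => /orP [] /eqP ->.
    by rewrite nbp eqxx !orbT.
  by rewrite nbq eqxx !orbT.
have [|i ->] := frame_top fB vV.
  by apply/eqP; rewrite eq_le (frame_le1 fB vV) int_gt0 // frame_intV.
have [il|il] := boolP (i \in [:: p; q]); last first.
  by right; exists i; rewrite // ri // !inE eqxx.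
left; rewrite rp rq; move: il; rewrite !inE => /orP [] /eqP ->.
  by rewrite eqxx.
by rewrite -rqE eqxx !orbT.
Qed.

End HalfSumSplit.

Lemma nonzero_sum_split B : (0 < d)%N -> nu != 0 -> frame B -> special B ->
  [\/ exists C a b, hexagons_over C [:: a; b] (V2t_of (row a C) (row b C)),
      exists C a b, hexagons_over C [:: a; b] (E1_of (row a C) (row b C)) |
      exists C a b c,
        hexagons_over C [:: a; b; c] (Q3'_of (row a C) (row b C) (row c C))].
Proof.
move=> d_gt0 nu_neq0 fB sB; have lnu := special_lev_nu d_gt0 nu_neq0 fB sB.
(* The coefficients of [nu] are nonnegative with sum 1, so a coefficient of at least 1 is the only
   one. *)
have [/existsP [p np]|] := boolP [exists p, 1 <= crd B nu p].
  have nuE : nu = row p B.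
    have n0 i : i != p -> crd B nu i = 0.
      move=> ip; apply/eqP; rewrite eq_le sB andbT.
      have := lnu; rewrite /lev (bigD1 p) //= (bigD1 i) //=.
      have : 0 <= \sum_(k | (k != p) && (k != i)) crd B nu k by apply: sumr_ge0.
      by move=> ? ?; lra.
    apply: (crdP (frame_unit fB)) => i; rewrite crd_row ?(frame_unit fB) //.
    have [<-|pi] := eqVneq p i; last by rewrite n0 1?eq_sym.
    have := lnu; rewrite /lev (bigD1 p) //= big1 ?addr0 // => k; exact: n0.
  have [h|h] := vertex_sum_split d_gt0 nu_neq0 (conj fB nuE : vertex_sum p B).
    exact: Or31.
  exact: Or33.
rewrite negb_exists => /forallP h.
have [i|p [q [pq np nq n0 _]]] := half_sum_support d_gt0 nu_neq0 fB sB.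
  by rewrite ltNge h.
have [C hC] := @half_sum_split d_gt0 nu_neq0 p q B (And5 fB pq np nq n0).
by apply: Or32; exists C, p, q.
Qed.

(** * Polytopes with vertex sum zero *)

Section ZeroSum.
Hypotheses (d_gt0 : (0 < d)%N) (nu_eq0 : nu = 0).

Lemma zero_sum_crd B i : crd B nu i = 0.
Proof. by rewrite nu_eq0 crd0. Qed.

Lemma zero_sum_cases B : frame B ->
  (full B /\ exists z, [/\ z \in V, lev B z = -2 &
       forall v, v \in V -> v != z -> -1 <= lev B v]) \/
  (size (L0 B) = (d - 1)%N /\ forall v, v \in V -> -1 <= lev B v).
Proof.
move=> fB; have [i|[_ [l1 _]]|[_ h]] := frame_nu_cases d_gt0 fB.
- by rewrite zero_sum_crd.
- by move: l1; rewrite nu_eq0 lev0 => /eqP; rewrite eq_sym oner_eq0.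
- exact: h.
Qed.

Lemma zero_sum_low B : frame B -> full B -> exists z, [/\ z \in V, lev B z = -2 &
  forall v, v \in V -> v != z -> -1 <= lev B v].
Proof.
move=> fB fuB; case: (zero_sum_cases fB) => [[_ //]|[s _]].
by move: fuB d_gt0; rewrite /full s; lia.
Qed.

Lemma zero_sum_full B v : frame B -> v \in V -> lev B v < -1 -> full B.
Proof.
move=> fB vV lv; case: (zero_sum_cases fB) => [[//]|[_ /(_ v vV)]].
by rewrite leNgt lv.
Qed.

Lemma zero_sum_notfull B : frame B -> ~~ full B ->
  size (L0 B) = (d - 1)%N /\ forall v, v \in V -> -1 <= lev B v.
Proof. by move=> fB nf; case: (zero_sum_cases fB) => [[fu]|//]; rewrite fu in nf. Qed.

(* With [d - 1] vertices at level 0 and one neighbour below level 0, the other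
   [d - 1] neighbours are these vertices, without repetition. *)
Lemma deficient_nb B i : frame B -> size (L0 B) = (d - 1)%N ->
  lev B (nb B i) != 0 ->
  forall j, j != i -> lev B (nb B j) = 0 /\
    forall l, l != j -> 0 <= crd B (nb B j) l.
Proof.
move=> fB s0 nbi.
pose W := [seq nb B j | j <- enum (predC1 i)].
have sub : {subset L0 B <= W}.
  move=> v; rewrite mem_L0 => /andP [vV /eqP l0].
  have [j vj] := lev0_lt0 fB vV l0; have e := lev0_nb fB vV l0 vj.
  apply/mapP; exists j => //; rewrite mem_enum inE.
  by apply: contraNneq nbi => <-; rewrite -e l0.
have szW : size W = (d - 1)%N by rewrite size_map -cardE cardC1 card_ord subn1.
have us : uniq (L0 B) by apply: filter_uniq.
have sz : (size W <= size (L0 B))%N by rewrite szW s0.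
have E := (uniq_min_size us sub sz).2.
have inj : {in predC1 i &, injective (nb B)}.
  by apply/dinjectiveP; apply: leq_size_uniq us sub sz.
move=> j ji; have : nb B j \in W by apply: map_f; rewrite mem_enum.
rewrite -E mem_L0 => /andP [jV /eqP lj].
split=> // l lj'; rewrite leNgt; apply/negP => cl.
have e := lev0_nb fB jV lj cl.
have li : l != i by apply: contraNneq nbi => <-; rewrite -e lj.
by case/eqP: lj'; apply: inj.
Qed.

(** * Vertex sum zero: facets with d vertices on level 0 *)

Section ZeroSumPairs.
Variables (B : 'M[R]_d) (fB : frame B) (fuB : full B).
Let Bu := frame_unit fB.

(** By [kap_full_adj] the adjacent facet has fewer than d vertices on level 0, so its levels are at
    least -1; the removed row has level [1 - kap B i] there. *)
Let kap2_facts i : kap B i != 1 -> [/\ kap B i = 2, ~~ full (adj B i) &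
  forall v, v \in V -> -1 <= lev B v - 2 * crd B v i].
Proof.
move=> ki; have fA := adj_frame i fB.
have nfA : ~~ full (adj B i) by apply: contra ki => /(kap_full_adj fB)/eqP.
have [_ lA] := zero_sum_notfull fA nfA.
have k2 : kap B i = 2.
  have h := lA _ (frame_row fB i); rewrite lev_adj // lev_row // crd_row // eqxx /= in h.
  have k1 := kap_ge1 fB i; apply/eqP; rewrite eq_le; apply/andP; split; first by lra.
  have : 1 <= kap B i - 1; last by lra.
  by apply: int_gt0; [rewrite rpredB ?rpred1 ?kap_int|rewrite subr_gt0 lt_neqAle eq_sym ki].
by split=> // v vV; have := lA v vV; rewrite lev_adj // k2.
Qed.

(** The i-th coordinate is -1/2, so the positive ones add up to 1/2. For one of them, at j, the
    product with [kap B j] is a positive integer; this forces [kap B j = 2] and leaves nothing for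
    the other indices. *)
Let nb_pair i : kap B i != 1 -> exists j, [/\ j != i, kap B j != 1 &
  forall k, crd B (nb B i) k = 2^-1 * ((j == k)%:R - (i == k)%:R)].
Proof.
move=> ki; have [k2 _ _] := kap2_facts ki.
have wi : crd B (nb B i) i = - 2^-1.
  by have := full_kap fB fuB i; rewrite k2 => ?; lra.
have w0 k : k != i -> 0 <= crd B (nb B i) k.
  by move=> ik; apply: full_ge0 => //; rewrite eq_sym.
have lw := full_lev fB fuB i; rewrite /lev (bigD1 i) //= wi in lw.
have [j ji wj] : exists2 j, j != i & 0 < crd B (nb B i) j.
  apply/exists_inP; apply: contraT; rewrite negb_exists => /forallP h.
  suff : \sum_(k < d | k != i) crd B (nb B i) k <= 0 by lra.
  by apply: sumr_le0 => k ki'; have := h k; rewrite ki' /= -leNgt.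
have r0 : 0 <= \sum_(k < d | (k != i) && (k != j)) crd B (nb B i) k.
  by apply: sumr_ge0 => k /andP [/w0].
rewrite (bigD1 j) //= in lw.
have wj2 : crd B (nb B i) j <= 2^-1 by lra.
have kwj : 1 <= kap B j * crd B (nb B i) j.
  by apply: int_gt0; [apply: kap_crd_int => //; apply/VN/nbV|have := kap_ge1 fB j; nra].
have kj : kap B j != 1 by apply/eqP => e; rewrite e in kwj; lra.
have [kj2 _ _] := kap2_facts kj; rewrite kj2 in kwj.
have wjE : crd B (nb B i) j = 2^-1 by lra.
have /psumr_eq0P z : \sum_(k < d | (k != i) && (k != j)) crd B (nb B i) k = 0 by lra.
exists j; split=> // k; have [<-|ik] := eqVneq i k.
  by rewrite (negbTE ji) wi /=; lra.
have [<-|jk] := eqVneq j k; first by rewrite wjE /=; lra.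
rewrite z ?subrr ?mulr0 //; first by move=> l /andP [/w0].
by rewrite eq_sym ik eq_sym jk.
Qed.

Let low i z : kap B i != 1 -> z \in V -> lev B z = -2 -> crd B z i <= - 2^-1.
Proof.
move=> ki zV lz; have [_ _ /(_ z zV)] := kap2_facts ki; rewrite lz; lra.
Qed.

(** Integrality and the bounds leave -1/2 and -1. With -1 the vertex would have level 0 on the
    adjacent facet and a j-th coordinate of at most -3/2 there, against [lev0_ge]. *)
Let low_eq i z : kap B i != 1 -> z \in V -> lev B z = -2 -> crd B z i = - 2^-1.
Proof.
move=> ki zV lz; have [j [ji kj w]] := nb_pair ki.
have [k2 _ _] := kap2_facts ki; have zi := low ki zV lz; have zj := low kj zV lz.
have znb : z != nb B i.
  by apply/eqP => e; move: lz; rewrite e full_lev // => ?; lra.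
have zi0 : crd B z i < 0 by lra.
have zge := crd_ge_or_nb fB zV znb zi0; rewrite lz k2 in zge.
have z2 : 2 * crd B z i \is a Num.int by rewrite -k2; apply: kap_crd_int => //; apply: VN.
have fA := adj_frame i fB.
have zj' : crd (adj B i) z j = crd B z j + crd B z i.
  by rewrite crd_adj // (negbTE ji) !w !eqxx (eq_sym i) (negbTE ji) /=; field.
suff : 2 * crd B z i != -2.
  move=> ne; have : -1 <= 2 * crd B z i; last by lra.
  have : 1 <= 2 * crd B z i + 2; last by lra.
  apply: int_gt0; first by rewrite rpredD ?rpred_nat.
  by rewrite lt_neqAle eq_sym addr_eq0 ne; lra.
apply/eqP => e; have lA : lev (adj B i) z = 0 by rewrite lev_adj // k2 lz; lra.
by have := lev0_ge fA j zV lA; rewrite zj'; lra.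
Qed.

(** The adjacent facet has d - 1 vertices on level 0, and its neighbour along i is not one of them,
    so by [deficient_nb] its neighbour y along j is. The bounds on its coordinates then give half of
    [- row i B - row j B]. *)
Let pair i : kap B i != 1 -> exists j, [/\ j != i, kap B j != 1,
  forall k, crd B (nb B i) k = 2^-1 * ((j == k)%:R - (i == k)%:R) &
  let y := nb (adj B i) j in [/\ y \in V, lev B y = -1,
    forall k, crd B y k = - 2^-1 * ((j == k)%:R + (i == k)%:R) &
    forall x, x \in V -> lev B x = -1 -> crd B x i < 0 -> x = y]].
Proof.
move=> ki; have [j [ji kj w]] := nb_pair ki; exists j; split=> //.
have [k2 nfA geA] := kap2_facts ki; have [_ _ geAj] := kap2_facts kj.
have fA := adj_frame i fB; have [sA lA] := zero_sum_notfull fA nfA.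
have ij : (i == j) = false by rewrite eq_sym (negbTE ji).
have levA v : lev (adj B i) v = lev B v - 2 * crd B v i by rewrite lev_adj // k2.
have crdA v k : crd (adj B i) v k = if k == i then - 2 * crd B v i
    else crd B v k + (j == k)%:R * crd B v i.
  rewrite crd_adj // !w eqxx (negbTE ji).
  have [_|ki'] := eqVneq k i; first by rewrite /=; field.
  by rewrite /=; field.
have [z [zV lz zu]] := zero_sum_low fB fuB.
have zi := low_eq ki zV lz; have zj := low_eq kj zV lz.
have lAz : lev (adj B i) z = -1 by rewrite levA lz zi; lra.
have cAz : crd (adj B i) z j = -1 by rewrite crdA (negbTE ji) eqxx zi zj /=; lra.
have nbAi : lev (adj B i) (nb (adj B i) i) != 0.
  by apply: contraNneq ki => /(kap_nb_adj fB) ->.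
have [ly yge] := deficient_nb fA sA nbAi ji.
rewrite /=; set y := nb (adj B i) j in ly yge *; have yV : y \in V by exact: nbV.
have yj := nb_lt0 j fA; rewrite -/y in yj.
have kA := lev0_kap fA yV ly yj.
(* On the adjacent facet z has level and j-th coordinate -1, which bounds this number by 2; the
   value 2 would make z the neighbour y, whose level is different. *)
have kA1 : kap (adj B i) j = 1.
  have k1 := kap_ge1 fA j; have kint := kap_int fA j; have fG := adj_frame j fA.
  have := frame_le1 fG zV; rewrite lev_adj // lAz cAz => le.
  have ne : kap (adj B i) j != 2.
    apply/eqP => e2; have zy : z = y.
      apply: (nb_top fA zV); first by rewrite cAz; lra.
      by rewrite (lev_adj fA) lAz cAz e2; lra.
    by move: lAz; rewrite zy ly => ?; lra.
  have : kap (adj B i) j - 1 <= 0; last by lra.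
  by apply: int_lt1; [rewrite rpredB ?rpred1|have := ne; rewrite neq_lt => /orP [] ?; lra].
rewrite kA1 mul1r in kA.
have yij : crd B y j + crd B y i = -1.
  by move: kA; rewrite crdA (negbTE ji) eqxx mul1r.
have yi0 : crd B y i <= 0.
  by have := yge i; rewrite crdA eqxx ij => /(_ isT); lra.
have lyB : lev B y = 2 * crd B y i by move: ly; rewrite levA; lra.
have yi_neq0 : crd B y i != 0.
  apply/eqP => e0; rewrite e0 mulr0 in lyB; rewrite e0 addr0 in yij.
  have yn : y = nb B j by apply: lev0_nb => //; rewrite yij; lra.
  have := full_kap fB fuB j; have [kj2 _ _] := kap2_facts kj.
  by rewrite kj2 -yn yij; lra.
have yi_lt0 : crd B y i < 0 by rewrite lt_neqAle yi_neq0.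
have lyN : lev B y = -1.
  have yz : y != z by apply/eqP => e; move: ly; rewrite e lAz => ?; lra.
  have := zu y yV yz; have : lev B y <= -1; last by lra.
  by apply: int_lt0; [apply: frame_intV|lra].
have yiE : crd B y i = - 2^-1 by lra.
have yjE : crd B y j = - 2^-1 by lra.
split=> //.
  have s0 : \sum_(k | (k != i) && (k != j)) crd B y k = 0.
    by have := lyN; rewrite /lev (bigD1 i) //= (bigD1 j) //= yiE yjE; lra.
  have yk k : (k != i) && (k != j) -> 0 <= crd B y k.
    move=> /andP [ki' kj']; have := yge k kj'.
    by rewrite crdA (negbTE ki') (eq_sym j) (negbTE kj') mul0r addr0.
  move: s0 => /(psumr_eq0P yk) z0 k.
  have [<-|ik] := eqVneq i k; first by rewrite (negbTE ji) yiE /=; lra.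
  have [<-|jk] := eqVneq j k; first by rewrite yjE /=; lra.
  by rewrite z0 ?addr0 ?mulr0 // eq_sym ik eq_sym jk.
move=> x xV lx xi; have xnb : x != nb B i.
  by apply/eqP => e; move: lx; rewrite e full_lev // => ?; lra.
have xge := crd_ge_or_nb fB xV xnb xi; rewrite lx k2 in xge.
have x2 : 2 * crd B x i <= -1.
  by apply: int_lt0; [rewrite -k2; apply: kap_crd_int => //; apply: VN|lra].
have xj := geAj x xV; rewrite lx in xj.
apply: (lev0_nb fA xV); first by rewrite levA lx; lra.
by rewrite crdA (negbTE ji) eqxx /=; lra.
Qed.

(** Otherwise [pair] yields j with half-integral vertices in the plane of i and j. After pivots at i
    and j, the vertex z of level -2 and some [nb B l], which these pivots do not affect, would both
    be the neighbour along l, but their levels on B differ. *)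
Lemma zero_sum_full_kap i : kap B i = 1.
Proof.
apply/eqP; apply: contraT => ki.
have [j [ji kj wi []]] := pair ki; set y := nb (adj B i) j => yV ly cy yu.
have [i' [i'j _ wj []]] := pair kj; set y' := nb (adj B j) i' => y'V ly' cy' yu'.
have ij : (i == j) = false by rewrite eq_sym (negbTE ji).
have yy : y = y'.
  by apply: yu' => //; rewrite cy eqxx (eq_sym i) (negbTE ji) /=; lra.
have i'i : i' = i.
  have := cy i; rewrite yy cy' eqxx (negbTE ji).
  by have [//|_ /= h] := eqVneq i' i; clear yy; exfalso; lra.
have yu2 x : x \in V -> lev B x = -1 -> crd B x j < 0 -> x = y.
  by move=> xV lx xj; have xy' := yu' x xV lx xj; rewrite xy' -yy.
rewrite i'i in wj; clear yy yu' cy' ly' y'V y' i'j i'i.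
have [z [zV lz zu]] := zero_sum_low fB fuB.
have zi := low_eq ki zV lz; have zj := low_eq kj zV lz.
(* The a-th coordinates add up to 0, to which [row a B], the neighbours along a and b, z and y
   contribute 1 - 1/2 + 1/2 - 1/2 - 1/2. The other neighbours, nonnegative there, contribute
   nothing. *)
have nb0 a b : kap B a != 1 -> b != a ->
   (forall k, crd B (nb B a) k = 2^-1 * ((b == k)%:R - (a == k)%:R)) ->
   (forall k, crd B (nb B b) k = 2^-1 * ((a == k)%:R - (b == k)%:R)) ->
   crd B y a = - 2^-1 ->
   (forall x, x \in V -> lev B x = -1 -> crd B x a < 0 -> x = y) ->
   forall l, l != a -> l != b -> crd B (nb B l) a = 0.
  move=> ka ba wa wb ya yua; have [ka2 nfA geA] := kap2_facts ka.
  have za := low_eq ka zV lz.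
  have neg v : v \in Lneg B -> v != z -> v != y -> crd B v a = 0.
    rewrite mem_Lneg => /andP [vV lv] vz vy.
    have lv1 : lev B v = -1.
      have := zu v vV vz; have := int_lt0 (frame_intV fB vV) lv; lra.
    have := geA v vV; rewrite lv1 => va.
    have [va0|va0] := leP 0 (crd B v a); first by lra.
    by case/eqP: vy; apply: yua.
  have zL : z \in Lneg B by rewrite mem_Lneg zV lz; lra.
  have yL : y \in rem z (Lneg B).
    rewrite mem_rem_uniq ?filter_uniq // !inE mem_Lneg yV ly.
    by apply/andP; split; [apply/eqP => e; move: ly; rewrite e lz => ?|]; lra.
  have tail0 : \sum_(v <- rem y (rem z (Lneg B))) crd B v a = 0.
    rewrite big_seq big1 // => v.
    rewrite mem_rem_uniq ?rem_uniq ?filter_uniq // inE.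
    rewrite mem_rem_uniq ?filter_uniq // inE => /and3P [vy vz vL].
    exact: neg.
  have := zero_sum_crd B a; rewrite crd_nu (V_sum fB) (full_sum fB fuB).
  rewrite (bigD1 a) //= crd_row // eqxx big1; last first.
    by move=> l la; rewrite crd_row // (negbTE la).
  rewrite (bigD1 a) //= (bigD1 b) //= wa wb !eqxx (negbTE ba).
  rewrite (big_rem z) //= (big_rem y) //= za ya tail0.
  move=> s0; have s1 : \sum_(l < d | (l != a) && (l != b)) crd B (nb B l) a = 0.
    by move: s0 => /=; lra.
  move=> l la lb; move/psumr_eq0P: s1; apply; last by rewrite la.
  by move=> k /andP [ka' _]; apply: full_ge0.
have yi : crd B y i = - 2^-1 by rewrite cy eqxx (negbTE ji) /=; lra.
have yj : crd B y j = - 2^-1 by rewrite cy eqxx ij /=; lra.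
have nbi0 := nb0 i j ki ji wi wj yi yu.
have nbj0 l lj li := nb0 j i kj (negbT ij) wj wi yj yu2 l lj li.
have fA := adj_frame i fB; have fG := adj_frame j fA.
have [k2 _ _] := kap2_facts ki.
have crdA v k : crd (adj B i) v k = if k == i then - 2 * crd B v i
    else crd B v k + (j == k)%:R * crd B v i.
  rewrite crd_adj // !wi eqxx (negbTE ji).
  have [_|ki'] := eqVneq k i; first by rewrite /=; field.
  by rewrite /=; field.
have crdG v k : crd (adj (adj B i) j) v k = if k == j then - crd (adj B i) v j
    else crd (adj B i) v k + crd (adj B i) y k * crd (adj B i) v j.
  rewrite crd_adj // -/y.
  have -> : crd (adj B i) y j = -1 by rewrite crdA (negbTE ji) eqxx yi yj /=; lra.
  by case: ifP => _; field.
have kA1 : kap (adj B i) j = 1.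
  have := kap_nb fA j; rewrite -/y crdA (negbTE ji) eqxx yi yj.
  by rewrite lev_adj // k2 ly yi /=; lra.
have levG v : lev (adj (adj B i) j) v =
    lev B v - 2 * crd B v i - (crd B v j + crd B v i).
  by rewrite lev_adj // kA1 lev_adj // k2 crdA (negbTE ji) eqxx /=; ring.
have lGz : lev (adj (adj B i) j) z = 0 by rewrite levG lz zi zj; lra.
have [l zl] := lev0_lt0 fG zV lGz.
have crdGl v m : m != i -> m != j -> crd (adj (adj B i) j) v m = crd B v m.
  move=> mi mj; have jm : (j == m) = false by rewrite eq_sym (negbTE mj).
  have im : (i == m) = false by rewrite eq_sym (negbTE mi).
  by rewrite crdG (negbTE mj) !crdA (negbTE mi) cy jm im /=; ring.
have lj : l != j.
  apply/eqP => e; move: zl; rewrite e crdG eqxx crdA (negbTE ji) eqxx zi zj /=; lra.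
have li : l != i.
  apply/eqP => e; move: zl; rewrite e crdG ij !crdA eqxx (negbTE ji) eqxx yi zi zj /=; lra.
have zn : z = nb (adj (adj B i) j) l by apply: lev0_nb.
have nbV' := nbV l fB.
have nn : nb B l = nb (adj (adj B i) j) l.
  apply: lev0_nb => //; first by rewrite levG full_lev // nbi0 // nbj0 //; ring.
  by rewrite crdGl // nb_lt0.
by move: lz; rewrite zn -nn full_lev // => ?; exfalso; lra.
Qed.

End ZeroSumPairs.

Lemma zero_sum_good B : frame B -> full B -> good B.
Proof. by move=> fB fuB; split=> // i; apply: zero_sum_full_kap. Qed.

(** A known vertex with these values is the neighbour and forces [kap A i = 1], so chains of pivots
    can be computed without knowing that the frames on the way are good. *)
Lemma nb_eq_adj A i w : frame A -> w \in V -> lev A w = 0 -> crd A w i = -1 ->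
  [/\ nb A i = w, forall v, lev (adj A i) v = lev A v - crd A v i &
   forall v j, crd (adj A i) v j =
     if j == i then - crd A v i else crd A v j + crd A w j * crd A v i].
Proof.
move=> fA wV lw wi; have e : w = nb A i by apply: lev0_nb; rewrite ?wi //; rlra.
have k1 : kap A i = 1 by have := kap_nb fA i; rewrite -e lw wi; rlra.
split=> // [v|v j]; first by rewrite lev_adj // k1 mul1r.
by rewrite crd_adj // -e wi; case: ifP => _; field.
Qed.

Lemma zero_sum_ge B v : frame B -> v \in V -> -2 <= lev B v.
Proof.
move=> fB vV; case: (zero_sum_cases fB) => [[_ [z [_ lz h]]]|[_ /(_ v vV)]]; last by rlra.
by have [->|/(h v vV)] := eqVneq v z; rlra.
Qed.

(** * Vertex sum zero: a vertex on level -2 *)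

Definition low_frame p q B := [/\ frame B, p != q & - row p B - row q B \in V].

Lemma low_frame_sym p q B : low_frame p q B -> low_frame q p B.
Proof. by case=> fB pq zV; split; rewrite 1?eq_sym // addrC. Qed.

(** The coordinates of the vertex of level -2 are 0 or -1: its level on an adjacent facet is at
    least -2, so none is positive, and a coordinate -2 would give level 0 there and a coordinate of
    at most -2 at [phi B i]. *)
Lemma low_frame_ex B : frame B -> full B -> exists p q, low_frame p q B.
Proof.
move=> fB fuB; have gB := zero_sum_good fB fuB; have Bu := frame_unit fB.
have [z [zV lz _]] := zero_sum_low fB fuB.
have z_int i : crd B z i \is a Num.int by apply: good_crd_int => //; apply: VN.
have z_le0 i : crd B z i <= 0.
  have := zero_sum_ge (adj_frame i fB) zV; rewrite good_lev_adj // lz; rlra.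
have z_ge i : -1 <= crd B z i.
  have [z0|zi] := leP 0 (crd B z i); first by rlra.
  have znb : z != nb B i.
    by apply/eqP => e; move: lz; rewrite e full_lev // => ?; rlra.
  have := crd_ge_or_nb fB zV znb zi; rewrite gB.2 lz mul1r => zge.
  have ne : crd B z i != -2.
    apply/eqP => e; have lA : lev (adj B i) z = 0 by rewrite good_lev_adj // lz e; rlra.
    have := lev0_ge (adj_frame i fB) (phi B i) zV lA.
    rewrite good_crd_adj // (negbTE (phi_neq fB gB i)) eqxx e.
    by have := z_le0 (phi B i); rewrite /=; rlra.
  have : 1 <= crd B z i + 2; last by rlra.
  apply: int_gt0; first by rewrite rpredD ?rpred_nat.
  by rewrite lt_neqAle eq_sym addr_eq0 ne; rlra.
have [p zp] : exists p, crd B z p != 0.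
  apply/existsP; apply: contraT; rewrite negb_exists => /forallP h.
  move: lz; rewrite /lev big1 => [|i _]; first by move=> ?; rlra.
  by have := h i; rewrite negbK => /eqP.
have {}zp : crd B z p = -1.
  have : crd B z p <= -1 by apply: int_lt0; rewrite // lt_neqAle zp z_le0.
  by have := z_ge p; rlra.
pose f i := - crd B z i - (i == p)%:R.
have [|||q fq] := @sum1_int R _ f.
- by move=> i; rewrite rpredB ?rpredN // rpred_nat.
- move=> i; rewrite /f; have [->|_] := eqVneq i p; first by rewrite zp /=; rlra.
  by have := z_le0 i; rewrite /=; rlra.
- rewrite sumrB sumrN -/(lev B z) lz (bigD1 p) //= eqxx big1 ?addr0 /=; first by rlra.
  by move=> i /negbTE ->.
exists p, q; split=> //.
  by have := fq p; rewrite /f zp eqxx; have [|] := eqVneq p q => //= _ ?; rlra.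
suff <- : z = - row p B - row q B by [].
apply: (crdP Bu) => i; rewrite crdB crdN !crd_row //.
by have := fq i; rewrite /f !(eq_sym i) => <-; ring.
Qed.

Section LowFrame.
Variables (p q : 'I_d) (B : 'M[R]_d) (hB : low_frame p q B).

Let fB : frame B. Proof. by case: hB. Qed.
Let Bu := frame_unit fB.
Let pq : p != q. Proof. by case: hB. Qed.
Let z := - row p B - row q B.
Let zV : z \in V. Proof. by case: hB. Qed.
Let lz : lev B z = -2. Proof. by rewrite levB levN !lev_row //; rlra. Qed.
Let cz i : crd B z i = - (p == i)%:R - (q == i)%:R.
Proof. by rewrite crdB crdN !crd_row. Qed.

Lemma low_full : full B.
Proof. by apply: (zero_sum_full fB zV); rewrite lz; rlra. Qed.

Lemma low_good : good B. Proof. exact/zero_sum_good/low_full. Qed.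
Let gB := low_good.

Lemma low_ge v : v \in V -> v != z -> -1 <= lev B v.
Proof.
move=> vV vz; have [z' [z'V lz' h]] := zero_sum_low fB low_full.
suff e : z = z' by apply: h; rewrite // -e.
by apply/eqP; apply: contraT => /(h z zV); rewrite lz; rlra.
Qed.

Lemma low_adj i : i \notin [:: p; q] -> low_frame p q (adj B i).
Proof.
rewrite !inE => /norP [ip iq]; split=> //; first exact: adj_frame.
by rewrite !row_adj !(eq_sym _ i) (negbTE ip) (negbTE iq).
Qed.

Lemma low_cases v : v \in V ->
  [\/ exists k, v = row k B, exists k, v = row (phi B k) B - row k B,
      lev B v = -1 | v = z].
Proof.
move=> vV; case: (good_V fB gB vV) => [h|h|]; [exact: Or41|exact: Or42|].
rewrite mem_Lneg vV /= => lv; have [->|vz] := eqVneq v z; first exact: Or44.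
apply: Or43; apply/eqP; rewrite eq_le low_ge // andbT.
by apply: int_lt0; first apply: frame_intV.
Qed.

Lemma low_crd_ge v i : v \in V -> lev B v = -1 -> -1 <= crd B v i.
Proof.
move=> vV lv; have [v0|vi] := leP 0 (crd B v i); first by rlra.
have vnb : v != nb B i.
  by apply/eqP => e; move: lv; rewrite e full_lev ?low_full // => ?; rlra.
by have := crd_ge_or_nb fB vV vnb vi; rewrite gB.2 lv; rlra.
Qed.

Lemma low_crd_int v i : v \in V -> crd B v i \is a Num.int.
Proof. by move=> vV; apply: good_crd_int => //; apply: VN. Qed.

End LowFrame.

(** A pivot off p and q keeps the expression of the vertex of level -2, so v still has a level of at
    least -1 afterwards; this excludes a positive coordinate. *)
Lemma low_crd p q B v i : low_frame p q B -> i \notin [:: p; q] -> v \in V ->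
  lev B v = -1 -> crd B v i = 0 \/ crd B v i = -1.
Proof.
move=> hB il vV lv; have [fB pq zV] := hB; have Bu := frame_unit fB.
have gB := low_good hB; have hA := low_adj hB il.
have e : - row p (adj B i) - row q (adj B i) = - row p B - row q B.
  by move: il; rewrite !inE !row_adj !(eq_sym _ i) => /norP [/negbTE -> /negbTE ->].
have vz : v != - row p (adj B i) - row q (adj B i).
  by apply/eqP; rewrite e => ev; move: lv; rewrite ev levB levN !lev_row // => ?; rlra.
have := low_ge hA vV vz; rewrite good_lev_adj // lv => vi.
have vint := low_crd_int hB i vV; have vge := low_crd_ge hB i vV lv.
have [v0|v0] := leP 0 (crd B v i); first by left; rlra.
by right; have := int_lt0 vint v0; rlra.
Qed.

Lemma low_step p q B v i : low_frame p q B -> i \notin [:: p; q] -> v \in V ->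
  lev B v = -1 -> crd B v i = -1 ->
  exists2 j, j != i & v = row (phi B i) B - row i B - row j B.
Proof.
move=> hB il; apply: good_step; [by case: hB|exact: low_good hB|].
exact: low_good (low_adj hB il).
Qed.

(** [row i B - row l B] has level -1 on the facet adjacent along i. If l is not [phi B i], its
    coordinate at [phi B i] is 1 there, which [low_crd] forbids off p and q. *)
Lemma low_phi_back p q B i l : low_frame p q B -> i \notin [:: p; q] ->
  phi B l = i -> l = phi B i \/ phi B i \in [:: p; q].
Proof.
move=> hB il e; have [fB _ _] := hB; have Bu := frame_unit fB.
have gB := low_good hB; have hA := low_adj hB il.
have [->|li] := eqVneq l (phi B i); first by left.
right; apply: contraT => pil; have lni : l != i by rewrite -e eq_sym phi_neq.
have wV : row i B - row l B \in V by rewrite -{1}e good_phiV.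
have wi : crd B (row i B - row l B) i = 1.
  by rewrite crdB !crd_row // eqxx (negbTE lni) subr0.
have lA : lev (adj B i) (row i B - row l B) = -1.
  by rewrite good_lev_adj // levB !lev_row // wi; rlra.
have pi := phi_neq fB gB i.
have : crd (adj B i) (row i B - row l B) (phi B i) = 1.
  rewrite good_crd_adj // (negbTE pi) eqxx wi crdB !crd_row //.
  by rewrite (eq_sym i) (negbTE pi) (negbTE li) /=; rlra.
by case: (low_crd hA pil wV lA) => -> /eqP;
  rewrite eq_sym ?oner_eq0 // -subr_eq0 opprK -mulr2n pnatr_eq0.
Qed.

(** The p-th coordinates add up to 0, and the vertex of level -2 contributes -1. Without a preimage
    of p some vertex of level -1 would have to compensate, but the shape given by [low_step], or
    else the bound at q, rules out a positive coordinate. *)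
Lemma low_phi_im p q B : low_frame p q B -> exists a, phi B a = p.
Proof.
move=> hB; have [fB pq zV] := hB; have Bu := frame_unit fB.
have gB := low_good hB.
have [/existsP [a /eqP]|] := boolP [exists a, phi B a == p]; first by exists a.
rewrite negb_exists => /forallP h; exfalso.
set z := - row p B - row q B in zV.
have lz : lev B z = -2 by rewrite levB levN !lev_row //; rlra.
have zp : crd B z p = -1.
  by rewrite crdB crdN !crd_row // eqxx (eq_sym q) (negbTE pq) /=; rlra.
have zL : z \in Lneg B by rewrite mem_Lneg zV lz; rlra.
have := good_crd_nu fB gB p; rewrite zero_sum_crd big1; last first.
  by move=> a _; rewrite (negbTE (h a)).
rewrite (big_rem z) //= zp => s0.
have [x xL xp] : exists2 x, x \in rem z (Lneg B) & 0 < crd B x p.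
  apply/hasP; apply: contraT => /hasPn hn.
  have : \sum_(v <- rem z (Lneg B)) crd B v p <= 0; last by rlra.
  by rewrite big_seq; apply: sumr_le0 => v /hn; rewrite -leNgt.
move: xL; rewrite mem_rem_uniq ?filter_uniq // !inE mem_Lneg => /andP [xz /andP [xV lx]].
have lx1 : lev B x = -1.
  by have := low_ge hB xV xz; have := int_lt0 (frame_intV fB xV) lx; rlra.
have xp1 := int_gt0 (low_crd_int hB p xV) xp.
have [/existsP [i /andP [il xi]]|] :=
    boolP [exists i, (i \notin [:: p; q]) && (crd B x i != 0)].
  have {}xi : crd B x i = -1.
    by case: (low_crd hB il xV lx1) => // e; rewrite e eqxx in xi.
  have [j ji xE] := low_step hB il xV lx1 xi.
  have := xp; rewrite xE !crdB !crd_row // (negbTE (h i)).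
  by case: (i == p); case: (j == p) => /= ?; rlra.
rewrite negb_exists => /forallP hx.
have xq := low_crd_ge hB q xV lx1.
have := lx1; rewrite /lev (bigD1 p) //= (bigD1 q) 1?eq_sym //= big1.
  by move=> ?; rlra.
move=> i /andP [ip iq]; have := hx i; rewrite !inE negb_or ip iq /= negbK.
by move/eqP.
Qed.

(* The three configurations excluded below are all the ways in which [phi] can
   fail to exchange [p] and [q]. *)
Lemma low_no_path p q B l : low_frame p q B -> l \notin [:: p; q] ->
  phi B p = l -> phi B l = q -> False.
Proof.
move=> hB ll ep el; have [fB pq zV] := hB; have Bu := frame_unit fB.
have gB := low_good hB; have hA := low_adj hB ll; have [fA _ _] := hA.
have gA := low_good hA; have fuA := low_full hA.
have [lp lq] : l != p /\ l != q by move: ll; rewrite !inE => /norP.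
have qp : (q == p) = false by rewrite eq_sym (negbTE pq).
have lA v : lev (adj B l) v = lev B v - crd B v l by rewrite good_lev_adj.
have cA v j : crd (adj B l) v j =
    if j == l then - crd B v l else crd B v j + (q == j)%:R * crd B v l.
  by rewrite good_crd_adj // el.
pose y := nb (adj B l) p; have yV : y \in V by apply: nbV.
have ly : lev (adj B l) y = 0 by apply: full_lev.
have yp : crd (adj B l) y p = -1 by have := full_kap fA fuA p; rewrite gA.2 mul1r.
move: (ly) (yp); rewrite lA cA (eq_sym p l) (negbTE lp) qp mul0r addr0 => ly' yp'.
have yE : y = row q B - row l B - row p B.
  case: (low_cases hB yV) => [[k e]|[k e]|e|e].
  - by move: yp'; rewrite e crd_row //; case: (k == p) => /= ?; exfalso; rlra.
  - have l0 : lev B y = 0 by rewrite e levB !lev_row // subrr.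
    have e' : y = nb B p by apply: lev0_nb => //; rewrite yp'; rlra.
    move: ly'; rewrite l0 e' good_nb // ep crdB !crd_row // eqxx (eq_sym p) (negbTE lp).
    by move=> /= ?; exfalso; rlra.
  - have yl : crd B y l = -1 by rlra.
    have [j jl yE] := low_step hB ll yV e yl.
    move: yp'; rewrite yE el !crdB !crd_row // qp (negbTE lp).
    by have [->|_] := eqVneq j p => //= ?; exfalso; rlra.
  - move: ly'; rewrite e levB levN !lev_row // crdB crdN !crd_row // !(eq_sym _ l).
    by rewrite (negbTE lp) (negbTE lq) /= => ?; exfalso; rlra.
have [_ lG cG] := nb_eq_adj fA yV ly yp.
(* After the pivots at l and p this vertex has level 0 and l-th coordinate -2, against [lev0_ge]. *)
have vV : row l B - row p B \in V by rewrite -{1}ep good_phiV.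
have fG := adj_frame p fA.
have cv : forall j, crd B (row l B - row p B) j = (l == j)%:R - (p == j)%:R.
  by move=> j; rewrite crdB !crd_row.
have lGv : lev (adj (adj B l) p) (row l B - row p B) = 0.
  rewrite lG lA levB !lev_row // !cA (eq_sym p l) (negbTE lp) qp !cv !eqxx.
  by rewrite (negbTE lp) (eq_sym p) (negbTE lp) /=; rlra.
have := lev0_ge fG l vV lGv.
rewrite cG (negbTE lp) !cA eqxx (eq_sym p l) (negbTE lp) qp !cv yE !crdB !crd_row //.
rewrite !eqxx (negbTE lp) (eq_sym p) (negbTE lp) (eq_sym q) (negbTE lq) /=.
by move=> ?; rlra.
Qed.

(** After pivots at b, where [phi B b = q], and at q, the vertex z of level -2 has level -1 and p-th
    coordinate -2. A pivot at p would then put it on the facet and identify it with the new vertex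
    [row l B - row p B], which has level 0 on B. *)
Lemma low_no_fork p q B l : low_frame p q B -> l \notin [:: p; q] ->
  phi B p = l -> phi B l = p -> phi B q = p -> False.
Proof.
move=> hB ll ep el eq; have [fB pq zV] := hB; have Bu := frame_unit fB.
have gB := low_good hB; have qp : (q == p) = false by rewrite eq_sym (negbTE pq).
have [lp lq] : l != p /\ l != q by move: ll; rewrite !inE => /norP.
have [b eb] := low_phi_im (low_frame_sym hB).
have bp : b != p by apply/eqP => bp; move: lq; rewrite -eb bp ep eqxx.
have bq : b != q by apply/eqP => bq; move: pq; rewrite -eb bq eq eqxx.
have bl : b != l by apply/eqP => bl; move: pq; rewrite -eb bl el eqxx.
have bN : b \notin [:: p; q] by rewrite !inE negb_or bp.
have hA := low_adj hB bN; have [fA _ _] := hA.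
have lA v : lev (adj B b) v = lev B v - crd B v b by rewrite good_lev_adj.
have cA v j : crd (adj B b) v j =
    if j == b then - crd B v b else crd B v j + (q == j)%:R * crd B v b.
  by rewrite good_crd_adj // eb.
have [bpF bqF blF] : [/\ (p == b) = false, (q == b) = false & (l == b) = false].
  by rewrite !(eq_sym _ b) (negbTE bp) (negbTE bq) (negbTE bl).
have [plF qlF] : (p == l) = false /\ (q == l) = false.
  by rewrite !(eq_sym _ l) (negbTE lp) (negbTE lq).
pose w := row p B - row q B; have wV : w \in V by rewrite /w -{1}eq good_phiV.
have cw j : crd B w j = (p == j)%:R - (q == j)%:R by rewrite crdB !crd_row.
have lw : lev (adj B b) w = 0.
  by rewrite lA levB !lev_row // cw bpF bqF /=; rlra.
have cAw j : crd (adj B b) w j = crd B w j.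
  rewrite cA; case: eqP => [->|_]; first by rewrite cw bpF bqF subrr oppr0.
  by rewrite (cw b) bpF bqF subrr mulr0 addr0.
have wq : crd (adj B b) w q = -1 by rewrite cAw cw (negbTE pq) eqxx sub0r.
have [_ lG cG] := nb_eq_adj fA wV lw wq.
have fG := adj_frame q fA.
pose v := row l B - row p B; have vV : v \in V by rewrite /v -{1}ep good_phiV.
have cv j : crd B v j = (l == j)%:R - (p == j)%:R by rewrite crdB !crd_row.
have lGv : lev (adj (adj B b) q) v = 0.
  rewrite lG lA levB !lev_row // cA bqF eqxx !cv blF bpF (negbTE lq) (negbTE pq) /=.
  by rlra.
have vp : crd (adj (adj B b) q) v p = -1.
  rewrite cG (negbTE pq) !cA bpF bqF eqxx qp !cv blF bpF (negbTE lq) (negbTE pq).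
  by rewrite (negbTE lp) eqxx /=; rlra.
have [nbE lH _] := nb_eq_adj fG vV lGv vp.
set z := - row p B - row q B in zV.
have cz j : crd B z j = - (p == j)%:R - (q == j)%:R by rewrite crdB crdN !crd_row.
have lz : lev B z = -2 by rewrite levB levN !lev_row //; rlra.
have zp : crd (adj (adj B b) q) z p = -2.
  rewrite cG (negbTE pq) !cA bpF bqF eqxx qp !cz !cw bpF bqF (negbTE pq) !eqxx qp.
  by rewrite /=; rlra.
have lHz : lev (adj (adj (adj B b) q) p) z = 1.
  rewrite lH zp lG lA cA bqF eqxx !cz bpF bqF (negbTE pq) eqxx lz /=; rlra.
have zv : z = v by rewrite -nbE; apply: nb_top; rewrite // zp; rlra.
by move: lz; rewrite zv levB !lev_row // => ?; rlra.
Qed.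

(** After pivots at p, q and l the vertices [- row l B] and [row q B] both have level 0 and q-th
    coordinate -1, so both would be the neighbour along q. *)
Lemma low_no_two_pairs p q B l m : low_frame p q B ->
  l \notin [:: p; q] -> m \notin [:: p; q] ->
  phi B p = l -> phi B l = p -> phi B q = m -> phi B m = q -> False.
Proof.
move=> hB ll mm ep el eq em; have [fB pq zV] := hB; have Bu := frame_unit fB.
have gB := low_good hB; have qp : (q == p) = false by rewrite eq_sym (negbTE pq).
have [lp lq] : l != p /\ l != q by move: ll; rewrite !inE => /norP.
have [mp mq] : m != p /\ m != q by move: mm; rewrite !inE => /norP.
have lm : l != m by apply/eqP => lm; move: pq; rewrite -el -em lm eqxx.
have [plF qlF mlF] : [/\ (p == l) = false, (q == l) = false & (m == l) = false].
  by rewrite !(eq_sym _ l) (negbTE lp) (negbTE lq) (negbTE lm).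
(* This vertex is found as the neighbour along p of the facet adjacent along l. *)
have negl : - row l B \in V.
  have hA := low_adj hB ll; have [fA _ _] := hA.
  have gA := low_good hA; have fuA := low_full hA.
  pose y := nb (adj B l) p; have yV : y \in V by apply: nbV.
  have ly : lev (adj B l) y = 0 by apply: full_lev.
  have yp : crd (adj B l) y p = -1 by have := full_kap fA fuA p; rewrite gA.2 mul1r.
  move: ly yp; rewrite good_lev_adj // good_crd_adj // plF el eqxx mul1r => ly' yp'.
  suff <- : y = - row l B by [].
  case: (low_cases hB yV) => [[k e]|[k e]|e|e].
  - move: ly' yp'; rewrite e lev_row // !crd_row //.
    by have [->|_] := eqVneq k l; rewrite ?(negbTE lp) /= => ? ?; exfalso; rlra.
  - have l0 : lev B y = 0 by rewrite e levB !lev_row // subrr.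
    have e' : y = nb B p by apply: lev0_nb => //; rlra.
    move: ly'; rewrite l0 e' good_nb // ep crdB !crd_row // eqxx plF.
    by move=> /= ?; exfalso; rlra.
  - have yl : crd B y l = -1 by rlra.
    have [j jl yE] := low_step hB ll yV e yl.
    move: yp'; rewrite yl yE el !crdB !crd_row // eqxx (negbTE lp).
    have [->|_] := eqVneq j p; last by move=> /= ?; exfalso; rlra.
    by move=> _; rewrite addrAC subrr sub0r.
  - move: ly'; rewrite e levB levN !lev_row // crdB crdN !crd_row //.
    by rewrite plF qlF /= => ?; exfalso; rlra.
have fA := adj_frame p fB.
have lA v : lev (adj B p) v = lev B v - crd B v p by rewrite good_lev_adj.
have cA v j : crd (adj B p) v j =
    if j == p then - crd B v p else crd B v j + (l == j)%:R * crd B v p.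
  by rewrite good_crd_adj // ep.
pose w := row m B - row q B; have wV : w \in V by rewrite /w -{1}eq good_phiV.
have cw j : crd B w j = (m == j)%:R - (q == j)%:R by rewrite crdB !crd_row.
have cAw j : crd (adj B p) w j = crd B w j.
  rewrite cA (cw p) (negbTE mp) qp subrr mulr0 addr0 oppr0.
  by case: eqP => // ->; rewrite cw (negbTE mp) qp subrr.
have lw : lev (adj B p) w = 0 by rewrite lA levB !lev_row // cw (negbTE mp) qp /=; rlra.
have wq : crd (adj B p) w q = -1 by rewrite cAw cw (negbTE mq) eqxx sub0r.
have [_ lG cG] := nb_eq_adj fA wV lw wq; have fG := adj_frame q fA.
have cAq v : crd (adj B p) v q = crd B v q by rewrite cA qp (negbTE lq) mul0r addr0.
have cGl v : crd (adj (adj B p) q) v l = crd B v l + crd B v p.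
  rewrite cG (negbTE lq) cAw cw mlF qlF subrr mul0r addr0 cA (negbTE lp) eqxx.
  by rewrite mul1r.
have cGq v : crd (adj (adj B p) q) v q = - crd B v q by rewrite cG eqxx cAq.
have lG' v : lev (adj (adj B p) q) v = lev B v - crd B v p - crd B v q.
  by rewrite lG lA cAq.
set z := - row p B - row q B in zV.
have cz j : crd B z j = - (p == j)%:R - (q == j)%:R by rewrite crdB crdN !crd_row.
have lz : lev B z = -2 by rewrite levB levN !lev_row //; rlra.
have lGz : lev (adj (adj B p) q) z = 0.
  by rewrite lG' lz !cz !eqxx qp (negbTE pq) /=; rlra.
have zl : crd (adj (adj B p) q) z l = -1.
  by rewrite cGl !cz plF qlF eqxx qp /=; rlra.
have [_ lH cH] := nb_eq_adj fG zV lGz zl; have fH := adj_frame l fG.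
have row_l : lev (adj (adj (adj B p) q) l) (- row l B) = 0 /\
    crd (adj (adj (adj B p) q) l) (- row l B) q = -1.
  rewrite lH cH qlF !lG' !cGl !cGq cz levN lev_row // !crdN !crd_row //.
  by rewrite (negbTE lp) (negbTE lq) !eqxx (negbTE pq) /=; split; rlra.
have row_q : lev (adj (adj (adj B p) q) l) (row q B) = 0 /\
    crd (adj (adj (adj B p) q) l) (row q B) q = -1.
  rewrite lH cH qlF !lG' !cGl !cGq cz lev_row // !crd_row //.
  by rewrite qp qlF !eqxx (negbTE pq) /=; split; rlra.
have e1 : - row l B = nb (adj (adj (adj B p) q) l) q.
  by apply: lev0_nb; rewrite // ?row_l.1 ?row_l.2 //; rlra.
have e2 : row q B = nb (adj (adj (adj B p) q) l) q.
  by apply: lev0_nb; rewrite // ?frame_row ?row_q.1 ?row_q.2 //; rlra.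
by have := congr1 (lev B) (etrans e1 (esym e2)); rewrite levN !lev_row // => ?; rlra.
Qed.

Lemma low_phi_pq p q B : low_frame p q B -> phi B p = q.
Proof.
move=> hB; have [fB pq _] := hB; have gB := low_good hB.
have hB' := low_frame_sym hB.
apply/eqP; apply: contraT => lq; have lp := phi_neq fB gB p.
have swap i : (i \notin [:: q; p]) = (i \notin [:: p; q]).
  by rewrite !inE orbC.
have ll : phi B p \notin [:: p; q] by rewrite !inE negb_or lp.
have el : phi B (phi B p) = p.
  case: (low_phi_back hB ll (erefl _)) => [//|].
  by rewrite !inE => /orP [] /eqP // /(low_no_path hB ll (erefl _)).
have mq := phi_neq fB gB q.
have [mp|mp] := eqVneq (phi B q) p.
  by case: (low_no_fork hB ll (erefl _) el mp).
have mm : phi B q \notin [:: p; q] by rewrite !inE negb_or mp.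
have em : phi B (phi B q) = q.
  have mm' : phi B q \notin [:: q; p] by rewrite swap.
  case: (low_phi_back hB mm (erefl _)) => [//|].
  by rewrite !inE => /orP [] /eqP // /(low_no_path hB' mm' (erefl _)).
by case: (low_no_two_pairs hB ll mm (erefl _) el (erefl _) em).
Qed.

Lemma low_split p q B : low_frame p q B ->
  hexagons_over B [:: p; q] (E2_of (row p B) (row q B)).
Proof.
(* Facts about one index of the pair suffice, because [low_frame] is symmetric in p and q. *)
suff half : forall p q, low_frame p q B -> [/\ - row p B \notin V,
    forall l, phi B l = p -> l = q &
    forall v, v \in V -> lev B v = -1 -> crd B v p = 0].
  move=> hB; have hB' := low_frame_sym hB; have [fB pq zV] := hB.
  have Bu := frame_unit fB; have gB := low_good hB.
  have [_ imp vp0] := half p q hB; have [_ imq vq0] := half q p hB'.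
  have ep := low_phi_pq hB; have eq := low_phi_pq hB'.
  have phiN i : i \notin [:: p; q] -> phi B i \notin [:: p; q].
    rewrite !inE => /norP [ip iq]; apply/norP; split.
      by apply: contra iq => /eqP /imp ->.
    by apply: contra ip => /eqP /imq ->.
  set z := - row p B - row q B in zV.
  have neg v : v \in Lneg B -> v = z \/ exists2 i, i \notin [:: p; q] & v = - row i B.
    rewrite mem_Lneg => /andP [vV vneg]; have [->|vz] := eqVneq v z; first by left.
    right; have lv : lev B v = -1.
      have := low_ge hB vV vz; have := int_lt0 (frame_intV fB vV) vneg; rlra.
    have v0 := vp0 v vV lv; have v0' := vq0 v vV lv.
    have [/existsP [i /andP [il vi]]|] :=
        boolP [exists i, (i \notin [:: p; q]) && (crd B v i != 0)].
      have {}vi : crd B v i = -1.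
        by case: (low_crd hB il vV lv) => // e; rewrite e eqxx in vi.
      have [j ji vE] := low_step hB il vV lv vi.
      exists i => //; have [e|jphi] := eqVneq j (phi B i).
        by rewrite vE e addrAC subrr sub0r.
      have ci : crd B v (phi B i) = 1.
        rewrite vE !crdB !crd_row // eqxx (negbTE jphi) (eq_sym i).
        by rewrite (negbTE (phi_neq fB gB i)) !subr0.
      by case: (low_crd hB (phiN i il) vV lv); rewrite ci => ?; exfalso; rlra.
    rewrite negb_exists => /forallP h.
    have : lev B v = 0; last by rewrite lv => ?; exfalso; rlra.
    rewrite /lev big1 // => i _; have [|il] := boolP (i \in [:: p; q]).
      by rewrite !inE => /orP [] /eqP ->.
    by have := h i; rewrite il /= negbK => /eqP.
  have negV := Lneg_rows_all fB gB.1 pq neg.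
  have phi_inv i : i \notin [:: p; q] -> phi B (phi B i) = i.
    move=> il; have [/existsP [l /eqP e]|] := boolP [exists l, phi B l == i].
      case: (low_phi_back hB il e) => [<- //|].
      by rewrite (negbTE (phiN i il)).
    rewrite negb_exists => /forallP h; exfalso.
    have := good_crd_nu fB gB i; rewrite zero_sum_crd big1; last first.
      by move=> l _; rewrite (negbTE (h l)).
    have wL : - row i B \in Lneg B by rewrite negrow_Lneg // negV.
    rewrite (big_rem _ wL) /= crdN crd_row // eqxx /= => s0.
    have : \sum_(v <- rem (- row i B) (Lneg B)) crd B v i <= 0; last by rlra.
    rewrite big_seq; apply: sumr_le0 => v /mem_rem /neg [->|[j jl ->]].
      rewrite crdB crdN !crd_row //.
      by case: (p == i); case: (q == i) => /=; rlra.
    by rewrite crdN crd_row //; case: (j == i) => /=; rlra.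
  apply: (@hexagons_overI _ _ _ (phi B)) => //.
  - exact: good_lattice_basis.
  - by rewrite /= inE pq.
  - by move=> i il; split; [exact: phiN|exact: phi_neq|exact: phi_inv].
  - apply/allP; rewrite /= !frame_row // zV.
    have := good_phiV p fB gB; have := good_phiV q fB gB.
    by rewrite ep eq => -> ->.
  - move=> i il; apply/allP.
    by rewrite /= frame_row // negV // good_phiV.
  move=> v vV; have shape i u : u \in [:: row i B; row (phi B i) B - row i B] ->
      u \in E2_of (row p B) (row q B) \/ (exists2 i0, i0 \notin [:: p; q] &
        u \in [:: row i0 B; - row i0 B; row (phi B i0) B - row i0 B]).
    rewrite !inE => uE; have [il|il] := boolP (i \in [:: p; q]); last first.
      right; exists i => //; rewrite !inE.
      by case/orP: uE => ->; rewrite ?orbT.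
    left; move: il uE; rewrite !inE => /orP [] /eqP ->; rewrite ?ep ?eq.
      by case/orP => ->; rewrite ?orbT.
    by case/orP => ->; rewrite ?orbT.
  case: (good_V fB gB vV) => [[i ->]|[i ->]|/neg [->|[i il ->]]].
  - by apply: (shape i); rewrite !inE eqxx.
  - by apply: (shape i); rewrite !inE eqxx orbT.
  - by left; rewrite !inE eqxx !orbT.
  - by right; exists i; rewrite // !inE eqxx orbT.
move=> {}p {}q hB; have [fB pq zV] := hB; have Bu := frame_unit fB.
have gB := low_good hB; have hB' := low_frame_sym hB.
have ep := low_phi_pq hB; have eq := low_phi_pq hB'.
have qp : (q == p) = false by rewrite eq_sym (negbTE pq).
set z := - row p B - row q B in zV.
have cz j : crd B z j = - (p == j)%:R - (q == j)%:R by rewrite crdB crdN !crd_row.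
have lz : lev B z = -2 by rewrite levB levN !lev_row //; rlra.
(* On the facet adjacent along p this vertex would be the neighbour along q. There z has level -1
   and q-th coordinate -2, so the pivot at q would put z on the facet too, as the same neighbour. *)
have negp : - row p B \notin V.
  apply/negP => negp; have fA := adj_frame p fB.
  have lA v : lev (adj B p) v = lev B v - crd B v p by rewrite good_lev_adj.
  have cAq v : crd (adj B p) v q = crd B v q + crd B v p.
    by rewrite good_crd_adj // qp ep eqxx mul1r.
  have e1 : - row p B = nb (adj B p) q.
    apply: lev0_nb => //; first by rewrite lA levN lev_row // crdN crd_row // eqxx /=; rlra.
    by rewrite cAq !crdN !crd_row // eqxx (negbTE pq) /=; rlra.
  have lAz : lev (adj B p) z = -1 by rewrite lA lz cz eqxx qp /=; rlra.
  have cAz : crd (adj B p) z q = -2 by rewrite cAq !cz !eqxx qp (negbTE pq) /=; rlra.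
  have k1 := kap_ge1 fA q.
  have := frame_le1 (adj_frame q fA) zV; rewrite lev_adj // lAz cAz => k2.
  have e2 : z = nb (adj B p) q.
    by apply: nb_top; rewrite // ?cAz ?(lev_adj fA) ?lAz ?cAz; rlra.
  by move: lz; rewrite e2 -e1 levN lev_row // => ?; rlra.
(* A coordinate -1 at p and another one at some i off the pair would make v the neighbour along p of
   the facet adjacent along i, but that is [nb B p]. Without such an i, v is [- row p B]. *)
have vp_ge v : v \in V -> lev B v = -1 -> 0 <= crd B v p.
  move=> vV lv; apply: int_gtN1; first exact: (low_crd_int hB p vV).
  rewrite lt_neqAle (low_crd_ge hB p vV lv) andbT eq_sym; apply/eqP => vp.
  have [/existsP [i /andP [il vi]]|] :=
      boolP [exists i, (i \notin [:: p; q]) && (crd B v i != 0)].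
    have {}vi : crd B v i = -1.
      by case: (low_crd hB il vV lv) => // e; rewrite e eqxx in vi.
    have [ip iq] : i != p /\ i != q by move: il; rewrite !inE => /norP.
    have fA := adj_frame i fB.
    have e1 : v = nb (adj B i) p.
      apply: lev0_nb => //; first by rewrite good_lev_adj // lv vi subrr.
      rewrite good_crd_adj // (eq_sym p) (negbTE ip) vi vp.
      by case: (phi B i == p) => /=; rlra.
    have e2 : nb B p = nb (adj B i) p.
      apply: lev0_nb => //; first exact: nbV.
        rewrite good_lev_adj // full_lev ?low_full // ?gB.1 //.
        by rewrite good_crd_nb // ep !(eq_sym _ i) (negbTE ip) (negbTE iq) /=; rlra.
      rewrite good_crd_adj // (eq_sym p) (negbTE ip) !good_crd_nb // ep qp eqxx.
      by rewrite !(eq_sym _ i) (negbTE ip) (negbTE iq) /=; rlra.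
    by move: lv; rewrite e1 -e2 full_lev ?gB.1 // => ?; rlra.
  rewrite negb_exists => /forallP h.
  have v0 i : i != p -> i != q -> crd B v i = 0.
    by move=> ip iq; have := h i; rewrite !inE negb_or ip iq /= negbK => /eqP.
  have vq : crd B v q = 0.
    have := lv; rewrite /lev (bigD1 p) //= (bigD1 q) 1?eq_sym //= big1; last first.
      by move=> i /andP [ip iq]; apply: v0.
    by rewrite vp => ?; rlra.
  have vE : v = - row p B.
    apply: (crdP Bu) => i; rewrite crdN crd_row //.
    have [<-|pi] := eqVneq p i; first by rewrite vp.
    have [->|iq] := eqVneq i q; first by rewrite vq oppr0.
    by rewrite v0 ?oppr0 // eq_sym.
  by move: negp; rewrite -vE vV.
have zL : z \in Lneg B by rewrite mem_Lneg zV lz; rlra.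
have remP v : v \in rem z (Lneg B) -> v \in V /\ lev B v = -1.
  rewrite mem_rem_uniq ?filter_uniq // !inE mem_Lneg => /andP [vz /andP [vV lv]].
  split=> //; have := low_ge hB vV vz.
  by have := int_lt0 (frame_intV fB vV) lv; rlra.
(* In the sum of the p-th coordinates the preimage q of p and the vertex z cancel; the remaining
   terms are nonnegative, hence 0. *)
have := good_crd_nu fB gB p; rewrite zero_sum_crd (bigD1 q) //= eq eqxx.
rewrite (big_rem z) //= cz eqxx qp => s0.
have r1 : 0 <= \sum_(l < d | l != q) (phi B l == p)%:R :> R by apply: sumr_ge0.
have g2 v : v \in rem z (Lneg B) -> 0 <= crd B v p.
  by move=> /remP [vV lv]; apply: vp_ge.
have r2 : 0 <= \sum_(v <- rem z (Lneg B)) crd B v p.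
  by rewrite big_seq; apply: sumr_ge0 => v /g2.
have /psumr_eq0P z1 : \sum_(l < d | l != q) (phi B l == p)%:R = 0 :> R.
  by move: s0 r1 r2 => /=; rlra.
have z2 : \sum_(v <- rem z (Lneg B)) crd B v p = 0 by move: s0 r1 r2 => /=; rlra.
split=> //.
  move=> l e; apply/eqP; apply: contraT => lq.
  have := z1 _ l lq; rewrite e eqxx /= => /(_ (fun _ _ => ler0n _ _)) /eqP.
  by rewrite oner_eq0.
move=> v vV lv; have vr : v \in rem z (Lneg B).
  rewrite mem_rem_uniq ?filter_uniq // !inE mem_Lneg vV lv.
  by apply/andP; split; [apply/eqP => e; move: lv; rewrite e lz => ?|]; rlra.
apply/eqP; rewrite eq_le vp_ge // andbT -z2 (big_rem v) //= lerDl.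
by rewrite big_seq; apply: sumr_ge0 => u /mem_rem/g2.
Qed.

(** * Vertex sum zero: centrally symmetric vertex sets *)

Section Symmetric.
Hypothesis V_sym : forall v, v \in V -> - v \in V.
Variables (B : 'M[R]_d) (fB : frame B).
Let Bu := frame_unit fB.

Let lev_ge v : v \in V -> -1 <= lev B v.
Proof.
by move=> /V_sym vV; have := frame_le1 fB vV; rewrite levN; rlra.
Qed.

Let L0_size_sym : size (L0 B) = (d - 1)%N.
Proof.
case: (zero_sum_cases fB) => [[_ [z [zV lz _]]]|[//]].
by have := lev_ge zV; rewrite lz => ?; exfalso; rlra.
Qed.

Let lev_neg v : v \in V -> lev B v < 0 -> exists i, v = - row i B.
Proof.
move=> vV lv; have lv1 : lev B v <= -1 by apply: int_lt0; first apply: frame_intV.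
have [|i e] := frame_top fB (V_sym vV).
  by rewrite levN; have := lev_ge vV; rlra.
by exists i; rewrite -e opprK.
Qed.

(** The vertex [- row i B] has level [kap B i - 1] on the adjacent facet, so [kap B i] is at most 2.
    The value 2 would make it the neighbour, whose level on B is 0 instead of -1. *)
Let kap_lev0 i : lev B (nb B i) = 0 -> kap B i = 1.
Proof.
move=> l0; have k1 := kap_ge1 fB i; have fA := adj_frame i fB.
have wV : - row i B \in V by apply: V_sym; apply: frame_row.
have lw : lev (adj B i) (- row i B) = -1 + kap B i.
  by rewrite lev_adj // levN lev_row // crdN crd_row // eqxx /=; ring.
have := frame_le1 fA wV; rewrite lw => k2.
have ne : kap B i != 2.
  apply/eqP => e; have e1 : - row i B = nb B i.
    apply: nb_top; rewrite // ?lw ?e; last by rlra.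
    by rewrite crdN crd_row // eqxx /=; rlra.
  by move: l0; rewrite -e1 levN lev_row // => ?; rlra.
have : kap B i - 1 <= 0; last by rlra.
apply: int_lt1; first by rewrite rpredB ?rpred1 ?kap_int.
by move: ne; rewrite neq_lt => /orP [] ?; rlra.
Qed.

Let crd_lev0 v i : v \in V -> lev B v = 0 -> crd B v i != 0 ->
  lev B (nb B i) = 0 /\
  (v = nb B i /\ crd B v i = -1 \/ - v = nb B i /\ crd B v i = 1).
Proof.
move=> vV lv; rewrite neq_lt => /orP [vi|vi].
  have e := lev0_nb fB vV lv vi; have l0 : lev B (nb B i) = 0 by rewrite -e.
  split=> //; left; split=> //; have := lev0_kap fB vV lv vi.
  by rewrite kap_lev0 // mul1r.
have nV := V_sym vV; have nl : lev B (- v) = 0 by rewrite levN lv oppr0.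
have ni : crd B (- v) i < 0 by rewrite crdN; rlra.
have e := lev0_nb fB nV nl ni; have l0 : lev B (nb B i) = 0 by rewrite -e.
split=> //; right; split=> //; have := lev0_kap fB nV nl ni.
by rewrite kap_lev0 // mul1r crdN => ?; rlra.
Qed.

(** Otherwise d neighbours lie among d - 1 vertices of level 0, so some x is the neighbour along
    both i and j. Its two coordinates -1 are balanced by at least two positive ones, each at most 1,
    along which the neighbour is [- x]. This leaves at most d - 2 distinct neighbours, too few for
    the vertices of level 0. *)
Let apex : exists i, lev B (nb B i) != 0.
Proof.
apply/existsP; apply: contraT; rewrite negb_exists => /forallP h.
have l0 i : lev B (nb B i) = 0 by have := h i; rewrite negbK => /eqP.
have mem v : v \in L0 B -> exists i, v = nb B i.
  by move=> /(L0_sub fB) /mapP [i _ ->]; exists i.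
have [i [j [ij e]]] : exists i j, i != j /\ nb B i = nb B j.
  have [/injectiveP inj|/injectivePn [i [j ij e]]] := boolP (injectiveb (nb B)).
    have us : uniq [seq nb B i | i <- enum 'I_d] by rewrite map_inj_uniq ?enum_uniq.
    have sub : {subset [seq nb B i | i <- enum 'I_d] <= L0 B}.
      by move=> v /mapP [i _ ->]; rewrite mem_L0 nbV //= l0.
    have := uniq_leq_size us sub; rewrite size_map size_enum_ord L0_size_sym.
    by lia.
  by exists i, j.
set x := nb B i in e; have xV : x \in V by apply: nbV.
have lx : lev B x = 0 by apply: l0.
have xi : crd B x i = -1 by have := kap_nb fB i; rewrite kap_lev0 // mul1r l0 sub0r.
have xj : crd B x j = -1.
  by have := kap_nb fB j; rewrite kap_lev0 // mul1r l0 sub0r e.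
have x1 k : crd B x k <= 1.
  have [->|xk] := eqVneq (crd B x k) 0; first by rlra.
  by have [_ [[_ ->]|[_ ->]]] := crd_lev0 xV lx xk; rlra.
have [l li xl] : exists2 l, (l != i) && (l != j) & 0 < crd B x l.
  apply/exists_inP; apply: contraT; rewrite negb_exists => /forallP hn.
  suff : \sum_(k < d | (k != i) && (k != j)) crd B x k <= 0.
    by move: lx; rewrite /lev (bigD1 i) //= (bigD1 j) 1?eq_sym //= xi xj => ? ?; exfalso; rlra.
  by apply: sumr_le0 => k ki; have := hn k; rewrite ki /= -leNgt.
have [l' li' xl'] : exists2 l', [&& l' != i, l' != j & l' != l] & 0 < crd B x l'.
  apply/exists_inP; apply: contraT; rewrite negb_exists => /forallP hn.
  suff : \sum_(k < d | (k != i) && (k != j) && (k != l)) crd B x k <= 0.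
    move: lx; rewrite /lev (bigD1 i) //= (bigD1 j) 1?eq_sym //= (bigD1 l) //=.
    by have := x1 l; rewrite xi xj => ? ? ?; exfalso; rlra.
  by apply: sumr_le0 => k; rewrite -andbA => ki; have := hn k; rewrite ki /= -leNgt.
have nx k : 0 < crd B x k -> nb B k = - x.
  move=> xk; have [|_ [[_ ck]|[-> //]]] := crd_lev0 xV lx (i := k).
    by rewrite gt_eqF.
  by rewrite ck in xk; exfalso; rlra.
pose W := [seq nb B k | k <- enum (~: [set j; l'])].
have sub : {subset L0 B <= W}.
  have inW k : k != j -> k != l' -> nb B k \in W.
    move=> kj kl; apply/mapP; exists k => //.
    by rewrite mem_enum !inE negb_or kj.
  move=> v /mem [k ->]; have [->|kj] := eqVneq k j.
    rewrite -e; apply: inW => //.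
    by move: li'; rewrite (eq_sym i) => /andP [].
  have [->|kl] := eqVneq k l'; last exact: inW.
  rewrite (nx l') // -(nx l) //; apply: inW; first by case/andP: li.
  by move: li'; rewrite (eq_sym l) => /and3P [].
have := uniq_leq_size (filter_uniq _ V_uniq) sub.
have jl' : j != l' by have /and3P [_ jl _] := li'; rewrite eq_sym.
by rewrite L0_size_sym size_map -cardE -(cardsC_pair jl') ltnn.
Qed.

Lemma symmetric_split : (2 < d)%N -> exists C a b c,
  hexagons_over C [:: a; b; c] (Q3_of (row a C) (row b C) (row c C)).
Proof.
move=> d2; have [i0 i0P] := apex.
have def := deficient_nb fB L0_size_sym i0P.
have k1 i : i != i0 -> kap B i = 1 by move=> /def [? _]; apply: kap_lev0.
(* [row i0 B] and its negative become the apexes of the bipyramid: the vertices of level 0 do not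
   involve this index. *)
have crd_i0 v : v \in V -> lev B v = 0 -> crd B v i0 = 0.
  move=> vV lv; apply/eqP; apply: contraT => /(crd_lev0 vV lv) [l0 _].
  by rewrite l0 eqxx in i0P.
have crd_int v i : v \in V -> lev B v = 0 -> crd B v i \is a Num.int.
  move=> vV lv; have [->|vi] := eqVneq (crd B v i) 0; first exact: rpred0.
  by have [_ [[_ ->]|[_ ->]]] := crd_lev0 vV lv vi; rewrite ?rpredN rpred1.
have nbE i : i != i0 -> nb B i = row (phi B i) B - row i B.
  move=> ii0; have [li ge] := def i ii0; have iV := nbV i fB.
  have ci : crd B (nb B i) i = -1 by have := kap_nb fB i; rewrite k1 // mul1r li sub0r.
  by apply: nb_phi => // k; apply: crd_int.
have phi_neq i : i != i0 -> phi B i != i.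
  move=> ii0; apply/eqP => e; have := nb_lt0 i fB.
  by rewrite nbE // e subrr crd0 ltxx.
have phi_i0 i : i != i0 -> phi B i != i0.
  move=> ii0; apply/eqP => e; have [li _] := def i ii0.
  have := crd_i0 _ (nbV i fB) li; rewrite nbE // e crdB !crd_row // eqxx (negbTE ii0).
  by move/eqP; rewrite subr0 oner_eq0.
(* By symmetry [- nb B i] is a vertex of level 0, and its coordinate -1 at [phi B i] makes it the
   neighbour along [phi B i]. *)
have phi_inv i : i != i0 -> phi B (phi B i) = i.
  move=> ii0; have [li _] := def i ii0; have pi := phi_i0 i ii0.
  have e : - nb B i = nb B (phi B i).
    apply: lev0_nb => //; first by apply: V_sym; apply: nbV.
      by rewrite levN li oppr0.
    rewrite nbE // crdN crdB !crd_row // eqxx (eq_sym i) (negbTE (phi_neq i ii0)) /=.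
    by rlra.
  move: e; rewrite !nbE // opprB => /addIr/(row_inj Bu) /esym.
  exact.
have LB : lattice_basis B.
  apply: lattice_basis_int => // [i|x i Nx]; first by apply: VN; apply: frame_row.
  have int j : j != i0 -> crd B x j \is a Num.int.
    by move=> ji; have := kap_crd_int fB j Nx; rewrite k1 // mul1r.
  have [->|] := eqVneq i i0; last exact: int.
  (* At [i0] the integrality of the level takes the place of [kap B i0 = 1]. *)
  have -> : crd B x i0 = lev B x - \sum_(j | j != i0) crd B x j.
    by rewrite /lev (bigD1 i0) //= addrK.
  by rewrite rpredB ?(frame_int fB) // rpred_sum.
have [a ai0] : exists a, a != i0.
  have /card_gt0P [k] : (0 < #|[set~ i0]|)%N by rewrite cardsC1 card_ord; lia.
  by rewrite !inE => ki; exists k.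
have bi0 := phi_i0 a ai0; have ba := phi_neq a ai0; have eb := phi_inv a ai0.
set b := phi B a in bi0 ba eb.
have negV i : - row i B \in V by apply: V_sym; apply: frame_row.
have nbV' i : i != i0 -> row (phi B i) B - row i B \in V.
  by move=> ii0; rewrite -nbE // nbV.
have inL i : i \notin [:: a; b; i0] -> [/\ i != a, i != b & i != i0].
  by rewrite !inE => /norP [? /norP []].
exists B, a, b, i0; apply: (@hexagons_overI _ _ _ (phi B)) => //.
- by rewrite /= !inE negb_or (eq_sym a) ba ai0 bi0.
- move=> i /inL [ia ib ii0]; split; [|exact: phi_neq|exact: phi_inv].
  rewrite !inE !negb_or phi_i0 // andbT; apply/andP; split.
    by apply: contraNneq ib => e; rewrite -(phi_inv i ii0) e -/b.
  by apply: contraNneq ia => e; rewrite -(phi_inv i ii0) e eb.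
- apply/allP; rewrite /= !frame_row // !negV /=.
  by have := nbV' a ai0; have := nbV' b bi0; rewrite eb -/b => -> ->.
- move=> i /inL [ia ib ii0]; apply/allP.
  by rewrite /= frame_row // negV nbV'.
move=> v vV; have [i vE] : exists i, [\/ v = row i B, v = - row i B |
    i != i0 /\ v = row (phi B i) B - row i B].
  case: (ltgtP (lev B v) 0) => l0.
  - by have [i ->] := lev_neg vV l0; exists i; apply: Or32.
  - have [|i ->] := frame_top fB vV; last by exists i; apply: Or31.
    by apply/eqP; rewrite eq_le (frame_le1 fB vV) int_gt0 // frame_intV.
  - have [i vi] := lev0_lt0 fB vV l0; exists i; apply: Or33.
    have ii0 : i != i0 by apply/eqP => e; rewrite e crd_i0 // ltxx in vi.
    by split=> //; rewrite -nbE //; apply: lev0_nb.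
have [il|il] := boolP (i \in [:: a; b; i0]); last first.
  by right; exists i => //; case: vE => [->|->|[_ ->]]; rewrite !inE eqxx ?orbT.
left; move: il; rewrite !inE => /or3P [] /eqP ei; move: vE; rewrite ei;
  case=> [->|->|[ne ->]]; rewrite ?eb ?eqxx ?orbT //.
by rewrite eqxx in ne.
Qed.

End Symmetric.
End ZeroSum.

Lemma hexagons_over_cases :
    (2 < d)%N ->
    (exists B, frame B /\ special B) ->
    ((forall B, frame B -> forall v, v \in V -> -1 <= lev B v) ->
      forall v, v \in V -> - v \in V) ->
  (exists C a b, [\/ hexagons_over C [:: a; b] (V2t_of (row a C) (row b C)),
    hexagons_over C [:: a; b] (E1_of (row a C) (row b C)) |
    hexagons_over C [:: a; b] (E2_of (row a C) (row b C))]) \/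
  (exists C a b c,
    hexagons_over C [:: a; b; c] (Q3_of (row a C) (row b C) (row c C)) \/
    hexagons_over C [:: a; b; c] (Q3'_of (row a C) (row b C) (row c C))).
Proof.
move=> d2 [B [fB sB]] sym; have d0 : (0 < d)%N by lia.
have [nu_eq0|nu_neq0] := eqVneq nu 0; last first.
  case: (nonzero_sum_split d0 nu_neq0 fB sB) => [[C [a [b h]]]|[C [a [b h]]]|[C [a [b [c h]]]]].
  - by left; exists C, a, b; apply: Or31.
  - by left; exists C, a, b; apply: Or32.
  - by right; exists C, a, b, c; right.
have [[B' [fB' fuB']]|nf] := pselect (exists B', frame B' /\ full B').
  have [p [q hB]] := low_frame_ex d0 nu_eq0 fB' fuB'.
  by left; exists B', p, q; apply: Or33; apply: low_split.
right; have [|C [a [b [c h]]]] := symmetric_split d0 nu_eq0 _ fB d2; last first.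
  by exists C, a, b, c; left.
(* Without a facet that has d vertices on level 0, all levels are at least -1. *)
apply: sym => B' fB' v vV; case: (zero_sum_cases d0 nu_eq0 fB') => [[fu _]|[_]]; last exact.
by case: nf; exists B'.
Qed.

End Splitting.

End FacetFrames.

Local Open Scope classical_set_scope.

(** * Convex hulls and exposed points *)

Section Convexity.
Variables (R : realType) (V : lmodType R).
Implicit Types A C : set V.

Definition convex_closed C :=
  forall (x y : V) (t : R), C x -> C y -> 0 <= t -> t <= 1 -> C (t *: x + (1 - t) *: y).

Lemma convex_closed_sum C n (a : 'I_n -> V) (t : 'I_n -> R) : convex_closed C ->
  (forall i, C (a i)) -> (forall i, 0 <= t i) -> \sum_i t i = 1 ->
  C (\sum_i t i *: a i).
Proof.
move=> Cc; elim: n a t => [|n IHn] a t Ca t0 s1.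
  by move: s1; rewrite big_ord0 => /eqP; rewrite eq_sym oner_eq0.
rewrite big_ord_recl; move: s1; rewrite big_ord_recl.
set S := \sum_(i < n) _ => s1.
have S0 : 0 <= S by apply: sumr_ge0.
have [Sz|Sz] := eqVneq S 0.
  have t1 : t ord0 = 1 by lra.
  rewrite big1 ?addr0 ?t1 ?scale1r // => i _.
  by move/psumr_eq0P: Sz => -> //; rewrite scale0r.
have -> : \sum_(i < n) t (lift ord0 i) *: a (lift ord0 i) =
    (1 - t ord0) *: \sum_(i < n) (t (lift ord0 i) / S) *: a (lift ord0 i).
  rewrite scaler_sumr; apply: eq_bigr => i _; rewrite scalerA; congr (_ *: _).
  have -> : 1 - t ord0 = S by rewrite -s1 addrC addKr.
  by field.
apply: Cc => //; last by lra.
apply: IHn => // [i|]; first by rewrite divr_ge0.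
by rewrite -mulr_suml divff.
Qed.

Lemma conv_convex A : convex_closed (conv A).
Proof.
move=> x y t [n [a [f [Aa f0 f1 ->]]]] [m [b [g [Ab g0 g1 ->]]]] t0 t1.
exists (n + m)%N, (fun k => match fintype.split k with inl i => a i | inr j => b j end),
  (fun k => match fintype.split k with inl i => t * f i | inr j => (1 - t) * g j end).
split.
- by move=> k; case: (fintype.split k).
- by move=> k; case: (fintype.split k) => i; apply: mulr_ge0; rewrite ?subr_ge0.
- rewrite big_split_ord /=.
  under eq_bigr => i _ do rewrite (unsplitK (inl i)).
  under [X in _ + X]eq_bigr => i _ do rewrite (unsplitK (inr i)).
  by rewrite -!mulr_sumr f1 g1; ring.
- rewrite big_split_ord /= !scaler_sumr; congr (_ + _); apply: eq_bigr => i _.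
    by rewrite (unsplitK (inl i)) scalerA.
  by rewrite (unsplitK (inr i)) scalerA.
Qed.

Lemma conv_sub A : A `<=` conv A.
Proof.
move=> x Ax; exists 1%N, (fun=> x), (fun=> 1).
by split; rewrite ?big_ord1 ?scale1r.
Qed.

Lemma conv_min A C : convex_closed C -> A `<=` C -> conv A `<=` C.
Proof.
move=> Cc AC x [n [a [t [Aa t0 t1 ->]]]]; apply: convex_closed_sum => // i.
exact/AC/Aa.
Qed.

Lemma conv_subset A A' : A `<=` A' -> conv A `<=` conv A'.
Proof.
by move=> AA'; apply: conv_min; [apply: conv_convex|move=> x /AA'; apply: conv_sub].
Qed.

Lemma convex_closed_cone C n (a : 'I_n -> V) (t : 'I_n -> R) : convex_closed C ->
  C 0 -> (forall i, C (a i)) -> (forall i, 0 <= t i) -> \sum_i t i <= 1 ->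
  C (\sum_i t i *: a i).
Proof.
move=> Cc C0 Ca t0 s1.
(* The missing weight is given to the additional point 0. *)
pose a' k := if unlift (ord0 : 'I_n.+1) k is Some i then a i else 0.
pose t' k := if unlift (ord0 : 'I_n.+1) k is Some i then t i else 1 - \sum_i t i.
have -> : \sum_i t i *: a i = \sum_k t' k *: a' k.
  rewrite big_ord_recl /a' unlift_none scaler0 add0r.
  by apply: eq_bigr => i _; rewrite /t' liftK.
apply: convex_closed_sum => //.
- by move=> k; rewrite /a'; case: unliftP.
- by move=> k; rewrite /t'; case: unliftP => // _; rewrite subr_ge0.
- rewrite big_ord_recl {1}/t' unlift_none -[RHS](subrK (\sum_i t i)).
  by congr (_ + _); apply: eq_bigr => i _; rewrite /t' liftK.
Qed.

End Convexity.

Section ConvexImages.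
Variable R : realType.

Lemma conv_image (V W : lmodType R) (g : V -> W) (A : set V) :
  (forall a x y, g (a *: x + y) = a *: g x + g y) -> g @` conv A = conv (g @` A).
Proof.
move=> gl; have g0 : g 0 = 0.
  by have := gl (-1) 0 0; rewrite scaler0 addr0 scaleN1r addNr.
apply/seteqP; split=> x.
  move=> [_ [m [a [t [Aa t0 t1 ->]]]] <-].
  exists m, (g \o a), t; split=> // [i|]; first by exists (a i).
  apply: (big_rec2 (fun p q => g p = q)) => // i p q _ <-; exact: gl.
apply: conv_min => [_ _ t [p Ap <-] [q Aq <-] t0 t1|y [p Ap <-]]; last first.
  by exists p => //; apply: conv_sub.
exists (t *: p + (1 - t) *: q); first exact: conv_convex.
by rewrite gl -[_ *: q]addr0 gl g0 addr0.
Qed.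

Lemma conv_convU (V : lmodType R) (A B : set V) : conv (conv A `|` B) = conv (A `|` B).
Proof.
apply/seteqP; split; last first.
  by apply: conv_subset => x [Ax|Bx]; [left; apply: conv_sub|right].
apply: conv_min => [|x [|Bx]]; first exact: conv_convex.
  by apply: conv_subset => y; left.
by apply: conv_sub; right.
Qed.

End ConvexImages.

Section Forms.
Variables (R : realType) (V : vectType R).

Lemma conv_le (A : set V) (u : 'Hom(V, R^o)) (c : R) y :
  (forall w, A w -> u w <= c) -> conv A y -> u y <= c.
Proof.
move=> h; apply: (conv_min (C := [set y | (u y : R) <= c])) => // x z t /= xc zc t0 t1.
rewrite linearD !linearZ /= /GRing.scale /=; nra.
Qed.

(** The differences [c - u (a i)] are nonnegative, and their weighted sum is 0. *)
Lemma conv_max (A : set V) (u : 'Hom(V, R^o)) (c : R) n (a : 'I_n -> V) (t : 'I_n -> R) :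
  (forall w, A w -> u w <= c) -> (forall i, A (a i)) -> (forall i, 0 <= t i) ->
  \sum_i t i = 1 -> u (\sum_i t i *: a i) = c ->
  forall i, t i != 0 -> u (a i) = c.
Proof.
move=> h Aa t0 t1 e i ti.
have s0 : \sum_i t i * (c - u (a i)) = 0.
  under eq_bigr => j _ do rewrite mulrBr.
  rewrite sumrB -mulr_suml t1 mul1r -{1}e linear_sum /=.
  by apply/eqP; rewrite subr_eq0; apply/eqP/eq_bigr => j _; rewrite linearZ.
have nn j : true -> 0 <= t j * (c - u (a j)).
  by move=> _; apply: mulr_ge0; rewrite // subr_ge0 h.
move/psumr_eq0P: s0 => /(_ nn i isT)/eqP.
by rewrite mulf_eq0 (negbTE ti) /= subr_eq0 => /eqP.
Qed.

Lemma form_of (g : V -> R) : (forall a x y, g (a *: x + y) = a * g x + g y) ->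
  exists u : 'Hom(V, R^o), forall v, u v = g v.
Proof.
move=> gl; pose G : V -> R^o := g.
have gL : linear G by move=> a x y; rewrite /G gl.
pose L : {linear V -> R^o} := HB.pack_for {linear V -> R^o} G
  (GRing.isLinear.Build R V R^o _ G gL).
by exists (linfun L) => v; rewrite lfunE.
Qed.

Lemma sum_pos_index n (t : 'I_n -> R) : \sum_i t i = 1 -> exists i, t i != 0.
Proof.
move=> t1; apply/existsP; apply: contraT; rewrite negb_exists => /forallP h.
move: t1; rewrite big1 => [/eqP|i _]; first by rewrite eq_sym oner_eq0.
by have := h i; rewrite negbK => /eqP.
Qed.

Lemma vertex_conv (A : set V) v : vertices (conv A) v -> A v.
Proof.
move=> [u [c [uc e]]]; have [Cv vc] : [set y | conv A y /\ u y = c] v by rewrite -e.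
move: (Cv) => [n [a [t [Aa t0 t1 vE]]]]; have [i ti] := sum_pos_index t1.
have uA w : A w -> u w <= c by move=> Aw; apply/uc/conv_sub.
have uai := conv_max uA Aa t0 t1 (etrans (congr1 u (esym vE)) vc) ti.
have : [set v] (a i) by rewrite e; split; [apply: conv_sub|].
by move=> /= <-.
Qed.

Lemma vertex_mem (P : set V) v : vertices P v -> P v.
Proof. by move=> [u [c [_ e]]]; have [] : [set y | P y /\ u y = c] v by rewrite -e. Qed.

Lemma vertex_extreme (P : set V) v n (a : 'I_n -> V) (t : 'I_n -> R) :
  vertices P v -> (forall i, P (a i)) -> (forall i, 0 <= t i) -> \sum_i t i = 1 ->
  v = \sum_i t i *: a i -> exists i, v = a i.
Proof.
move=> [u [c [uc e]]] Pa t0 t1 vE; have [i ti] := sum_pos_index t1.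
have [_ uv] : [set y | P y /\ u y = c] v by rewrite -e.
have uai := conv_max uc Pa t0 t1 (etrans (congr1 u (esym vE)) uv) ti.
exists i; have : [set v] (a i) by rewrite e; split.
by move=> /= ->.
Qed.

End Forms.

(* The ratio test of the simplex algorithm. *)
Lemma push_form (R : realType) (T : eqType) (s : seq T) (g h : T -> R) :
  (forall w, w \in s -> g w <= 1) -> (exists2 w, w \in s & 0 < h w) ->
  exists w, [/\ w \in s, 0 < h w &
    forall v, v \in s -> g v + (1 - g w) / h w * h v <= 1].
Proof.
elim: s => [|x s IHs] gle [w ws hw]; first by [].
have [[w' w's hw']|nw] := pselect (exists2 w, w \in s & 0 < h w); last first.
  have xw : w = x.
    by move: ws; rewrite inE => /orP [/eqP //|ws]; case: nw; exists w.
  exists w; split=> // v; rewrite inE => /orP [/eqP ->|vs].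
    by rewrite xw divfK ?subrKC // gt_eqF // -xw.
  have hv : h v <= 0 by rewrite leNgt; apply/negP => hv; apply: nw; exists v.
  have gv : g v <= 1 by apply: gle; rewrite inE vs orbT.
  have : 0 <= (1 - g w) / h w by rewrite divr_ge0 ?(ltW hw) // subr_ge0 gle.
  by move: ((1 - g w) / h w) => k k0; nra.
have [v vs||y [ys hy ymin]] := IHs; first by apply: gle; rewrite inE vs orbT.
  by exists w'.
have [xle|xgt] := leP (g x + (1 - g y) / h y * h x) 1.
  exists y; split=> // [|v]; first by rewrite inE ys orbT.
  by rewrite inE => /orP [/eqP ->|/ymin].
have gx : g x <= 1 by apply: gle; rewrite inE eqxx.
have gy : g y <= 1 by apply: gle; rewrite inE ys orbT.
have k0 : 0 <= (1 - g y) / h y by rewrite divr_ge0 ?(ltW hy) // subr_ge0.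
have hx : 0 < h x by rewrite ltNge; apply/negP => hx; nra.
exists x; split=> //; first by rewrite inE eqxx.
move=> v; rewrite inE => /orP [/eqP ->|vs]; first by rewrite divfK ?subrKC ?gt_eqF.
have kk : (1 - g x) / h x <= (1 - g y) / h y.
  by rewrite ler_pdivrMr //; lra.
have k0' : 0 <= (1 - g x) / h x by rewrite divr_ge0 ?(ltW hx) // subr_ge0.
have gv : g v <= 1 by apply: gle; rewrite inE vs orbT.
have vle := ymin v vs.
have [hv|hv] := leP 0 (h v); nra.
Qed.

(** * Linear and affine independence *)

Section FreeFamilies.
Variables (R : realType) (d : nat).
Implicit Types (s : seq 'rV[R]_d).

Lemma affinely_free_of_free s : free s -> affinely_free s.
Proof.
case: s => [//|x s]; rewrite /affinely_free => fs.
set D := [seq y - x | y <- s].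
have sub : (<<x :: s>> <= <<x :: D>>)%VS.
  apply/span_subvP => y; rewrite inE => /orP [/eqP ->|ys].
    by apply: memv_span; rewrite inE eqxx.
  rewrite -(subrK x y); apply: memvD; apply: memv_span; rewrite inE ?eqxx //.
  by apply/orP; right; apply/mapP; exists y.
have : free (x :: D).
  rewrite /free; apply/eqP/anti_leq; rewrite dim_span /= size_map.
  by move: fs; rewrite /free => /eqP /= <-; apply: dimvS.
by rewrite free_cons => /andP [].
Qed.

(** The differences lie in the kernel of [u], whereas the base point does not. *)
Lemma free_of_affinely_free s (u : 'Hom('rV[R]_d, R^o)) :
  affinely_free s -> (forall y, y \in s -> u y = 1) -> free s.
Proof.
case: s => [_ _|x s]; first exact: nil_free.
rewrite /affinely_free => fD u1; set D := [seq y - x | y <- s] in fD.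
have xD : x \notin <<D>>%VS.
  apply/negP => xD; have sub : (<<D>> <= lker u)%VS.
    apply/span_subvP => _ /mapP [y ys ->]; rewrite memv_ker linearB /=.
    by rewrite !u1 ?inE ?eqxx ?ys ?orbT // subrr.
  have := subvP sub _ xD; rewrite memv_ker u1 ?inE ?eqxx //.
  by rewrite oner_eq0.
have : free (x :: D) by rewrite free_cons xD.
rewrite /free => /eqP /= dD; apply/eqP/anti_leq; rewrite dim_span /=.
have <- : size D = size s by rewrite size_map.
rewrite -dD; apply: dimvS; apply/span_subvP => y; rewrite inE => /orP [/eqP ->|].
  by apply: memv_span; rewrite inE eqxx.
by move=> /mapP [z zs ->]; rewrite memvB // memv_span // inE ?eqxx ?zs ?orbT.
Qed.

Lemma free_size s : free s -> (size s <= d)%N.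
Proof.
by move=> /eqP <-; apply: leq_trans (dimvS (subvf _)) _; rewrite dimvf /dim /= mul1n.
Qed.

Lemma free_rows (B : 'M[R]_d) : B \in unitmx -> free [seq row i B | i <- enum 'I_d].
Proof.
move=> Bu; have sz : size [seq row i B | i <- enum 'I_d] = d.
  by rewrite size_map size_enum_ord.
rewrite /free; apply/eqP/anti_leq; rewrite dim_span sz /=.
have dimV : \dim {: 'rV[R]_d} = d by rewrite dimvf /dim /= mul1n.
rewrite -[X in (X <= _)%N]dimV.
apply: dimvS; apply/subvP => v _; rewrite (crdE v Bu).
apply: memv_suml => i _; apply: memvZ; apply: memv_span.
by apply: map_f; rewrite mem_enum.
Qed.

Lemma unitmx_rows s (B : 'M[R]_d) : free s -> size s = d ->
  (forall i : 'I_d, row i B = nth 0 s i) -> B \in unitmx.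
Proof.
move=> fs sz rB; rewrite -row_free_unit -kermx_eq0; apply/eqP/row_matrixP => k.
rewrite row0; set c := row k (kermx B).
have : c *m B = 0 by rewrite /c -row_mul mulmx_ker row0.
rewrite mulmx_sum_row => c0; apply/rowP => i; rewrite [RHS]mxE.
have ssz : size s == d by rewrite sz.
have /freeP fT : free (Tuple ssz) by [].
apply: (fT (fun j => c 0 j)).
by rewrite -[RHS]c0; apply: eq_bigr => j _; rewrite rB.
Qed.

End FreeFamilies.

Section LevelForm.
Variables (R : realType) (d : nat).

Lemma lev_form (B : 'M[R]_d) : exists u : 'Hom('rV[R]_d, R^o), forall v, u v = lev B v.
Proof. by apply: form_of => a x y; rewrite levD levZ. Qed.

Lemma crd_form (B : 'M[R]_d) i :
  exists u : 'Hom('rV[R]_d, R^o), forall v, u v = crd B v i.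
Proof. by apply: form_of => a x y; rewrite crdD crdZ. Qed.

Lemma form_lev (u : 'Hom('rV[R]_d, R^o)) (B : 'M[R]_d) : B \in unitmx ->
  (forall i, u (row i B) = 1) -> forall v, u v = lev B v.
Proof.
move=> Bu u1 v; rewrite {1}(crdE v Bu) linear_sum; apply: eq_bigr => i _.
by rewrite linearZ /= u1 /GRing.scale /= mulr1.
Qed.

Lemma lev_eq (B C : 'M[R]_d) : C \in unitmx -> (forall i, lev B (row i C) = 1) ->
  forall v, lev B v = lev C v.
Proof.
move=> Cu h v; have [u uE] := lev_form B.
by rewrite -uE (form_lev Cu) // => i; rewrite uE.
Qed.

Lemma conv_lev_le (B : 'M[R]_d) (A : set 'rV[R]_d) c y :
  (forall w, A w -> lev B w <= c) -> conv A y -> lev B y <= c.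
Proof.
have [u uE] := lev_form B => h Ay; rewrite -uE.
by apply: conv_le Ay => w Aw; rewrite uE; apply: h.
Qed.

End LevelForm.

(** * Facets of a simplicial polytope *)

Section Polytope.
Variables (R : realType) (d : nat) (N P : set 'rV[R]_d) (s : seq 'rV[R]_d).
Hypotheses (d_gt0 : (0 < d)%N) (PE : P = conv [set` s]).
Hypotheses (P_dim : has_dim P d) (P_simp : simplicial P) (P0 : interior P 0).

Let sP w : w \in s -> P w.
Proof. by move=> ws; rewrite PE; apply: conv_sub. Qed.

Lemma polytope_dir y : exists2 t : R, 0 < t & P (t *: y).
Proof.
have cont : (fun t : R => t *: y) @ (0 : R) --> (0 : R) *: y.
  by apply: cvgZl; exact: cvg_id.
rewrite scale0r in cont.
have /nbhs_ballP [e /= e0 he] := cont P P0.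
exists (e / 2); first by rewrite divr_gt0.
apply: he; rewrite /ball /= sub0r normrN gtr0_norm ?divr_gt0 //.
by rewrite ltr_pdivrMr // ltr_pMr // ltr1n.
Qed.

Lemma polytope_pos (u : 'Hom('rV[R]_d, R^o)) y : 0 < u y -> exists2 w, w \in s & 0 < u w.
Proof.
move=> uy; apply/hasP; apply: contraT => /hasPn h.
have [t t0 Pty] := polytope_dir y.
have : u (t *: y) <= 0.
  move: Pty; rewrite PE; apply: conv_le => w /= ws; by rewrite leNgt h.
by rewrite linearZ /= /GRing.scale /=; nra.
Qed.

Lemma polytope_crd_pos (B : 'M[R]_d) i : B \in unitmx ->
  exists2 w, w \in s & 0 < crd B w i.
Proof.
move=> Bu; have [u uE] := crd_form B i.
have [|w ws uw] := @polytope_pos u (row i B).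
  by rewrite uE crd_row // eqxx ltr01.
by exists w; rewrite // -uE.
Qed.

Lemma polytope_crd_neg (B : 'M[R]_d) i : B \in unitmx ->
  exists2 w, w \in s & crd B w i < 0.
Proof.
move=> Bu; have [u uE] := crd_form B i.
have [|w ws uw] := @polytope_pos (- u) (- row i B).
  by rewrite opp_lfunE linearN /= opprK uE crd_row // eqxx ltr01.
by exists w; rewrite // -uE; move: uw; rewrite opp_lfunE oppr_gt0.
Qed.

Definition supporting (B : 'M[R]_d) :=
  [/\ B \in unitmx, forall i, row i B \in s & forall w, w \in s -> lev B w <= 1].

Lemma supporting_ex : exists B, supporting B.
Proof.
(* The simplex algorithm, started from the unit basis: the form that adds up the first k coordinates
   is 0 for k = 0, and each ratio test brings one more point of s to level 1. *)
pose Q k (C : 'M[R]_d) := [/\ C \in unitmx, forall i : 'I_d, (i < k)%N -> row i C \in s &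
  forall w, w \in s -> \sum_(i < d | (i < k)%N) crd C w i <= 1].
suff step k : (k <= d)%N -> exists C, Q k C.
  have [C [Cu Cr Cl]] := step d (leqnn d); exists C; split=> // [i|w ws]; first exact: Cr.
  by have := Cl w ws; rewrite (eq_bigl xpredT) // => i; rewrite ltn_ord.
elim: k => [_|k IHk kd].
  exists 1%:M; split; rewrite ?unitmx1 // => w _.
  by rewrite big_pred0 ?ler01 // => i; rewrite ltn0.
have [C [Cu Cr Cl]] := IHk (ltnW kd); pose i0 := Ordinal kd.
have [w [ws wk wl]] := push_form Cl (polytope_crd_pos i0 Cu).
have w0 : crd C w i0 != 0 by rewrite gt_eqF.
exists (repl C i0 w); split; first exact: repl_unit.
  move=> i; rewrite row_repl ltnS leq_eqVlt => /orP [/eqP ik|ik].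
    by have -> : i == i0 by apply/eqP/val_inj.
  by case: eqP => // _; apply: Cr.
move=> v vs; apply: le_trans (wl v vs); rewrite le_eqVlt; apply/orP; left; apply/eqP.
rewrite (bigD1 i0) /=; last by rewrite ltnSn.
have E : (fun i : 'I_d => (i < k.+1)%N && (i != i0)) =1 (fun i : 'I_d => (i < k)%N).
  by move=> i; rewrite -val_eqE /= ltnS; lia.
rewrite (eq_bigl _ _ E) crd_repl // eqxx.
under eq_bigr => i ik.
  have ii0 : (i == i0) = false by rewrite -val_eqE /= ltn_eqF.
  rewrite crd_repl // ii0; over.
rewrite sumrB /= -!mulr_suml; move: (\sum_(i < d | _) crd C w i) (\sum_(i < d | _) crd C v i).
by move=> a b; field.
Qed.

(* For small [e > 0], the form [(1 - e) * lev B + e * crd T _ i] exposes the row. *)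
Lemma exposed_row (B T : 'M[R]_d) i : T \in unitmx ->
  (forall w, w \in s -> lev B w <= 1) -> (forall k, lev B (row k T) = 1) ->
  (forall k, P (row k T)) ->
  (forall w, w \in s -> lev B w = 1 -> forall k, 0 <= crd T w k) ->
  vertices P (row i T).
Proof.
move=> Tu lB rT PT cT; have levE := lev_eq Tu rT.
have [e e0 eP] : exists2 e : R, 0 < e & forall w, w \in s -> lev B w < 1 ->
    forall e', 0 < e' -> e' <= e -> lev B w + e' * (crd T w i - lev B w) < 1.
  elim: (s) => [|x s' [e e0 IH]]; first by exists 1.
  have [lx|lx] := ltP (lev B x) 1; last first.
    exists e => // w; rewrite inE => /orP [/eqP ->|]; last exact: IH.
    by rewrite ltNge lx.
  (* The summand 1 keeps the denominator positive and makes the inequality for [e'] strict. *)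
  pose m := (1 - lev B x) / (1 + `|crd T x i - lev B x|).
  have D0 : 0 < 1 + `|crd T x i - lev B x| by rewrite ltr_pwDl.
  have m0 : 0 < m by rewrite divr_gt0 ?subr_gt0.
  exists (Num.min e m); first by rewrite lt_min e0.
  move=> w; rewrite inE => /orP [/eqP -> _|ws lw] e'; rewrite ?le_min => e'0 /andP [le1 le2].
    have : e' * (1 + `|crd T x i - lev B x|) <= 1 - lev B x by rewrite -ler_pdivlMr.
    by have := ler_norm (crd T x i - lev B x); nra.
  exact: IH.
have [u uE] : exists u : 'Hom('rV[R]_d, R^o), forall v,
    u v = lev B v + e * (crd T v i - lev B v).
  by apply: form_of => a x y; rewrite !levD !levZ crdD crdZ; ring.
have uP w : w \in s -> u w <= 1 /\ (u w = 1 -> w = row i T).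
  move=> ws; rewrite uE; have := lB w ws; rewrite le_eqVlt => /orP [/eqP lw|lw].
    have c0 := cT w ws lw.
    have s1 : lev T w = 1 by rewrite -levE.
    rewrite /lev (bigD1 i) //= in s1.
    have r0 : 0 <= \sum_(k | k != i) crd T w k by apply: sumr_ge0.
    rewrite lw; split; first by nra.
    move=> e1; have ci : crd T w i = 1 by nra.
    have /psumr_eq0P z : \sum_(k | k != i) crd T w k = 0 by lra.
    apply: (crdP Tu) => k; rewrite crd_row //.
    by have [<-|ik] := eqVneq i k; rewrite ?ci // z // eq_sym.
  have := eP w ws lw e e0 (lexx e) => lt1; split; first exact: ltW.
  by move=> e1; rewrite e1 ltxx in lt1.
exists u, 1; split.
  by move=> y; rewrite PE; apply: conv_le => w /= /uP [].
have uT : u (row i T) = 1 by rewrite uE rT crd_row // eqxx /=; ring.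
apply/seteqP; split=> [y /= ->|y /= [Py uy]]; first by split.
move: Py; rewrite PE => -[n [a [t [sa t0 t1 yE]]]].
have uw w : [set` s] w -> u w <= 1 by move=> /uP [].
have ua := conv_max uw sa t0 t1 (etrans (congr1 u (esym yE)) uy).
rewrite yE (eq_bigr (fun k => t k *: row i T)) => [|k _].
  by rewrite -scaler_suml t1 scale1r.
have [->|tk] := eqVneq (t k) 0; first by rewrite !scale0r.
by congr (_ *: _); apply: (uP _ (sa k)).2; apply: ua.
Qed.

(* The facet of a supporting basis is a simplex with [d] vertices, all of them
   exposed points of [P]. *)
Lemma supporting_facet B : supporting B -> exists T : 'M[R]_d,
  [/\ T \in unitmx, forall i, vertices P (row i T),
      forall i, lev B (row i T) = 1,
      forall y, P y -> lev B y = 1 -> forall i, 0 <= crd T y i &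
      forall v, vertices P v -> lev B v = 1 -> exists i, v = row i T].
Proof.
move=> [Bu Bs Bl]; have [u uE] := lev_form B.
pose F := [set y | P y /\ u y = 1].
have uP y : P y -> u y <= 1 by rewrite PE; apply: conv_le => w /= /Bl; rewrite uE.
have BF i : F (row i B) by split; [apply/sP/Bs|rewrite uE lev_row].
have Ffac : facet P F.
  split; first by exists u, 1.
  exists d.-1; rewrite prednK //; split=> //; rewrite -[d.-1]/(d.-1)%N; split.
    exists [seq row i B | i <- enum 'I_d]; split.
    - by move=> _ /= /mapP [i _ ->].
    - exact/affinely_free_of_free/free_rows.
    - by rewrite size_map size_enum_ord prednK.
  move=> r rF fr; rewrite prednK //; apply/free_size/(free_of_affinely_free fr (u := u)).
  by move=> y yr; have [] := rF y yr.
have [t [ft FE]] := P_simp Ffac.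
have tF y : y \in t -> F y by move=> yt; rewrite FE; apply: conv_sub.
have ft' : free t by apply: (free_of_affinely_free ft (u := u)) => y /tF [].
have st : size t = d.
  apply/anti_leq; rewrite free_size //=; move: ft'; rewrite /free => /eqP <-.
  have dimV : \dim {: 'rV[R]_d} = d by rewrite dimvf /dim /= mul1n.
  rewrite -[X in (X <= _)%N]dimV.
  apply: dimvS; apply/subvP => v _; rewrite (crdE v Bu).
  apply: memv_suml => i _; apply: memvZ.
  have : F (row i B) by []; rewrite FE => -[n [a [f [ta _ _ ->]]]].
  by apply: memv_suml => k _; apply: memvZ; apply: memv_span; apply: ta.
pose T : 'M[R]_d := \matrix_(i, j) (nth 0 t i) 0 j.
have rT i : row i T = nth 0 t i by apply/rowP => j; rewrite !mxE.
have Tt i : row i T \in t by rewrite rT mem_nth // st.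
have Tu : T \in unitmx := unitmx_rows ft' st rT.
have tT y : y \in t -> exists i, y = row i T.
  move=> yt; have yi : (index y t < d)%N by rewrite -[X in (_ < X)%N]st index_mem.
  by exists (Ordinal yi); rewrite rT nth_index.
have cT y : P y -> lev B y = 1 -> forall i, 0 <= crd T y i.
  move=> Py ly i; have : F y by split; rewrite ?uE.
  rewrite FE => -[n [a [f [ta f0 _ ->]]]]; rewrite crd_sum.
  apply: sumr_ge0 => k _; rewrite crdZ; apply: mulr_ge0 => //.
  by have [j ->] := tT _ (ta k); rewrite crd_row.
have lT i : lev B (row i T) = 1 by have [_] := tF _ (Tt i); rewrite uE.
exists T; split=> //.
- move=> i; apply: (exposed_row (B := B)) => //.
    by move=> k; have [] := tF _ (Tt k).
  by move=> w ws; apply/cT/sP.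
move=> v vv lv; have vF : F v by split; [exact: vertex_mem|rewrite uE].
have := vF; rewrite FE => -[n [a [f [ta f0 f1 vE]]]].
have aP k : P (a k) by have [] := tF _ (ta k).
by have [k ->] := vertex_extreme vv aP f0 f1 vE; apply: tT; apply: ta.
Qed.

Definition vertex_frame (B : 'M[R]_d) :=
  [/\ B \in unitmx, forall i, vertices P (row i B) & forall y, P y -> lev B y <= 1].

Lemma vertex_in_gen v : vertices P v -> v \in s.
Proof. by move=> vv; move: vv; rewrite PE => /vertex_conv. Qed.

Lemma vertex_frame_supporting B : vertex_frame B -> supporting B.
Proof.
move=> [Bu Bv Bl]; split=> // [i|w ws]; first exact: vertex_in_gen.
exact/Bl/sP.
Qed.

Lemma vertex_frame_ex : exists B, vertex_frame B.
Proof.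
have [B sB] := supporting_ex; have [T [Tu Tv lT _ _]] := supporting_facet sB.
have [_ _ Bl] := sB; exists T; split=> // y.
rewrite -(lev_eq Tu lT) PE; apply: conv_lev_le => w /=; exact: Bl.
Qed.

Lemma vertex_frame_top B v : vertex_frame B -> vertices P v -> lev B v = 1 ->
  exists i, v = row i B.
Proof.
move=> vB vv lv; have [Bu Bv _] := vB.
have [T [_ _ _ _ top]] := supporting_facet (vertex_frame_supporting vB).
have [f fE] : {f : 'I_d -> 'I_d & forall i, row i B = row (f i) T}.
  by apply: (choice (P := fun i k => row i B = row k T)) => i; apply: top; rewrite ?lev_row.
have finj : injective f by move=> i j e; apply: (row_inj Bu); rewrite !fE e.
have [k ->] := top v vv lv.
have /codomP [i ->] : k \in codom f by apply: (inj_card_onto finj).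
by exists i; rewrite fE.
Qed.

(** The point [w0] of the ratio test need not be a vertex. It is a nonnegative combination of the
    vertices of its facet, so one of them also has a negative i-th coordinate; it defines the same
    form and replaces [w0]. *)
Lemma vertex_frame_nb B i : vertex_frame B ->
  exists w, [/\ vertices P w, crd B w i < 0 & vertex_frame (repl B i w)].
Proof.
move=> vB; have [Bu Bv _] := vB; have [_ Bs Bl] := vertex_frame_supporting vB.
have [|w0 [w0s w0i w0le]] := push_form (h := fun w => - crd B w i) Bl.
  by have [w ws wi] := polytope_crd_neg i Bu; exists w; rewrite // oppr_gt0.
rewrite oppr_gt0 in w0i; have w0i0 : crd B w0 i != 0 by rewrite lt_eqF.
have levE v : lev (repl B i w0) v = lev B v + (1 - lev B w0) / - crd B w0 i * - crd B v i.
  by rewrite lev_repl //; field.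
have sB1 : supporting (repl B i w0).
  split; first exact: repl_unit.
    by move=> j; rewrite row_repl; case: eqP.
  by move=> v vs; rewrite levE w0le.
have [T [Tu Tv lT cT top]] := supporting_facet sB1.
have lw0 : lev (repl B i w0) w0 = 1 by rewrite levE; field.
have c0 := cT w0 (sP w0s) lw0.
have [k ck] : exists k, crd B (row k T) i < 0.
  apply/existsP; apply: contraT; rewrite negb_exists => /forallP h.
  have : 0 <= crd B w0 i; last by rewrite leNgt w0i.
  rewrite [w0 in crd B w0](crdE w0 Tu) crd_sum; apply: sumr_ge0 => j _.
  by rewrite crdZ mulr_ge0 // leNgt h.
have B2u : repl B i (row k T) \in unitmx by rewrite repl_unit // lt_eqF.
exists (row k T); split=> //; split=> // [j|y].
  by rewrite row_repl; case: eqP.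
have [B1u _ B1l] := sB1.
rewrite -(lev_eq (B := repl B i w0) B2u) => [|j].
  rewrite PE; apply: conv_lev_le => w /=; exact: B1l.
rewrite row_repl; case: (altP (j =P i)) => [_|ji]; first exact: lT.
by rewrite -(lev_row j B1u) row_repl (negbTE ji).
Qed.

(** * Cones over facets and the description of the polytope by facets *)

Variable V : seq 'rV[R]_d.
Hypothesis VP : forall v, v \in V <-> vertices P v.

Lemma vertex_frame_cone y : exists B, vertex_frame B /\ forall i, 0 <= crd B y i.
Proof.
(* Frames are coded by the positions of their rows in V; this makes them finite in number, so that a
   maximum exists. *)
pose mx (f : {ffun 'I_d -> 'I_(size V)}) : 'M[R]_d :=
  \matrix_(i, j) (nth 0 V (f i)) 0 j.
have mxP B : vertex_frame B -> exists f, B = mx f.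
  move=> [_ Bv _]; have vi i : (index (row i B) V < size V)%N.
    by rewrite index_mem; apply/VP.
  exists [ffun i => Ordinal (vi i)]; apply/row_matrixP => i; apply/rowP => j.
  rewrite [in RHS]mxE [in RHS]mxE ffunE /= nth_index //; exact/VP.
have [B0 vB0] := vertex_frame_ex; have [f0 f0E] := mxP B0 vB0.
have vf0 : `[< vertex_frame (mx f0) >] by apply/asboolP; rewrite -f0E.
pose Q f := `[< vertex_frame (mx f) >].
case: (@arg_maxP _ _ _ f0 Q (fun f => lev (mx f) y) vf0) => f /asboolP vf fmax.
exists (mx f); split=> // i; rewrite leNgt; apply/negP => yi.
(* A pivot at a negative coordinate of y would increase the level of y. *)
have [Bu Bv Bl] := vf; have [w [wv wi vB]] := vertex_frame_nb i vf.
have [g gE] := mxP _ vB; have vg : `[< vertex_frame (mx g) >] by rewrite -gE; apply/asboolP.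
have := fmax g vg; rewrite /= -gE lev_repl ?lt_eqF //.
have lw : lev (mx f) w < 1.
  rewrite lt_neqAle Bl ?andbT; last exact: vertex_mem.
  apply/eqP => /(vertex_frame_top vf wv) [j wE]; move: wi.
  by rewrite wE crd_row // ltNge ler0n.
rewrite gerDl leNgt => /negP; apply.
by rewrite nmulr_lgt0 // nmulr_llt0 ?invr_lt0 // subr_gt0.
Qed.

Lemma zero_in_conv : conv [set` V] 0.
Proof.
have [B [Bu Bv Bl]] := vertex_frame_ex.
(* The sum of the rows of B and a nonnegative combination of the rows of C cancel; [D] is the total
   weight by which this relation is normalised. *)
have [C [[Cu Cv Cl] Cc]] := vertex_frame_cone (- \sum_i row i B).
set y := - \sum_i row i B in Cc; pose D := d%:R + lev C y.
have ly : 0 <= lev C y by apply: sumr_ge0.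
have D0 : 0 < D by rewrite ltr_pwDl ?ltr0n.
exists (d + d)%N,
  (fun k => match fintype.split k with inl i => row i B | inr j => row j C end),
  (fun k => match fintype.split k with inl _ => D^-1 | inr j => crd C y j / D end).
split.
- by move=> k; case: (fintype.split k) => i; apply/VP.
- by move=> k; case: (fintype.split k) => i; rewrite ?divr_ge0 // ?invr_ge0 ltW.
- rewrite big_split_ord /=.
  under eq_bigr => i _ do rewrite (unsplitK (inl i)).
  under [X in _ + X]eq_bigr => i _ do rewrite (unsplitK (inr i)).
  rewrite -mulr_suml -/(lev C y) sumr_const card_ord -mulr_natl -mulrDl.
  by rewrite divff // gt_eqF.
- rewrite big_split_ord /=.
  under eq_bigr => i _ do rewrite (unsplitK (inl i)).
  under [X in _ + X]eq_bigr => i _ do rewrite (unsplitK (inr i)) mulrC -scalerA.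
  by rewrite -!scaler_sumr -(crdE y Cu) -scalerDr subrr scaler0.
Qed.

Lemma polytopeE y : (forall B, vertex_frame B -> lev B y <= 1) -> conv [set` V] y.
Proof.
move=> h; have [B [vB c0]] := vertex_frame_cone y; have [Bu Bv _] := vB.
rewrite (crdE y Bu); apply: convex_closed_cone => //.
- exact: conv_convex.
- exact: zero_in_conv.
- by move=> i; apply: conv_sub; apply/VP.
- exact: h.
Qed.

Lemma polytope_conv_vertices : P = conv [set` V].
Proof.
apply/seteqP; split=> y; first by move=> Py; apply: polytopeE => B [_ _]; apply.
apply: conv_min => [|v /VP]; [by rewrite PE; apply: conv_convex|exact: vertex_mem].
Qed.

Lemma zero_not_vertex : 0 \notin V.
Proof.
apply/negP => /VP [u [c [uc e]]].
have [_ u0] : [set y | P y /\ u y = c] 0 by rewrite -e.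
rewrite linear0 in u0.
pose e1 : 'rV[R]_d := delta_mx 0 (Ordinal d_gt0).
have [t t0 Pt] := polytope_dir e1; have [t' t'0 Pt'] := polytope_dir (- e1).
have ut := uc _ Pt; have ut' := uc _ Pt'.
rewrite -u0 !linearZ linearN /= /GRing.scale /= in ut ut'.
have ue : u e1 = 0 by nra.
have : [set (0 : 'rV[R]_d)] (t *: e1).
  by rewrite e; split=> //; rewrite linearZ /= ue scaler0.
move=> /eqP; rewrite scaler_eq0 gt_eqF //= => /eqP /rowP /(_ (Ordinal d_gt0)).
by rewrite !mxE !eqxx => /eqP; rewrite oner_eq0.
Qed.

Hypothesis P_dual : lattice_polytope (dual_lattice N) (dual_polytope P).

(** The form is a point of the dual polytope, hence a convex combination of dual lattice points,
    each at most 1 on every row. As the combination is 1 on the rows, so is each point of nonzero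
    weight, which therefore is the form itself. *)
Lemma vertex_frame_int B x : vertex_frame B -> N x -> lev B x \is a Num.int.
Proof.
move=> [Bu Bv Bl] Nx; have [u uE] := lev_form B.
have uD : dual_polytope P u by move=> y /Bl; rewrite uE.
have [U [UN UE]] := P_dual.
have Ule w i : [set` U] w -> (w (row i B) : R) <= 1.
  move=> Uw; have : dual_polytope P w by rewrite UE; apply: conv_sub.
  by apply; apply: vertex_mem.
have : conv [set` U] u by rewrite -UE.
move=> [n [a [t [Ua t0 t1 uS]]]]; have [k tk] := sum_pos_index t1.
have ak i : a k (row i B) = 1.
  have [ev evE] := form_of (g := fun w : 'Hom('rV[R]_d, R^o) => w (row i B) : R)
    (fun c x y => etrans (add_lfunE _ _ _) (congr2 +%R (scale_lfunE _ _ _) erefl)).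
  rewrite -evE; apply: (conv_max _ Ua t0 t1 _ tk) => [w Uw|]; rewrite evE ?Ule //.
  by rewrite -uS uE lev_row.
rewrite -(form_lev Bu ak); exact: (UN _ (Ua k)).
Qed.

Lemma vertex_frameP B : frame N V B <-> vertex_frame B.
Proof.
split=> [fB|vB].
  split; first exact: frame_unit fB.
    by move=> i; apply/VP/(frame_row fB).
  move=> y; rewrite polytope_conv_vertices; apply: conv_lev_le => w /=.
  exact: (frame_le1 fB).
have [Bu Bv Bl] := vB; split=> //.
- by move=> i; apply/VP.
- by move=> x; apply: vertex_frame_int.
- by move=> v /VP /vertex_mem; apply: Bl.
- by move=> v /VP vv; apply: vertex_frame_top.
Qed.

(** P is cut out by the inequalities [lev B y <= 1], and the premise provides them for [- y] as
    well. *)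
Lemma vertices_sym :
  (forall B, frame N V B -> forall v, v \in V -> -1 <= lev B v) ->
  forall v, v \in V -> - v \in V.
Proof.
move=> h; have PN y : P y -> P (- y).
  move=> Py; rewrite polytope_conv_vertices; apply: polytopeE => B vB.
  have fB : frame N V B by apply/vertex_frameP.
  rewrite levN lerNl; move: Py; rewrite polytope_conv_vertices => Py.
  have [u uE] := lev_form B.
  have : (- u) y <= 1; last by rewrite opp_lfunE uE lerNl.
  apply: conv_le Py => w /= wV; rewrite opp_lfunE uE lerNl; exact: (h _ fB).
move=> v /VP [u [c [uc e]]]; apply/VP; exists (- u), c; split.
  by move=> y /PN /uc; rewrite opp_lfunE linearN.
apply/seteqP; split=> y /=.
  move=> ->; have [Pv uv] : [set y | P y /\ u y = c] v by rewrite -e.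
  by split; [apply: PN|rewrite opp_lfunE linearN opprK].
rewrite opp_lfunE -linearN => -[/PN Py uy].
have : [set v] (- y) by rewrite e.
by move=> /= <-; rewrite opprK.
Qed.

End Polytope.

(** * Splitting along coordinate blocks *)

Section Block.
Variables (R : realType) (d : nat) (N : set 'rV[R]_d) (C : 'M[R]_d).
Hypothesis LB : lattice_basis N C.
Variables (n : nat) (T : n.-tuple 'I_d).
Hypothesis T_uniq : uniq T.

Let Cu : C \in unitmx := LB.1.
Let T_inj : injective (tnth T). Proof. exact/tuple_uniqP. Qed.

Definition emb (p : 'rV[R]_n) : 'rV[R]_d := \sum_k p 0 k *: row (tnth T k) C.
Definition ext (x : 'rV[R]_d) : 'rV[R]_n := \row_k crd C x (tnth T k).
Definition block_lattice : set 'rV[R]_d :=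
  [set x | N x /\ forall i, i \notin T -> crd C x i = 0].

Lemma emb_is_linear a p q : emb (a *: p + q) = a *: emb p + emb q.
Proof.
rewrite /emb scaler_sumr -big_split /=; apply: eq_bigr => k _.
by rewrite !mxE scalerDl scalerA.
Qed.

Lemma ext_is_linear a x y : ext (a *: x + y) = a *: ext x + ext y.
Proof. by apply/rowP => k; rewrite !mxE crdD crdZ. Qed.

Lemma crd_emb p k : crd C (emb p) (tnth T k) = p 0 k.
Proof.
rewrite crd_sum (bigD1 k) //= big1 ?addr0 => [|j jk].
  by rewrite crdZ crd_row // eqxx mulr1.
by rewrite crdZ crd_row // (inj_eq T_inj) (negbTE jk) mulr0.
Qed.

Lemma crd_emb_out p i : i \notin T -> crd C (emb p) i = 0.
Proof.
move=> iT; rewrite crd_sum big1 // => k _; rewrite crdZ crd_row //.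
by case: eqP => [ki|_]; rewrite ?mulr0 //; move: iT; rewrite -ki mem_tnth.
Qed.

Lemma embK : cancel emb ext.
Proof. by move=> p; apply/rowP => k; rewrite mxE crd_emb. Qed.

Lemma extK x : (forall i, i \notin T -> crd C x i = 0) -> emb (ext x) = x.
Proof.
move=> x0; apply: (crdP Cu) => i; have [|iT] := boolP (i \in T).
  by move=> /tnthP [k ->]; rewrite crd_emb mxE.
by rewrite crd_emb_out // x0.
Qed.

Lemma emb_lattice p : Zlattice R n p -> block_lattice (emb p).
Proof.
move=> pZ; split; last by move=> i; apply: crd_emb_out.
apply/LB.2 => i; have [/tnthP [k ->]|iT] := boolP (i \in T).
  by rewrite crd_emb.
by rewrite crd_emb_out // rpred0.
Qed.

Lemma ext_lattice x : block_lattice x -> Zlattice R n (ext x).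
Proof. by move=> [/LB.2 xi _] k; rewrite mxE. Qed.

Lemma block_is_lattice : is_lattice n block_lattice.
Proof.
pose b := [tuple row (tnth T k) C | k < n].
have bE (k : 'I_n) : b`_k = row (tnth T k) C by rewrite -tnth_nth tnth_mktuple.
exists b; split.
  apply/freeP => c c0 k; have e0 : emb (\row_j c j) = 0.
    by rewrite -[RHS]c0; apply: eq_bigr => j _; rewrite mxE bE.
  have := crd_emb (\row_j c j) k; rewrite e0 crd0 mxE; exact: esym.
apply/seteqP; split=> x /=.
  move=> xN; have xZ := ext_lattice xN.
  have [z zE] : {z : 'I_n -> int & forall k, ext x 0 k = (z k)%:~R}.
    by apply: (choice (P := fun k m => ext x 0 k = m%:~R)) => k; apply/intrP.
  exists z; rewrite -[LHS]extK; last by case: xN.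
  by apply: eq_bigr => k _; rewrite zE scaler_int bE.
move=> [z ->]; have -> : \sum_(k < n) b`_k *~ z k = emb (\row_k (z k)%:~R).
  by apply: eq_bigr => k _; rewrite mxE scaler_int bE.
by apply: emb_lattice => k; rewrite mxE intr_int.
Qed.

Lemma emb_conv (Q : seq 'rV[R]_n) : emb @` conv [set` Q] = conv [set` map emb Q].
Proof.
rewrite (conv_image _ emb_is_linear); congr conv; apply/seteqP.
by split=> [y [p pQ <-]|y /mapP [p pQ ->]]; [apply/mapP; exists p|exists p].
Qed.

(** Exposing forms are carried over by composition with the linear maps [ext] and [emb]. *)
Lemma vertices_emb (K : set 'rV[R]_n) : vertices (emb @` K) = emb @` vertices K.
Proof.
apply/seteqP; split=> v.
  move=> [u [c [uc e]]]; have [[p Kp pv] uv] : [set y | (emb @` K) y /\ u y = c] v.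
    by rewrite -e.
  exists p => //.
  have [w wE] : exists w : 'Hom('rV[R]_n, R^o), forall q, w q = u (emb q).
    by apply: form_of => a x y; rewrite emb_is_linear linearP.
  exists w, c; split; first by move=> q Kq; rewrite wE; apply: uc; exists q.
  apply/seteqP; split=> q /=.
    by move=> ->; rewrite wE pv.
  rewrite wE => -[Kq uq]; have : [set v] (emb q) by rewrite e; split=> //; exists q.
  by move=> /= eq; apply: (can_inj embK); rewrite eq pv.
move=> [p [u [c [uc e]]] <-].
have [Kp up] : [set y | K y /\ u y = c] p by rewrite -e.
have [w wE] : exists w : 'Hom('rV[R]_d, R^o), forall x, w x = u (ext x).
  by apply: form_of => a x y; rewrite ext_is_linear linearP.
exists w, c; split; first by move=> _ [q Kq <-]; rewrite wE embK; apply: uc.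
apply/seteqP; split=> x /=.
  by move=> ->; rewrite wE embK; split=> //; exists p.
move=> [[q Kq <-]]; rewrite wE embK => uq; congr emb.
by have : [set p] q by rewrite e.
Qed.

Lemma block_isomorphic (K : set 'rV[R]_n) :
  isomorphic block_lattice (emb @` K) (Zlattice R n) K.
Proof.
exists ext; split.
- by move=> x y _ _; have := ext_is_linear 1 x y; rewrite !scale1r.
- split.
  + by move=> x; apply: ext_lattice.
  + move=> x y; rewrite !inE => -[_ x0] [_ y0] e.
    by rewrite -(extK x0) -(extK y0) e.
  + by move=> p pZ; exists (emb p); [apply: emb_lattice|apply: embK].
- rewrite vertices_emb; apply/seteqP; split=> p.
    by move=> [_ [q Kq <-] <-]; rewrite embK.
  by move=> Kp; exists (emb p); [exists p|apply: embK].
Qed.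

Lemma block_polytope (Q : seq 'rV[R]_n) : (forall p, p \in Q -> Zlattice R n p) ->
  lattice_polytope block_lattice (emb @` conv [set` Q]).
Proof.
move=> QZ; exists (map emb Q); split; last exact: emb_conv.
by move=> _ /= /mapP [p pQ ->]; apply/emb_lattice/QZ.
Qed.

End Block.

Section DirectSum.
Variables (R : realType) (d : nat) (N : set 'rV[R]_d) (C : 'M[R]_d).
Hypothesis LB : lattice_basis N C.
Variables (k : nat) (blk : 'I_d -> 'I_k) (Ns : 'I_k -> set 'rV[R]_d).
Hypothesis NsE : forall j x, Ns j x <-> N x /\ forall i, blk i != j -> crd C x i = 0.
Hypothesis Ns_lattice : forall j, exists r, is_lattice r (Ns j).

Lemma coordinate_direct_sum : lattice_direct_sum N Ns.
Proof.
have [Cu NC] := LB; split=> //.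
  apply/seteqP; split=> x /=.
    move=> Nx; pose y j := \sum_(i | blk i == j) crd C x i *: row i C.
    have cy j i : crd C (y j) i = if blk i == j then crd C x i else 0.
      rewrite crd_sum; case: ifP => ij.
        rewrite (bigD1 i) //= crdZ crd_row // eqxx mulr1 big1 ?addr0 // => l /andP [_ li].
        by rewrite crdZ crd_row // (negbTE li) mulr0.
      rewrite big1 // => l lj; rewrite crdZ crd_row //.
      by case: eqP => [li|_]; rewrite ?mulr0 //; rewrite -li lj in ij.
    exists y.
      move=> j; apply/NsE; split; last by move=> i ij; rewrite cy (negbTE ij).
      apply/NC => i; rewrite cy; case: ifP => _; last exact: rpred0.
      exact: ((NC x).1 Nx).
    rewrite [RHS](crdE x Cu) (partition_big blk xpredT) //=.
  move=> [y yN <-]; apply/NC => i; rewrite crd_sum rpred_sum // => j _.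
  by have [/NC yi _] := (NsE j (y j)).1 (yN j).
move=> x y xN yN e j; apply: (crdP Cu) => i.
have single (z : 'I_k -> 'rV[R]_d) : (forall j, Ns j (z j)) ->
    crd C (\sum_j z j) i = crd C (z (blk i)) i.
  move=> zN; rewrite crd_sum (bigD1 (blk i)) //= big1 ?addr0 // => l li.
  by have [_ ->] := (NsE l (z l)).1 (zN l); rewrite // eq_sym.
have [ij|ij] := eqVneq (blk i) j; first by rewrite -ij -!single // e.
have [_ x0] := (NsE j (x j)).1 (xN j); have [_ y0] := (NsE j (y j)).1 (yN j).
by rewrite x0 // y0.
Qed.

End DirectSum.

(** * From index blocks to a splitting *)

Section Assembly.
Variables (R : realType) (d : nat) (N P : set 'rV[R]_d) (V : seq 'rV[R]_d).
Variables (C : 'M[R]_d) (n : nat) (T : n.-tuple 'I_d).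
Variables (Q : seq 'rV[R]_d) (Q0 : seq 'rV[R]_n).
Hypotheses (PV : P = conv [set` V]) (hex : hexagons_over N V C T Q).
Hypothesis Q_emb : Q = map (emb C T) Q0.
Hypothesis Q0_Z : forall p, p \in Q0 -> Zlattice R n p.

Definition V2_points : seq 'rV[R]_2 :=
  [:: pt2 R 1 0; pt2 R (-1) 0; pt2 R 0 1; pt2 R 0 (-1); pt2 R 1 (-1); pt2 R (-1) 1].

Lemma V2_points_Z p : p \in V2_points -> Zlattice R 2 p.
Proof.
move=> pV j; have : p 0 j \is a Num.int; last by [].
move: pV; rewrite !inE => /or4P [/eqP ->|/eqP ->|/eqP ->|/or3P [] /eqP ->];
  by rewrite mxE intr_int.
Qed.

Lemma emb_pair a b x y : emb C [tuple a; b] (pt2 R x y) =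
  row a C *~ x + row b C *~ y.
Proof. by rewrite /emb big_ord_recl big_ord1 !mxE /= !scaler_int. Qed.

Lemma hexagons_splits :
  splits_into N P (conv [set` Q0]) ((d - n) %/ 2) (V2 R) /\ ~~ odd (d - n).
Proof.
have [LB T_uniq [f [fP VE]]] := hex.
have [m [rep [card repT rep_ex rep_uniq]]] := involution_pairs T_uniq fP.
rewrite size_tuple in card.
have -> : ((d - n) %/ 2)%N = m by rewrite card addKn mulKn.
split; last by rewrite card addKn oddM.
(* The summand [ord0] receives the indices of the block, every other summand one pair. *)
pose bi j : seq 'I_d :=
  if unlift (ord0 : 'I_m.+1) j is Some k then [:: rep k; f (rep k)] else T.
have biT j i : i \in bi j -> (i \in T) = (j == ord0).
  rewrite /bi; case: unliftP => [k ->|->]; last by move=> ->; rewrite eqxx.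
  have [fkT _ _] := fP _ (repT k).
  by rewrite eq_sym (negbTE (neq_lift _ _)) !inE => /orP [] /eqP ->; apply/negbTE.
have bi_uniq i j j' : i \in bi j -> i \in bi j' -> j = j'.
  move=> ij ij'; have := biT _ _ ij; rewrite (biT _ _ ij').
  move: ij ij'; rewrite /bi; case: unliftP => [k ->|-> _]; last first.
    by move=> _; rewrite eqxx => /eqP.
  case: unliftP => [k' ->|-> _ _]; last by rewrite eqxx => /esym/eqP.
  by move=> h h' _; rewrite (rep_uniq _ _ _ h h').
have bi_ex i : exists j, i \in bi j.
  have [iT|iT] := boolP (i \in T); first by exists ord0; rewrite /bi unlift_none.
  by have [k ik] := rep_ex i iT; exists (lift ord0 k); rewrite /bi liftK.
have [blk blkP] := choice bi_ex.
have blkE i j : (i \in bi j) = (blk i == j).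
  apply/idP/eqP => [ij|<-]; [exact: bi_uniq (blkP i) ij|exact: blkP].
pose Ns j := [set x | N x /\ forall i, i \notin bi j -> crd C x i = 0].
pose Ps j := if unlift (ord0 : 'I_m.+1) j is Some k then
  emb C [tuple rep k; f (rep k)] @` V2 R else emb C T @` conv [set` Q0].
have pair_uniq k : uniq [tuple rep k; f (rep k)].
  have kT := repT k; have [_ fk _] := fP _ kT.
  by rewrite /= inE eq_sym fk.
have Ns0 : Ns ord0 = block_lattice N C T by rewrite /Ns /bi unlift_none.
have Ns1 k : Ns (lift ord0 k) = block_lattice N C [tuple rep k; f (rep k)].
  by rewrite /Ns /bi liftK.
have Ps0 : Ps ord0 = emb C T @` conv [set` Q0] by rewrite /Ps unlift_none.
have Ps1 k : Ps (lift ord0 k) = emb C [tuple rep k; f (rep k)] @` V2 R.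
  by rewrite /Ps liftK.
have QV v : v \in Q -> v \in V by move=> vQ; apply/VE; left.
have ptsE k : map (emb C [tuple rep k; f (rep k)]) V2_points =
    V2_of (row (rep k) C) (row (f (rep k)) C).
  by rewrite /= !emb_pair !mulr1z !mulr0z !mulrN1z !addr0 !add0r [- _ + _]addrC.
have hexV k v : v \in map (emb C [tuple rep k; f (rep k)]) V2_points -> v \in V.
  have kT := repT k; have [fkT _ fk] := fP _ kT.
  rewrite ptsE => vk; apply/VE; right.
  move: vk; rewrite !inE => /or4P [] => [vk|vk|vk|/or3P [] vk].
  - by exists (rep k); rewrite // !inE vk.
  - by exists (rep k); rewrite // !inE vk orbT.
  - by exists (f (rep k)); rewrite // !inE vk.
  - by exists (f (rep k)); rewrite // !inE vk orbT.
  - by exists (f (rep k)); rewrite // fk !inE vk !orbT.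
  - by exists (rep k); rewrite // !inE vk !orbT.
exists Ns, Ps; split.
- split.
  + apply: (coordinate_direct_sum LB (blk := blk)) => [j x|j].
      by rewrite /Ns /=; split=> -[Nx h]; split=> // i ij; apply: h; rewrite ?blkE // -blkE.
    case: (unliftP ord0 j) => [k ->|->]; rewrite ?Ns1 ?Ns0.
      by exists 2%N; apply: block_is_lattice.
    by exists n; apply: block_is_lattice.
  + move=> j; case: (unliftP ord0 j) => [k ->|->]; rewrite ?Ns1 ?Ns0 ?Ps1 ?Ps0.
      by apply: block_polytope => //; apply: V2_points_Z.
    exact: block_polytope.
  + rewrite PV; apply/seteqP; split; last first.
      apply: conv_min; first exact: conv_convex.
      move=> v [j _]; case: (unliftP ord0 j) => [k ->|->]; rewrite ?Ps1 ?Ps0.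
        by rewrite (emb_conv _ _ V2_points); apply: conv_subset => u /= /hexV.
      by rewrite emb_conv -Q_emb; apply: conv_subset.
    apply: conv_subset => v /VE [vQ|[i iT vi]].
      exists ord0 => //; rewrite Ps0 emb_conv -Q_emb; exact: conv_sub.
    have [k ki] := rep_ex i iT.
    exists (lift ord0 k) => //; rewrite Ps1 (emb_conv _ _ V2_points); apply: conv_sub.
    have kT := repT k; have [fkT _ fk] := fP _ kT.
    rewrite ptsE; suff : v \in V2_of (row (rep k) C) (row (f (rep k)) C) by [].
    move: vi ki; rewrite /V2_of /V2t_of /= !inE => vi /orP [] /eqP ik; rewrite ik ?fk in vi;
      by case/or3P: vi => ->; rewrite ?orbT.
- by rewrite Ns0 Ps0; apply: block_isomorphic.
- move=> j; case: (unliftP ord0 j) => [k -> _|->]; last by rewrite eqxx.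
  by rewrite Ns1 Ps1; apply: block_isomorphic.
Qed.

End Assembly.

(** * Lattice coordinates of the model polytopes *)

Section Models.
Variable R : realType.

Lemma set_of_cat (T : eqType) (s1 s2 : seq T) :
  [set` s1 ++ s2] = [set` s1] `|` [set` s2].
Proof.
apply/seteqP; split=> y /=; rewrite mem_cat; first by case/orP; [left|right].
by case=> ->; rewrite ?orbT.
Qed.

Definition V2_points3 : seq 'rV[R]_3 :=
  [:: pt3 R 1 0 0; pt3 R (-1) 0 0; pt3 R 0 1 0; pt3 R 0 (-1) 0;
      pt3 R 1 (-1) 0; pt3 R (-1) 1 0].

(** This brings [Q3] and [Q3'] into the form of a hull of a finite list, as [hexagons_splits]
    requires. *)
Lemma bipyramid_conv (s : seq 'rV[R]_3) :
  conv (V2x0 R `|` [set` s]) = conv [set` V2_points3 ++ s].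
Proof.
have -> : V2x0 R = conv [set` V2_points3].
  rewrite /V2x0 /V2 conv_image => [|a x y]; last first.
    by rewrite scale_row_mx add_row_mx scaler0 addr0.
  have pt a b : row_mx (pt2 R a b) (0 : 'rV[R]_1) = pt3 R a b 0.
    apply/rowP => j; case: (fintype.splitP (j : 'I_(2 + 1))) => k jk.
      have -> : j = lshift 1 k by apply/val_inj.
      by rewrite row_mxEl !mxE /=; case: k {jk} => [[|[|k]] hk].
    have -> : j = rshift 2 k by apply/val_inj.
    by rewrite row_mxEr !mxE ord1.
  have -> : V2_points3 = [seq row_mx v (0 : 'rV[R]_1) | v <- V2_points R].
    by rewrite /= !pt.
  congr conv; apply/seteqP; split=> [y [x xV <-]|y /mapP [x xV ->]].
    by apply/mapP; exists x.
  by exists x.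
by rewrite conv_convU set_of_cat.
Qed.

Lemma emb_triple (d : nat) (C : 'M[R]_d) a b c x y z :
  emb C [tuple a; b; c] (pt3 R x y z) = row a C *~ x + row b C *~ y + row c C *~ z.
Proof.
by rewrite /emb !big_ord_recl big_ord0 !mxE /= !scaler_int addr0 addrA.
Qed.

Lemma Zlattice_all n (s : seq 'rV[R]_n) :
  all (fun p : 'rV[R]_n => [forall j, p 0 j \is a Num.int]) s ->
  forall p, p \in s -> Zlattice R n p.
Proof. by move=> /allP h p /h /forallP. Qed.

Lemma pt2_int x y : [forall j, pt2 R x y 0 j \is a Num.int].
Proof. by apply/forallP => j; rewrite mxE intr_int. Qed.

Lemma pt3_int x y z : [forall j, pt3 R x y z 0 j \is a Num.int].
Proof. by apply/forallP => j; rewrite mxE intr_int. Qed.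

End Models.

Theorem theorem1p2 (R : realType) (d : nat) (hd : (3 <= d)%N)
    (N : set 'rV[R]_d) (hN : is_lattice d N)
    (P : set 'rV[R]_d) (hsimp : simplicial P) (hrefl : reflexive_polytope N P)
    (hvert : (vertices P #= `I_(3 * d - 1))%card) :
  (~~ odd d ->
     splits_into N P (V2t R) ((d - 2) %/ 2) (V2 R) \/
     splits_into N P (E1 R) ((d - 2) %/ 2) (V2 R) \/
     splits_into N P (E2 R) ((d - 2) %/ 2) (V2 R)) /\
  (odd d ->
     splits_into N P (Q3 R) ((d - 3) %/ 2) (V2 R) \/
     splits_into N P (Q3' R) ((d - 3) %/ 2) (V2 R)).
Proof.
have [Pdim [s [sN PE]] P0 Pdual] := hrefl.
have d0 : (0 < d)%N by apply: leq_trans hd.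
pose V : seq 'rV[R]_d := enum_fset (fset_set (vertices P)).
have Pfin : finite_set (vertices P) by exists (3 * d - 1)%N.
have VP v : v \in V <-> vertices P v.
  have -> : (v \in V) = (v \in fset_set (vertices P)) by [].
  by rewrite in_fset_set //; split=> [/set_mem|/mem_set].
have V_uniq : uniq V by apply: fset_uniq.
have V_size : size V = (3 * d - 1)%N by have := card_fset_set hvert; rewrite cardfE.
have frameP := vertex_frameP d0 PE Pdim hsimp P0 VP Pdual.
(* A neighbour is chosen for all pairs at once, with the dummy value 0 where B is not a frame. *)
have [nb nbP] : {nb : 'M[R]_d * 'I_d -> 'rV[R]_d & forall Bi, frame N V Bi.1 ->
    [/\ nb Bi \in V, crd Bi.1 (nb Bi) Bi.2 < 0 & frame N V (repl Bi.1 Bi.2 (nb Bi))]}.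
  apply: (choice (P := fun Bi w => frame N V Bi.1 ->
    [/\ w \in V, crd Bi.1 w Bi.2 < 0 & frame N V (repl Bi.1 Bi.2 w)])) => -[B i] /=.
  have [/frameP vB|] := pselect (frame N V B); last by exists 0.
  have [w [/VP wV wi vw]] := vertex_frame_nb d0 PE Pdim hsimp P0 i vB.
  by exists w => _; split=> //; apply/frameP.
have [b [_ NE]] := hN.
have N0 : N 0.
  by rewrite NE; exists (fun=> 0); rewrite big1 // => i _; rewrite mulr0z.
have ND x y : N x -> N y -> N (x + y).
  rewrite NE => -[z ->] [z' ->]; exists (fun i => z i + z' i).
  by rewrite -big_split; apply: eq_bigr => i _; rewrite mulrzDr.
have NN x : N x -> N (- x).
  rewrite NE => -[z ->]; exists (fun i => - z i).
  by rewrite -sumrN; apply: eq_bigr => i _; rewrite mulrNz.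
have VN v : v \in V -> N v.
  by move=> /VP /(vertex_in_gen PE) /sN.
have PV := polytope_conv_vertices d0 PE Pdim hsimp P0 VP.
have nb1 B i : frame N V B -> nb (B, i) \in V by move=> /(nbP (B, i)) [].
have nb2 B i : frame N V B -> crd B (nb (B, i)) i < 0 by move=> /(nbP (B, i)) [].
have nb3 B i : frame N V B -> frame N V (adj (fun B i => nb (B, i)) B i).
  by move=> /(nbP (B, i)) [].
have special_ex : exists B, frame N V B /\ special V B.
  have [B [/frameP fB sB]] := vertex_frame_cone d0 PE Pdim hsimp P0 VP (nu V).
  by exists B.
have sym := vertices_sym d0 PE Pdim hsimp P0 VP Pdual.
(* By [hexagons_splits] the dimension minus the block size is even, so the parity of d decides
   between blocks of two and of three indices. *)
have even2 : ~~ odd (d - 2) = ~~ odd d by rewrite oddB ?(ltnW hd) //= addbF.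
have odd3 : ~~ odd (d - 3) = odd d by rewrite oddB //= addbT negbK.
case: (hexagons_over_cases VN V_uniq (zero_not_vertex d0 P0 VP) V_size
    nb1 nb2 nb3 N0 ND NN hd special_ex sym) => [[C [a [b' h]]]|[C [a [b' [c h]]]]].
- have split2 (Q0 : seq 'rV[R]_2) (Q : seq 'rV[R]_d) :
      Q = map (emb C [tuple a; b']) Q0 ->
      (forall p, p \in Q0 -> Zlattice R 2 p) -> hexagons_over N V C [:: a; b'] Q ->
      splits_into N P (conv [set` Q0]) ((d - 2) %/ 2) (V2 R) /\ ~~ odd d.
    by move=> QE QZ hQ; rewrite -even2; apply: (hexagons_splits PV (T := [tuple a; b'])) hQ QE QZ.
  suff [S dE] : (splits_into N P (V2t R) ((d - 2) %/ 2) (V2 R) \/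
      splits_into N P (E1 R) ((d - 2) %/ 2) (V2 R) \/
      splits_into N P (E2 R) ((d - 2) %/ 2) (V2 R)) /\ ~~ odd d.
    by split=> // dO; rewrite dO in dE.
  case: h => /split2 h.
  + have [||S dE] := h [:: pt2 R 1 0; pt2 R (-1) 0; pt2 R 0 1; pt2 R 0 (-1); pt2 R 1 (-1)].
    * by rewrite /= !emb_pair !mulr1z !mulr0z !mulrN1z !addr0 !add0r.
    * by apply: Zlattice_all; rewrite /= !pt2_int.
    by split=> //; left.
  + have [||S dE] := h [:: pt2 R 1 0; pt2 R 1 1; pt2 R 0 1; pt2 R (-1) (-1); pt2 R (-1) (-2)].
    * by rewrite /= !emb_pair !mulr1z !mulr0z !mulrN1z !addr0 !add0r mulrNz.
    * by apply: Zlattice_all; rewrite /= !pt2_int.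
    by split=> //; right; left.
  + have [||S dE] := h [:: pt2 R 1 0; pt2 R 0 1; pt2 R (-1) 1; pt2 R (-1) (-1); pt2 R 1 (-1)].
    * by rewrite /= !emb_pair !mulr1z !mulr0z !mulrN1z !addr0 !add0r [- _ + _]addrC.
    * by apply: Zlattice_all; rewrite /= !pt2_int.
    by split=> //; right; right.
have split3 (s3 : seq 'rV[R]_3) (Q : seq 'rV[R]_d) :
    Q = map (emb C [tuple a; b'; c]) (V2_points3 R ++ s3) ->
    (forall p, p \in V2_points3 R ++ s3 -> Zlattice R 3 p) ->
    hexagons_over N V C [:: a; b'; c] Q ->
    splits_into N P (conv (V2x0 R `|` [set` s3])) ((d - 3) %/ 2) (V2 R) /\ odd d.
  move=> QE QZ hQ; rewrite -odd3 bipyramid_conv.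
  exact: (hexagons_splits PV (T := [tuple a; b'; c])) hQ QE QZ.
suff [S dO] : (splits_into N P (Q3 R) ((d - 3) %/ 2) (V2 R) \/
    splits_into N P (Q3' R) ((d - 3) %/ 2) (V2 R)) /\ odd d.
  by split=> // dE; rewrite dO in dE.
case: h => /split3 h.
- have [||S dO] := h [:: pt3 R 0 0 1; pt3 R 0 0 (-1)].
  + by rewrite /= !emb_triple !mulr1z !mulr0z !mulrN1z !addr0 !add0r [- _ + _]addrC.
  + by apply: Zlattice_all; rewrite /= !pt3_int.
  by split=> //; left.
have [||S dO] := h [:: pt3 R 0 0 1; pt3 R 1 0 (-1)].
- by rewrite /= !emb_triple !mulr1z !mulr0z !mulrN1z !addr0 !add0r [- _ + _]addrC.
- by apply: Zlattice_all; rewrite /= !pt3_int.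
by split=> //; right.
Qed.
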